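(* Let $H$ be a locally compact second countable group with left Haar measure $m_H$ and a proper left-invariant metric $d$, and assume $(H,d)$ has sub-exponential growth, i.e. $\limsup_{r\to\infty} \frac{\log m_H(B_d(e,r))}{r}=0$, where $B_d(e,r)$ is the $d$-ball of radius $r$ about the identity $e$. Let $(F_T)$ be a right Følner sequence in $H$ with $m_H(F_T)\to\infty$. Suppose $H$ acts on a probability space $(X,\mu)$ and this action is exponentially mixing of all orders on an $H$-invariant subalgebra $\mathcal{A}$ of $L^\infty(X,\mu)$ with respect to $d$ and a family of seminorms $(N_s)$ as described in the context. Then for every $f\in\mathcal{A}$ with $\mu(f)=0$, $$\frac{1}{m_H(F_T)^{1/2}}\int_{F_T} (f\circ h^{-1})\,dm_H(h)\implies N(0,\sigma_f^2)\quad\text{as } T\to\infty,$$ where $\sigma_f^2=\int_H \langle f, f\circ h^{-1}\rangle\,dm_H(h)$, and $\implies$ denotes convergence in distribution of functions on $(X,\mu)$.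
   Context: A sequence $(F_T)$ of compact subsets of $H$ with non-empty interior is right Følner if $m_H(F_T\triangle F_Th)/m_H(F_T)\to 0$ for all $h\in H$. The action of $H$ on $(X,\mu)$ is jointly measurable and measure-preserving; $H$ acts on functions by $h\cdot f=f\circ h^{-1}$. $\mathcal{A}\subset L^\infty(X,\mu)$ is an $H$-invariant subalgebra and $(N_s)_{s\ge1}$ is a family of seminorms on $\mathcal{A}$ such that for all $s\ge1$, all $f,f_1,f_2\in\mathcal{A}$ and $h\in H$ (implied constants depending only on $s$): $N_s(f)\ll N_{s+1}(f)$; $\|f\|_{L^\infty}\ll N_s(f)$; there is $\sigma_s>0$ with $N_s(h\cdot f)\ll e^{\sigma_s d(h,e)}N_s(f)$; and $N_s(f_1f_2)\ll N_{s+1}(f_1)N_{s+1}(f_2)$. Exponential mixing of all orders means: for every integer $r\ge2$ there exist $\delta_r>0$ and an integer $s_r>0$ such that for all $s>s_r$, all $f_1,\dots,f_r\in\mathcal{A}$ and all $h_1,\dots,h_r\in H$, $$\Big|\mu\Big(\prod_{i=1}^r h_i\cdot f_i\Big)-\prod_{i=1}^r\mu(f_i)\Big|\le C_{r,s}\, e^{-\delta_r \min_{i\ne j} d(h_i,h_j)}\prod_{i=1}^r N_s(f_i),$$ with $C_{r,s}$ depending only on $r,s$. *)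

(* Defs.v *)
From HB Require Import structures.
From mathcomp Require Import all_boot all_order all_algebra.
From mathcomp Require Import all_classical all_reals all_analysis.
Set Implicit Arguments. Unset Strict Implicit. Unset Printing Implicit Defensive.
Import Order.TTheory GRing.Theory Num.Theory.
Import numFieldNormedType.Exports.
Local Open Scope classical_set_scope.
Local Open Scope ring_scope.

Definition borel_of (H : ptopologicalType) := g_sigma_algebraType (@open H).

Section Defs.
Context (R : realType) (H : ptopologicalType).
Notation BH := (borel_of H).

Definition is_group (mul : H -> H -> H) (inv : H -> H) (e : H) :=
  [/\ forall x y z, mul x (mul y z) = mul (mul x y) z,
      forall x, mul e x = x /\ mul x e = x &
      forall x, mul (inv x) x = e /\ mul x (inv x) = e].

Definition lcsc_group (mul : H -> H -> H) (inv : H -> H) (e : H) :=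
  [/\ is_group mul inv e,
      continuous (fun p : H * H => mul p.1 p.2),
      continuous inv,
      hausdorff_space H &
      locally_compact [set: H] /\ @second_countable H].

(* left Haar measure: nonzero, left invariant, Radon (finite on compact sets;
   on an lcsc space such Borel measures are automatically regular) *)
Definition left_Haar (mul : H -> H -> H) (mH : {measure set BH -> \bar R}) :=
  [/\ forall (g : H) (A : set BH), measurable A -> mH (mul g @` A) = mH A,
      forall K : set H, compact K -> (mH K < +oo)%E &
      (0 < mH [set: BH])%E].

Definition dball (d : H -> H -> R) (x : H) (r : R) : set H := [set y | d x y < r].

Definition proper_left_inv_metric (mul : H -> H -> H) (d : H -> H -> R) :=
  [/\ forall x y, d x y = 0 <-> x = y,
      forall x y, d x y = d y x,
      forall x y z, d x z <= d x y + d y z &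
      [/\ forall g x y, d (mul g x) (mul g y) = d x y,
          continuous (fun p : H * H => d p.1 p.2) &
          forall x r, compact [set y | d x y <= r]]].

Definition subexp_growth (mH : {measure set BH -> \bar R}) (d : H -> H -> R)
    (e : H) :=
  limf_esup (fun r : R => (ln (fine (mH (dball d e r))) / r)%:E)
            (@pinfty_nbhs R) = 0%E.

Definition right_Folner (mul : H -> H -> H) (mH : {measure set BH -> \bar R})
    (F : nat -> set H) :=
  [/\ forall T, compact (F T),
      forall T, interior (F T) !=set0 &
      forall h : H,
        (fine (mH ((F T `\` (fun x => mul x h) @` F T) `|`
                    ((fun x => mul x h) @` F T `\` F T)))
          / fine (mH (F T))) @[T --> \oo] --> (0 : R)].

(* minimum over i != j of d(h_i, h_j) (for r >= 2; the default value is the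
   maximum over all pairs, which is never smaller than this minimum) *)
Definition max_dist (d : H -> H -> R) (r : nat) (h : 'I_r -> H) : R :=
  \big[Num.max/0]_(p : 'I_r * 'I_r) d (h p.1) (h p.2).
Definition min_dist (d : H -> H -> R) (r : nat) (h : 'I_r -> H) : R :=
  \big[Num.min/max_dist d h]_(p : 'I_r * 'I_r | p.1 != p.2) d (h p.1) (h p.2).

End Defs.

Section ActionDefs.
Context (R : realType) (H : ptopologicalType) (dX : measure_display)
        (X : measurableType dX).
Notation BH := (borel_of H).

Definition mp_action (mul : H -> H -> H) (e : H) (mu : probability X R)
    (a : H -> X -> X) :=
  [/\ measurable_fun [set: BH * X] (fun p : BH * X => a p.1 p.2),
      forall x, a e x = x,
      forall g h x, a (mul g h) x = a g (a h x) &
      forall h (A : set X), measurable A -> mu (a h @^-1` A) = mu A].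

Definition act_fun (inv : H -> H) (a : H -> X -> X) (h : H) (f : X -> R) : X -> R :=
  fun x => f (a (inv h) x).

Definition mexp (mu : probability X R) (f : X -> R) : R := Rintegral mu setT f.

(* Ainv is an H-invariant subalgebra of L^oo(X, mu) (functions given by
   representatives) *)
Definition inv_subalgebra (inv : H -> H) (a : H -> X -> X) (mu : probability X R)
    (Ainv : set (X -> R)) :=
  [/\ forall f, Ainv f -> measurable_fun [set: X] f /\
                  exists M : R, {ae mu, forall x, `|f x| <= M},
      Ainv (fun _ => 0),
      forall f g, Ainv f -> Ainv g -> Ainv (f \+ g) &
      [/\ forall (c : R) f, Ainv f -> Ainv (fun x => c * f x),
      forall f g, Ainv f -> Ainv g -> Ainv (f \* g) &
      forall h f, Ainv f -> Ainv (act_fun inv a h f)]].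

Definition good_seminorms (d : H -> H -> R) (e : H) (inv : H -> H)
    (a : H -> X -> X) (mu : probability X R) (Ainv : set (X -> R))
    (N : nat -> (X -> R) -> R) :=
  forall s : nat, (1 <= s)%N ->
  [/\ forall f, Ainv f -> 0 <= N s f,
      forall f g, Ainv f -> Ainv g -> N s (f \+ g) <= N s f + N s g,
      forall (c : R) f, Ainv f -> N s (fun x => c * f x) = `|c| * N s f &
      [/\ exists C : R, forall f, Ainv f -> N s f <= C * N s.+1 f,
      exists C : R, forall f, Ainv f -> {ae mu, forall x, `|f x| <= C * N s f},
      exists2 sigma : R, 0 < sigma & exists C : R, forall f h, Ainv f ->
          N s (act_fun inv a h f) <= C * expR (sigma * d h e) * N s f &
      exists C : R, forall f1 f2, Ainv f1 -> Ainv f2 ->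
          N s (f1 \* f2) <= C * N s.+1 f1 * N s.+1 f2]].

Definition exp_mixing_all_orders (d : H -> H -> R) (inv : H -> H)
    (a : H -> X -> X) (mu : probability X R) (Ainv : set (X -> R))
    (N : nat -> (X -> R) -> R) :=
  forall r : nat, (2 <= r)%N ->
  exists2 delta : R, 0 < delta & exists s_r : nat, (0 < s_r)%N /\
  forall s : nat, (s_r < s)%N -> exists C : R,
  forall (f : 'I_r -> X -> R) (h : 'I_r -> H), (forall i, Ainv (f i)) ->
    `| mexp mu (fun x => \prod_(i < r) act_fun inv a (h i) (f i) x)
       - \prod_(i < r) mexp mu (f i) |
    <= C * expR (- delta * min_dist d h) * \prod_(i < r) N s (f i).

(* expectation of phi under N(0, v) (v = 0: Dirac mass at 0) *)
Definition normal_expect (v : R) (phi : R -> R) : R :=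
  if v == 0 then phi 0
  else Rintegral lebesgue_measure setT
         (fun t => phi t * normal_pdf 0 (Num.sqrt v) t).

(* Y_T ==> N(0, v) in distribution on (X, mu) (v >= 0 required for
   N(0, v) to make sense) *)
Definition cvg_dist_normal (mu : probability X R) (Y : nat -> X -> R) (v : R) :=
  0 <= v /\
  forall phi : R -> R, continuous phi -> (exists M : R, forall t, `|phi t| <= M) ->
    (mexp mu (fun x => phi (Y T x))) @[T --> \oo] --> normal_expect v phi.

End ActionDefs.

(* Main.v *)
Require Import Defs.
From HB Require Import structures.
From mathcomp Require Import all_boot all_order all_algebra.
From mathcomp Require Import all_classical all_reals all_analysis.
From mathcomp Require Import measurable_realfun ring lra.
Set Implicit Arguments.
Unset Strict Implicit.
Unset Printing Implicit Defensive.
Import Order.TTheory GRing.Theory Num.Theory.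
Import numFieldNormedType.Exports.
Local Open Scope classical_set_scope.
Local Open Scope ring_scope.

(** Method of moments.  Put [Z = \int_F f(h^-1 x) dh] and [Y = Z / sqrt (m F)].

    Mixing of all orders yields a decoupling estimate: two families of
    translates of [f] at distance [b] from each other are independent up to
    [O (exp (- c b))].  Fix [h] in [F] and split [Z = D + W], where [W] only
    integrates over the ball of radius [2 b] about [h].  Expanding [Z ^ r]
    around [D] and decoupling gives
      [E (u_h Z^r) = r E (u_h Z) E (Z^(r-1)) + error],  [u_h = f o h^-1],
    with an error [O (exp (- c b) (m F)^r + m (B_2b)^2 E (|Z| + C m (B_2b))^(r-2))].
    With [b] a large multiple of [ln (m F)], subexponential growth makes
    [m (B_2b)] smaller than any power of [m F]; integrating over [h] then gives
      [E (Y^(r+1)) = r E (Y^2) E (Y^(r-1)) + o(1)].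
    The Folner property gives [E (Y^2) -> sigma_f^2], so all moments of [Y]
    converge to Gaussian moments.  These grow slowly enough for Taylor's formula
    to give the convergence of [E (cos (t Y + c))], and trigonometric polynomials
    approximate any bounded continuous function up to [eps (1 + y^2)]. *)

(** * Integrals of bounded functions and Fubini *)

(** The exponents shape the construction. After integration over [h] and division by
    [(m F) ^ ((r+1)/2)], the decoupling error becomes [exp (- c b) (m F) ^ ((r+1)/2)], so the
    multiple of [ln (m F)] chosen for [b] grows with [r]. The error due to [W] becomes
    [m (B_2b)^2 (m F) ^ (-1/2)] times a moment of [Y]: half a power of [m F] has to pay for the
    ball, however large the multiple is, and this is where subexponential growth enters. Mixing is
    informative only for mutually separated points, whereas each of the two families to be decoupled
    may contain arbitrarily close ones; this is the main obstacle to the decoupling estimate.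
    Singling out one point [h] at a time avoids any sum over the cluster configurations of an
    [r]-tuple: the moment left in the error has order at most [r - 1], so the induction controls it.
    In the last step the weight [1 + y^2] lets bounded second moments play the role of tightness. *)

Section bounded_integrals.
Context (R : realType) (dT : measure_display) (T : measurableType dT)
  (m : {measure set T -> \bar R}).

Lemma integrable_bounded (D : set T) (f : T -> R) (M : R) : measurable D ->
  (m D < +oo)%E -> measurable_fun D f -> (forall x, D x -> `|f x| <= M) ->
  m.-integrable D (EFin \o f).
Proof.
move=> mD mDoo mf fM; apply: measurable_bounded_integrable => //.
exists M; split; first exact: num_real.
by move=> y My x Dx; apply: le_trans (fM _ Dx) _; exact: ltW.
Qed.

Lemma normr_Rintegral_le (D : set T) (f : T -> R) (M : R) : measurable D ->
  (m D < +oo)%E -> measurable_fun D f -> (forall x, D x -> `|f x| <= M) ->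
  `|Rintegral m D f| <= M * fine (m D).
Proof.
move=> mD mDoo mf fM.
have fi := integrable_bounded mD mDoo mf fM.
apply: (le_trans (le_normr_Rintegral mD fi)).
rewrite -(Rintegral_cst m mD); apply: le_Rintegral => //.
- exact: (@integrable_norm _ _ _ m D f).
- apply: (@integrable_bounded _ _ `|M|) => //.
Qed.

End bounded_integrals.

Section ae_bounded_expectation.
Context (R : realType) (dT : measure_display) (T : measurableType dT)
  (mu : probability T R).

Lemma integrable_ae_bounded (f : T -> R) (M : R) : measurable_fun setT f ->
  {ae mu, forall x, `|f x| <= M} -> mu.-integrable setT (EFin \o f).
Proof.
move=> mf fM; apply/integrableP; split; first exact/measurable_EFinP.
apply: (@le_lt_trans _ _ (\int[mu]_x (`|M|%:E))%E).
  apply: ae_ge0_le_integral => //.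
  - by apply: measurableT_comp => //; exact/measurable_EFinP.
  - apply: filterS fM => x fx _ /=; rewrite lee_fin.
    by rewrite (le_trans fx)// ler_norm.
by rewrite integral_cst// [X in (_ * X)%E](_ : _ = 1%E) ?mule1 ?ltry//; exact: probability_setT.
Qed.

Lemma normr_mexp_le (f : T -> R) (M : R) : measurable_fun setT f ->
  {ae mu, forall x, `|f x| <= M} -> `|mexp mu f| <= M.
Proof.
move=> mf fM.
have fi := integrable_ae_bounded mf fM.
(* A negative [M] would make the exceptional set the whole space, which has measure 1. *)
have M0 : 0 <= M.
  rewrite leNgt; apply/negP => M0.
  have /(negligibleP _ measurableT) mu0 : mu.-negligible [set: T].
    case: fM => A [mA A0 sA]; exists A; split => // x _; apply: sA => /= fx.
    by have := le_lt_trans (normr_ge0 _) (le_lt_trans fx M0); rewrite ltxx.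
  have /eqP := etrans (esym (probability_setT mu)) mu0.
  by rewrite eqe oner_eq0.
rewrite /mexp -lee_fin (EFin_normr_Rintegral measurableT fi).
apply: (le_trans (le_abse_integral mu measurableT (measurable_int _ fi))).
apply: (@le_trans _ _ (\int[mu]_x (M%:E))%E).
  apply: ae_ge0_le_integral => //.
  - by apply: measurableT_comp => //; exact/measurable_EFinP.
  - by apply: filterS fM => x fx _ /=; rewrite lee_fin.
by rewrite integral_cst// [X in (_ * X)%E](_ : _ = 1%E) ?mule1//; exact: probability_setT.
Qed.

Lemma mexp_cst (r : R) : mexp mu (fun=> r) = r.
Proof.
rewrite /mexp Rintegral_cst// [X in fine X](_ : _ = 1%E) ?mulr1//.
exact: probability_setT.
Qed.

Lemma eq_mexp_ae (f g : T -> R) : measurable_fun setT f ->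
  measurable_fun setT g -> {ae mu, forall x, f x = g x} ->
  mexp mu f = mexp mu g.
Proof.
move=> mf mg fg; rewrite /mexp /Rintegral; congr fine.
apply: ae_eq_integral => //; [exact/measurable_EFinP|exact/measurable_EFinP|].
by apply: filterS fg => x -> _.
Qed.

End ae_bounded_expectation.

Section Fubini_Rintegral.
Context (R : realType) (d1 d2 : measure_display) (T1 : measurableType d1)
  (T2 : measurableType d2) (m1 : {sigma_finite_measure set T1 -> \bar R})
  (m2 : {sigma_finite_measure set T2 -> \bar R}).
Context (D1 : set T1) (D2 : set T2) (u : T1 -> T2 -> R) (M : R).
Context (mD1 : measurable D1) (mD2 : measurable D2)
  (m1D : (m1 D1 < +oo)%E) (m2D : (m2 D2 < +oo)%E)
  (mu : measurable_fun [set: T1 * T2] (fun p => u p.1 p.2))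
  (uM : forall x y, `|u x y| <= M).

(** Extension by zero off the rectangle: a bounded function on a set of finite measure becomes
    integrable on the whole product, where Fubini applies. *)
Let v (p : T1 * T2) : R := ((fun p => u p.1 p.2) \_ (D1 `*` D2)) p.

Let mD12 : measurable (D1 `*` D2). Proof. exact: measurableX. Qed.

Let mv : measurable_fun setT v.
Proof.
by rewrite -(measurable_restrictT _ mD12); exact: measurable_funTS.
Qed.

Let iv : (m1 \x m2)%E.-integrable setT (EFin \o v).
Proof.
have -> : EFin \o v = (EFin \o (fun p => u p.1 p.2)) \_ (D1 `*` D2).
  by rewrite restrict_EFin.
rewrite -integrable_mkcond//; apply: (@integrable_bounded _ _ _ _ _ _ M) => //.
- by rewrite /= product_measure1E// lte_mul_pinfty// ge0_fin_numE.
- exact: measurable_funTS.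
Qed.

Let vE x y : v (x, y) = ((fun x => ((u x) \_ D2) y) \_ D1) x.
Proof.
rewrite /v !patchE; case: ifPn => [|/negP xy].
  by rewrite inE => -[/= ? ?]; rewrite !mem_set.
case: ifPn => // xD; case: ifPn => // yD; exfalso; apply: xy.
by move: xD yD; rewrite !inE.
Qed.

Let FE x : fubini_F m2 (EFin \o v) x =
  (((fun x => Rintegral m2 D2 (u x)) \_ D1) x)%:E.
Proof.
rewrite /fubini_F /= patchE; under eq_integral do rewrite vE patchE.
case: ifPn => xD; last by rewrite integral0.
rewrite Rintegral_mkcond fineK//.
apply: integrable_fin_num => //.
suff : m2.-integrable setT ((EFin \o u x) \_ D2) by rewrite restrict_EFin.
rewrite -integrable_mkcond//.
apply: (@integrable_bounded _ _ _ _ _ _ M) => //.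
by apply: measurable_funTS; exact: measurableT_comp mu (pair1_measurable x).
Qed.

Let GE y : fubini_G m1 (EFin \o v) y =
  (((fun y => Rintegral m1 D1 (u ^~ y)) \_ D2) y)%:E.
Proof.
rewrite /fubini_G /= patchE; under eq_integral do rewrite vE.
case: ifPn => yD; last first.
  rewrite integral0_eq// => x _; rewrite patchE; case: ifPn => // _.
  by rewrite patchE (negbTE yD).
transitivity (\int[m1]_x (((u ^~ y) \_ D1) x)%:E)%E.
  by apply: eq_integral => x _; rewrite !patchE yD.
rewrite Rintegral_mkcond fineK//.
apply: integrable_fin_num => //.
suff : m1.-integrable setT ((EFin \o u ^~ y) \_ D1) by rewrite restrict_EFin.
rewrite -integrable_mkcond//.
apply: (@integrable_bounded _ _ _ _ _ _ M) => //.
by apply: measurable_funTS; exact: measurableT_comp mu (pair2_measurable y).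
Qed.

Lemma measurable_Rintegral1 : measurable_fun D2 (fun y => Rintegral m1 D1 (u ^~ y)).
Proof.
apply/(measurable_restrictT _ mD2)/measurable_EFinP.
have := measurable_fubini_G iv.
by congr measurable_fun; apply/funext => y; rewrite GE.
Qed.

Lemma measurable_Rintegral2 : measurable_fun D1 (fun x => Rintegral m2 D2 (u x)).
Proof.
apply/(measurable_restrictT _ mD1)/measurable_EFinP.
have := measurable_fubini_F iv.
by congr measurable_fun; apply/funext => y; rewrite FE.
Qed.

Lemma Fubini_Rintegral :
  Rintegral m1 D1 (fun x => Rintegral m2 D2 (u x)) =
  Rintegral m2 D2 (fun y => Rintegral m1 D1 (u ^~ y)).
Proof.
rewrite Rintegral_mkcond [RHS]Rintegral_mkcond /Rintegral; congr fine.
transitivity (\int[m1]_x fubini_F m2 (EFin \o v) x)%E.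
  by apply: eq_integral => x _; rewrite FE.
rewrite (Fubini iv); by apply: eq_integral => y _; rewrite -GE.
Qed.

End Fubini_Rintegral.

(** * Decoupling from mixing of all orders *)

Lemma not_all_split (T : Type) (P : pred T) (s : seq T) : ~~ all P s ->
  exists B q C, s = B ++ q :: C /\ ~~ P q.
Proof.
elim: s => //= x s IH; rewrite negb_and => /orP[nPx|/IH[B [q [C [-> nPq]]]]].
  by exists [::], x, s.
by exists (x :: B), q, C.
Qed.

(** Exposes the two close points that the induction in [decoupling] merges. *)
Lemma not_pairwise_split (T : Type) (r : rel T) (s : seq T) : ~~ pairwise r s ->
  exists A p B q C, s = A ++ p :: B ++ q :: C /\ ~~ r p q.
Proof.
elim: s => //= x s IH; rewrite negb_and => /orP[/not_all_split|/IH].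
  by move=> [B [q [C [-> nPq]]]]; exists [::], x, B, q, C.
by move=> [A [p [B [q [C [-> nr]]]]]]; exists (x :: A), p, B, q, C.
Qed.

Lemma ler_prod_seq (R : realType) (T : Type) (P : pred T) (F G : T -> R)
    (s : seq T) : (forall x, P x -> 0 <= F x <= G x) -> all P s ->
  0 <= \prod_(x <- s) F x <= \prod_(x <- s) G x.
Proof.
move=> FG; elim: s => [|x s IH] /=; first by rewrite !big_nil lexx ler01.
move=> /andP[/FG /andP[F0 FGx] /IH /andP[F1 FG1]].
by rewrite !big_cons mulr_ge0//= ler_pM.
Qed.

Section decoupling.
Context (R : realType) (H : ptopologicalType)
  (mul : H -> H -> H) (inv : H -> H) (e : H) (d : H -> H -> R)
  (dX : measure_display) (X : measurableType dX) (mu : probability X R)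
  (a : H -> X -> X) (Ainv : set (X -> R)) (N : nat -> (X -> R) -> R).
Context (grpH : is_group mul inv e) (metH : proper_left_inv_metric mul d)
  (actH : mp_action mul e mu a) (algH : inv_subalgebra inv a mu Ainv)
  (normH : good_seminorms d e inv a mu Ainv N)
  (mixH : exp_mixing_all_orders d inv a mu Ainv N).

Lemma grp_invM g h : inv (mul g h) = mul (inv h) (inv g).
Proof.
case: grpH => mulA mul1 mulV.
rewrite -[RHS](mul1 _).2 -(mulV (mul g h)).2 mulA.
rewrite -(mulA (inv h)) (mulA (inv g)) (mulV g).1 (mul1 h).1 (mulV h).1.
by rewrite (mul1 _).1.
Qed.

Lemma grp_mulVK g h : mul g (mul (inv g) h) = h.
Proof. by case: grpH => mulA mul1 mulV; rewrite mulA (mulV g).2 (mul1 h).1. Qed.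

Lemma dist_ge0 x y : 0 <= d x y.
Proof.
case: metH => d0 dC dT _; have := dT x y x.
by rewrite (d0 x x).2// (dC y x) -mulr2n pmulrn_lge0.
Qed.

Lemma dist_mulV g h : d (mul (inv g) h) e = d g h.
Proof.
case: grpH => mulA mul1 mulV; case: metH => _ dC _ [dI _ _].
by rewrite dC -(dI g) grp_mulVK (mul1 g).2.
Qed.

Lemma act_fun_mul g h (f : X -> R) : act_fun inv a g (act_fun inv a h f) =
  act_fun inv a (mul g h) f.
Proof.
by case: actH => _ _ aM _; apply/funext => x; rewrite /act_fun grp_invM aM.
Qed.

Lemma measurable_act g : measurable_fun setT (a g).
Proof.
case: actH => ma _ _ _.
exact: (measurableT_comp ma (pair1_measurable (g : borel_of H))).
Qed.

Lemma ae_act g (P : X -> Prop) : {ae mu, forall x, P x} ->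
  {ae mu, forall x, P (a g x)}.
Proof.
case: actH => _ _ _ aI [A [mA A0 sA]]; exists (a g @^-1` A); split.
- by rewrite -[X in measurable X]setTI; apply: measurable_act.
- by rewrite aI.
- by move=> x /= nP; apply: sA => /= Px; apply: nP.
Qed.

Lemma mexp_act g (f : X -> R) (M : R) : measurable_fun setT f ->
  {ae mu, forall x, `|f x| <= M} -> mexp mu (fun x => f (a g x)) = mexp mu f.
Proof.
move=> mf fM; rewrite /mexp /Rintegral; congr fine.
have mag := measurable_act g.
transitivity (\int[pushforward mu (a g)]_x (f x)%:E)%E.
  rewrite (@integral_pushforward _ _ _ _ _ _ mag mu setT (EFin \o f)) ?preimage_setT//.
    exact/measurable_EFinP.
  apply: (@integrable_ae_bounded _ _ _ mu (f \o a g) M).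
    exact: measurableT_comp.
  exact: (ae_act g fM).
by apply: eq_measure_integral => A mA _; case: actH => _ _ _ aI; exact: aI.
Qed.

(** A pair stands for the translate of its function by its group element. Each point carries its own
    function so that a merged pair of points is again a point. *)
Let pt := (H * (X -> R))%type.

Definition point_prod (L : seq pt) (x : X) : R :=
  \prod_(p <- L) act_fun inv a p.1 p.2 x.

Definition corr (L : seq pt) : R := mexp mu (point_prod L).

Definition in_alg (p : pt) : bool := `[< Ainv p.2 >].

Definition norm_prod (s : nat) (L : seq pt) : R := \prod_(p <- L) N s p.2.

Lemma norm_prod_cat s L1 L2 :
  norm_prod s (L1 ++ L2) = norm_prod s L1 * norm_prod s L2.
Proof. exact: big_cat. Qed.

Lemma point_prod_cat L1 L2 x :
  point_prod (L1 ++ L2) x = point_prod L1 x * point_prod L2 x.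
Proof. exact: big_cat. Qed.

Lemma corrC L1 L2 : corr (L1 ++ L2) = corr (L2 ++ L1).
Proof.
by congr (mexp mu _); apply/funext => x; rewrite !point_prod_cat mulrC.
Qed.

Lemma corr_nil : corr [::] = 1.
Proof.
rewrite /corr (_ : point_prod [::] = cst 1) ?mexp_cst//.
by apply/funext => x; rewrite /point_prod big_nil.
Qed.

Lemma measurable_act_fun g (f : X -> R) : measurable_fun setT f ->
  measurable_fun setT (act_fun inv a g f).
Proof. by move=> mf; apply: measurableT_comp => //; exact: measurable_act. Qed.

Lemma measurable_point_prod L : all in_alg L -> measurable_fun setT (point_prod L).
Proof.
elim: L => [_|p L IH /= /andP[/asboolP pA LA]].
  rewrite (_ : point_prod [::] = cst 1)//.
  by apply/funext => x; rewrite /point_prod big_nil.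
have -> : point_prod (p :: L) = act_fun inv a p.1 p.2 \* point_prod L.
  by apply/funext => x; rewrite /point_prod big_cons.
apply: measurable_funM; last exact: IH.
by apply: measurable_act_fun; case: algH => mA _ _ _; case: (mA _ pA).
Qed.

Lemma norm_ge0 s f : (1 <= s)%N -> Ainv f -> 0 <= N s f.
Proof. by move=> s1 fA; have [+ _ _ _] := normH s1; exact. Qed.

Lemma norm_prod_ge0 s L : (1 <= s)%N -> all in_alg L -> 0 <= norm_prod s L.
Proof.
move=> s1; elim: L => [|p L IH /= /andP[/asboolP pA LA]].
  by rewrite /norm_prod big_nil.
by rewrite /norm_prod big_cons mulr_ge0 ?norm_ge0//; exact: IH.
Qed.

Lemma norm_sup s : (1 <= s)%N -> exists2 B : R, 1 <= B &
  forall f, Ainv f -> {ae mu, forall x, `|f x| <= B * N s f}.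
Proof.
move=> s1; have [_ _ _ [_ [C CP] _ _]] := normH s1.
exists (`|C| + 1) => [|f fA]; first by rewrite lerDr.
apply: filterS (CP _ fA) => x /le_trans; apply.
rewrite ler_wpM2r ?norm_ge0//.
by rewrite (le_trans (ler_norm _))// lerDl.
Qed.

Lemma norm_mono s s' : (1 <= s)%N -> (s <= s')%N -> exists2 K : R, 1 <= K &
  forall f, Ainv f -> N s f <= K * N s' f.
Proof.
move=> s1 /subnK <-; elim: (s' - s)%N => [|k [K K1 IH]].
  by exists 1 => // f fA; rewrite mul1r.
have sk1 : (1 <= k + s)%N by rewrite (leq_trans s1)// leq_addl.
have [_ _ _ [[C CP] _ _ _]] := normH sk1.
exists (K * (`|C| + 1)) => [|f fA].
  by rewrite mulr_ege1// lerDr.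
rewrite (le_trans (IH _ fA))// -mulrA ler_wpM2l//; first exact: le_trans K1.
rewrite (le_trans (CP _ fA))// addSn ler_wpM2r ?norm_ge0//.
by rewrite (le_trans (ler_norm _))// lerDl.
Qed.

Lemma norm_prod_mono s s' K L : (1 <= s)%N ->
  (forall f, Ainv f -> N s f <= K * N s' f) -> all in_alg L ->
  norm_prod s L <= K ^+ size L * norm_prod s' L.
Proof.
move=> s1 KP LA; rewrite /norm_prod.
have -> : K ^+ size L * \prod_(p <- L) N s' p.2 = \prod_(p <- L) (K * N s' p.2).
  by rewrite big_split /= big_const_seq count_predT iter_mulr_1.
have NK p : in_alg p -> 0 <= N s p.2 <= K * N s' p.2.
  by move=> /asboolP pA; rewrite norm_ge0//= KP.
by have /andP[] := ler_prod_seq NK LA.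
Qed.

Lemma point_prod_ae s B L : (1 <= s)%N ->
  (forall f, Ainv f -> {ae mu, forall x, `|f x| <= B * N s f}) ->
  all in_alg L ->
  {ae mu, forall x, `|point_prod L x| <= B ^+ size L * norm_prod s L}.
Proof.
move=> s1 BP; elim: L => [_|p L IH /= /andP[/asboolP pA /IH {}IH]].
  by apply: aeW => x; rewrite /point_prod /norm_prod !big_nil normr1 mulr1.
have := ae_act (inv p.1) (BP _ pA).
apply: filterS2 IH => x IH Bx.
rewrite /point_prod /norm_prod !big_cons normrM exprS mulrACA.
by rewrite ler_pM// -/(act_fun inv a p.1 p.2 x).
Qed.

Lemma corr_le s B L : (1 <= s)%N ->
  (forall f, Ainv f -> {ae mu, forall x, `|f x| <= B * N s f}) ->
  all in_alg L -> `|corr L| <= B ^+ size L * norm_prod s L.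
Proof.
move=> s1 BP LA; apply: normr_mexp_le; first exact: measurable_point_prod.
exact: point_prod_ae.
Qed.

Lemma prod_mexp_le s B L : (1 <= s)%N ->
  (forall f, Ainv f -> {ae mu, forall x, `|f x| <= B * N s f}) ->
  all in_alg L ->
  `|\prod_(p <- L) mexp mu p.2| <= B ^+ size L * norm_prod s L.
Proof.
move=> s1 BP; elim: L => [|p L IH /= /andP[/asboolP pA /IH {}IH]].
  by rewrite /norm_prod !big_nil normr1 mulr1.
rewrite /norm_prod !big_cons normrM exprS mulrACA ler_pM//.
by apply: normr_mexp_le; [case: algH => /(_ _ pA)[]|exact: BP].
Qed.

Lemma min_dist_ge (r : nat) (h : 'I_r -> H) (g : R) : (2 <= r)%N ->
  (forall i j, i != j -> g <= d (h i) (h j)) -> g <= min_dist d h.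
Proof.
case: r h => [|[|r]]// h _ hg; rewrite /min_dist.
elim/big_ind: _ => [|x y gx gy|p].
(* The default value of the minimum is at least the distance between the first and the last point,
   which differ because [2 <= r]. *)
- rewrite /max_dist; apply: (le_trans (hg ord0 ord_max _)) => //.
  exact: (@le_bigmax _ _ _ 0 (fun p : 'I_r.+2 * 'I_r.+2 => d (h p.1) (h p.2))
    (ord0, ord_max)).
- by rewrite le_min gx.
- exact: hg.
Qed.

Lemma mixing_list r : exists2 delta : R, 0 < delta & exists s0 : nat,
  forall s, (s0 < s)%N -> exists2 C : R, 0 <= C &
  forall (L : seq pt) (g : R), size L = r -> all in_alg L ->
    pairwise (fun p q => g <= d p.1 q.1) L ->
    `|corr L - \prod_(p <- L) mexp mu p.2|
      <= C * expR (- delta * g) * norm_prod s L.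
Proof.
(* The mixing hypothesis starts at two factors. Below that the difference vanishes, for one factor
   by invariance of [mu]. *)
have [r2|] := leqP 2 r; last first.
  case: r => [|[|//]] _; exists 1 => //; exists 0%N => s _; exists 0 => // -[|p [|//]]//= g _.
    by rewrite corr_nil big_nil subrr normr0 !mul0r.
  rewrite /in_alg andbT => /asboolP pA _.
  have [/(_ _ pA)[mp [M pM]] _ _ _] := algH.
  rewrite /corr (_ : point_prod [:: p] = fun x => p.2 (a (inv p.1) x)); last first.
    by apply/funext => x; rewrite /point_prod big_seq1.
  by rewrite (mexp_act _ mp pM) big_seq1 subrr normr0 !mul0r.
have [delta d0 [s0 [s00 mix]]] := mixH r2.
exists delta => //; exists s0 => s s0s; have [C CP] := mix _ s0s.
exists `|C| => // L g Lr LA Lg; subst r.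
have p0 : pt := (e, fun=> 0).
have lA i : (i < size L)%N -> Ainv (nth p0 L i).2.
  by move=> iL; apply/asboolP/(all_nthP p0 LA).
have := CP (fun i => (nth p0 L i).2) (fun i => (nth p0 L i).1)
  (fun i => lA i (ltn_ord i)).
rewrite /corr /norm_prod.
rewrite (_ : point_prod L = fun x => \prod_(i < size L)
  act_fun inv a (nth p0 L i).1 (nth p0 L i).2 x); last first.
  by apply/funext => x; rewrite /point_prod (big_nth p0) big_mkord.
rewrite ![\prod_(p <- L) _](big_nth p0) !big_mkord => /le_trans; apply.
rewrite ler_wpM2r ?prodr_ge0//.
  by move=> i _; apply: norm_ge0; [exact: leq_trans s0s|exact: lA].
apply: (@le_trans _ _ (`|C| * expR (- delta * min_dist d
  (fun i : 'I_(size L) => (nth p0 L i).1)))).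
  by rewrite ler_wpM2r ?expR_ge0 ?ler_norm.
rewrite ler_wpM2l// ler_expR !mulNr lerN2 ler_wpM2l ?(ltW d0)//.
apply: min_dist_ge => // i j.
case: metH => _ dC _ _.
wlog : i j / (i < j)%N => [W ij|ij _].
  have := ij; rewrite neq_ltn => /orP[lij|lji]; first exact: W.
  by rewrite dC; apply: W => //; rewrite eq_sym.
by have /(pairwiseP p0) := Lg; apply; rewrite ?inE.
Qed.

(** Rate, order and constant of mixing depend on the number of factors, while decoupling compares a
    list with its two halves and wants common ones. Since [0 <= g], lowering the rate only weakens
    the bound. *)
Lemma mixing_list_upto n : exists2 delta : R, 0 < delta & exists s0 : nat,
  forall s, (s0 < s)%N -> exists2 C : R, 0 <= C &
  forall (L : seq pt) (g : R), (size L <= n)%N -> all in_alg L -> 0 <= g ->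
    pairwise (fun p q => g <= d p.1 q.1) L ->
    `|corr L - \prod_(p <- L) mexp mu p.2|
      <= C * expR (- delta * g) * norm_prod s L.
Proof.
elim: n => [|n [de1 de10 [s1 IH]]].
  have [de de0 [s0 P]] := mixing_list 0.
  exists de => //; exists s0 => s /P[C C0 CP]; exists C => // L g.
  by rewrite leqn0 => /eqP Ln LA _; exact: CP.
have [de2 de20 [s2 P]] := mixing_list n.+1.
exists (Num.min de1 de2); first by rewrite lt_min de10.
exists (maxn s1 s2) => s; rewrite gtn_max => /andP[s1s s2s].
have [C1 C10 P1] := IH _ s1s; have [C2 C20 P2] := P _ s2s.
exists (C1 + C2) => [|L g]; first exact: addr_ge0.
have s_ge1 : (1 <= s)%N by exact: leq_trans s1s.
rewrite leq_eqVlt => /orP[/eqP Ln|Ln] LA g0 Lg.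
  apply: (le_trans (P2 _ _ Ln LA Lg)); rewrite ler_wpM2r ?norm_prod_ge0//.
  rewrite ler_pM ?expR_ge0 ?lerDr// ler_expR !mulNr lerN2 ler_wpM2r//.
  by rewrite ge_min lexx orbT.
apply: (le_trans (P1 _ _ Ln LA g0 Lg)); rewrite ler_wpM2r ?norm_prod_ge0//.
rewrite ler_pM ?expR_ge0 ?lerDl// ler_expR !mulNr lerN2 ler_wpM2r//.
by rewrite ge_min lexx.
Qed.

(** The product of two translates is a single translate by [p.1]: the relative displacement of [q.1]
    is absorbed into the function, which stays in the invariant algebra. *)
Definition merge_points (p q : pt) : pt :=
  (p.1, p.2 \* act_fun inv a (mul (inv p.1) q.1) q.2).

Lemma merge_in_alg p q : in_alg p -> in_alg q -> in_alg (merge_points p q).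
Proof.
move=> /asboolP pA /asboolP qA; apply/asboolP => /=.
by case: algH => _ _ _ [_ AM AI]; apply: AM => //; exact: AI.
Qed.

Lemma point_prod_merge A p B q C :
  point_prod (A ++ merge_points p q :: B ++ C) = point_prod (A ++ p :: B ++ q :: C).
Proof.
apply/funext => x; rewrite /point_prod !(big_cat, big_cons) /=.
have -> : act_fun inv a p.1 (p.2 \* act_fun inv a (mul (inv p.1) q.1) q.2) x =
    act_fun inv a p.1 p.2 x * act_fun inv a q.1 q.2 x.
  by have := act_fun_mul p.1 (mul (inv p.1) q.1) q.2; rewrite grp_mulVK => <-.
ring.
Qed.

(** The product rule costs one order of seminorm. The displacement [mul (inv p.1) q.1] costs the
    exponential, and by left invariance its distance to [e] is [d p.1 q.1]. *)
Lemma norm_merge s : (1 <= s)%N -> exists2 sg : R, 0 < sg &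
  exists2 K : R, 0 <= K & forall p q, in_alg p -> in_alg q ->
  N s (merge_points p q).2 <= K * expR (sg * d p.1 q.1) * (N s.+1 p.2 * N s.+1 q.2).
Proof.
move=> s1; have [_ _ _ [_ _ _ [C CP]]] := normH s1.
have [_ _ _ [_ _ [sg sg0 [D DP]] _]] := normH (leqW s1 : (1 <= s.+1)%N).
exists sg => //; exists (`|C| * `|D|) => [|p q /asboolP pA /asboolP qA].
  exact: mulr_ge0.
set g := mul (inv p.1) q.1.
have gA : Ainv (act_fun inv a g q.2) by case: algH => _ _ _ [_ _]; exact.
apply: (le_trans (CP _ _ pA gA)).
have := DP _ g qA; rewrite dist_mulV => Dq.
have Np := norm_ge0 (leqW s1 : (1 <= s.+1)%N) pA.
have Nq := norm_ge0 (leqW s1 : (1 <= s.+1)%N) qA.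
have Ng := norm_ge0 (leqW s1 : (1 <= s.+1)%N) gA.
have E0 := expR_ge0 (sg * d p.1 q.1).
apply: (@le_trans _ _ (`|C| * N s.+1 p.2 * N s.+1 (act_fun inv a g q.2))).
  by rewrite !ler_wpM2r ?ler_norm.
rewrite [leRHS](_ : _ = `|C| * N s.+1 p.2 *
  (`|D| * expR (sg * d p.1 q.1) * N s.+1 q.2)); last by ring.
rewrite ler_wpM2l ?mulr_ge0// (le_trans Dq)// !ler_wpM2r ?ler_norm//.
Qed.

Definition far (b : R) (L1 L2 : seq pt) : bool :=
  allrel (fun p q : pt => b <= d p.1 q.1) L1 L2.

Lemma farC b L1 L2 : far b L1 L2 = far b L2 L1.
Proof.
rewrite /far allrelC; apply: eq_allrel => p q /=.
by case: metH => _ -> _ _.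
Qed.

(* Either all points are [eps * b]-separated and mixing applies to the whole
   family and to both halves, or two close points of the same half can be
   merged into one, at the cost of a factor [expR (sg * eps * b)] which the
   inductive rate absorbs. *)
Lemma decoupling n : exists2 s : nat, (1 <= s)%N & exists2 c : R, 0 < c &
  exists2 C : R, 0 <= C & forall (L1 L2 : seq pt) (b : R), (size L1 + size L2 = n)%N ->
  all in_alg L1 -> all in_alg L2 -> 0 <= b -> far b L1 L2 ->
  `|corr (L1 ++ L2) - corr L1 * corr L2|
    <= C * expR (- c * b) * (norm_prod s L1 * norm_prod s L2).
Proof.
elim: n => [|n [s1 s11 [c1 c10 [C1 C10 IH]]]].
  exists 1%N => //; exists 1 => //; exists 0 => // -[|//] [|//] b _ _ _ _ _.
  by rewrite corr_nil mulr1 subrr normr0 !mul0r.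
have [sg sg0 [K K0 KP]] := norm_merge s11.
have [K1 K11 K1P] := norm_mono s11 (leqnSn s1).
have [de de0 [s0 mixP]] := mixing_list_upto n.+1.
(* One order above [s1] pays for the product rule in a merge; being above [s0] makes mixing
   available. *)
pose s := maxn s1.+1 s0.+1.
have s_ge1 : (1 <= s)%N by rewrite /s leq_max.
have [K2 K21 K2P] := norm_mono (leqW s11 : (1 <= s1.+1)%N) (leq_maxl _ _ : (s1.+1 <= s)%N).
have [Cm Cm0 CmP] := mixP s (leq_maxr _ _ : (s0 < s)%N).
have [B B1 BP] := norm_sup s_ge1.
(* With [sg * eps <= c1 / 2] a merge leaves half of the inductive rate [c1]; with [eps <= 1] points
   that are [b] apart are also [eps * b] apart. *)
pose eps : R := Num.min 1 (c1 / (2 * sg)).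
have eps0 : 0 < eps by rewrite lt_min ltr01 divr_gt0// mulr_gt0.
have eps1 : eps <= 1 by rewrite ge_min lexx.
have epsc : sg * eps <= c1 / 2.
  apply: (@le_trans _ _ (sg * (c1 / (2 * sg)))).
    by rewrite ler_wpM2l ?(ltW sg0)// ge_min lexx orbT.
  by rewrite le_eqVlt; apply/orP; left; apply/eqP; field; rewrite gt_eqF.
pose c := Num.min (de * eps) (c1 / 2).
have c0 : 0 < c by rewrite lt_min mulr_gt0//= divr_gt0.
pose Ca := C1 * (K * K1 ^+ n.+1) * K2 ^+ n.+1.
pose Cb := Cm * (1 + B ^+ n.+1 + B ^+ n.+1).
have K10 : 0 <= K1 by exact: le_trans K11.
have K20 : 0 <= K2 by exact: le_trans K21.
have B0 : 0 <= B by exact: le_trans B1.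
have Ca0 : 0 <= Ca by rewrite /Ca !mulr_ge0// exprn_ge0.
have Cb0 : 0 <= Cb by rewrite /Cb mulr_ge0// !addr_ge0// exprn_ge0.
have close : forall (L1 L2 : seq pt) (b : R), (size L1 + size L2 = n.+1)%N ->
  all in_alg L1 -> all in_alg L2 -> 0 <= b -> far b L1 L2 ->
  ~~ pairwise (fun p q : pt => eps * b <= d p.1 q.1) L1 ->
  `|corr (L1 ++ L2) - corr L1 * corr L2|
    <= Ca * expR (- c * b) * (norm_prod s L1 * norm_prod s L2).
  move=> L1 L2 b Ln L1A L2A b0 L12 /not_pairwise_split[A [p [D [q [E [LE]]]]]].
  rewrite -ltNge => pq; pose L1' := A ++ merge_points p q :: D ++ E.
  have LA0 := L1A; rewrite LE !all_cat /= !all_cat /= in LA0; move: LA0.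
  move=> /andP[AA /andP[pA /andP[DA /andP[qA EA]]]].
  have mA := merge_in_alg pA qA.
  have L1'A : all in_alg L1' by rewrite /L1' all_cat /= all_cat AA mA DA EA.
  have szA : (size L1' + size L2 = n)%N.
    apply/eqP; rewrite -eqSS -Ln LE /L1' !size_cat /= !size_cat /=.
    by rewrite !(addSn, addnS).
  have far' : far b L1' L2.
    move: L12; rewrite LE /L1' /far !(allrel_catl, allrel_consl) /=.
    by move=> /andP[-> /andP[-> /andP[-> /andP[_ ->]]]].
  have corrE : corr L1' = corr L1 by rewrite /corr LE /L1' point_prod_merge.
  have corrE2 : corr (L1' ++ L2) = corr (L1 ++ L2).
    congr (mexp mu _); apply/funext => x.
    by rewrite point_prod_cat [RHS]point_prod_cat LE /L1' point_prod_merge.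
  have := IH L1' L2 b szA L1'A L2A b0 far'; rewrite corrE corrE2 => hIH; apply: le_trans hIH _.
  have N1 : norm_prod s1 L1' <= K * K1 ^+ (size L1) * expR (sg * eps * b)
      * norm_prod s1.+1 L1.
    rewrite LE /L1' /norm_prod !(big_cat, big_cons) /=.
    rewrite -!/(norm_prod _ _).
    have hA := norm_prod_mono s11 K1P AA.
    have hD := norm_prod_mono s11 K1P DA.
    have hE := norm_prod_mono s11 K1P EA.
    have hm : N s1 (merge_points p q).2 <= K * K1 ^+ 2 * expR (sg * eps * b) *
        (N s1.+1 p.2 * N s1.+1 q.2).
      apply: (le_trans (KP _ _ pA qA)).
      have /asboolP pA' := pA; have /asboolP qA' := qA.
      rewrite ler_wpM2r ?mulr_ge0 ?norm_ge0//.
      rewrite ler_pM ?expR_ge0//.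
        by rewrite ler_peMr// exprn_ege1.
      by rewrite ler_expR -mulrA ler_wpM2l ?(ltW sg0)// ltW.
    have -> : size (A ++ p :: D ++ q :: E) = (size A + 2 + size D + size E)%N.
      by rewrite size_cat /= size_cat /= addn2 !(addSn, addnS) addnA.
    have nm : 0 <= N s1 (merge_points p q).2 by apply: norm_ge0 => //; exact/asboolP.
    apply: (@le_trans _ _ ((K1 ^+ size A * norm_prod s1.+1 A) *
      (K * K1 ^+ 2 * expR (sg * eps * b) * (N s1.+1 p.2 * N s1.+1 q.2) *
      ((K1 ^+ size D * norm_prod s1.+1 D) *
       (K1 ^+ size E * norm_prod s1.+1 E))))); last first.
      by rewrite !exprD le_eqVlt; apply/orP; left; apply/eqP; ring.
    by rewrite !(ler_pM, mulr_ge0, norm_prod_ge0).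
  have N2 : norm_prod s1.+1 L1 <= K2 ^+ size L1 * norm_prod s L1.
    exact: norm_prod_mono.
  have N3 : norm_prod s1 L2 <= K1 ^+ size L2 * norm_prod s1.+1 L2.
    exact: norm_prod_mono.
  have N4 : norm_prod s1.+1 L2 <= K2 ^+ size L2 * norm_prod s L2.
    exact: norm_prod_mono.
  have P1 := norm_prod_ge0 s11 L1'A; have P2 := norm_prod_ge0 s11 L2A.
  have P3 := norm_prod_ge0 s_ge1 L1A; have P4 := norm_prod_ge0 s_ge1 L2A.
  have Ex : expR (- c1 * b) * expR (sg * eps * b) <= expR (- c * b).
    rewrite -expRD ler_expR -mulrDl ler_wpM2r//.
    have : c <= c1 / 2 by rewrite ge_min lexx orbT.
    by move: epsc; lra.
  apply: (@le_trans _ _ (C1 * expR (- c1 * b) *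
    ((K * K1 ^+ size L1 * expR (sg * eps * b) * (K2 ^+ size L1 * norm_prod s L1))
    * (K1 ^+ size L2 * (K2 ^+ size L2 * norm_prod s L2))))).
    rewrite ler_wpM2l ?mulr_ge0 ?expR_ge0// ler_pM//.
      apply: (le_trans N1); rewrite ler_wpM2l// !mulr_ge0 ?expR_ge0 ?exprn_ge0//.
    apply: (le_trans N3); rewrite ler_wpM2l// exprn_ge0//.
  rewrite [leLHS](_ : _ = Ca * (expR (- c1 * b) * expR (sg * eps * b)) *
    (norm_prod s L1 * norm_prod s L2)).
    by rewrite ler_wpM2r ?mulr_ge0// ler_wpM2l.
  by rewrite /Ca -!Ln !exprD; ring.
exists s => //; exists c => //; exists (Ca + Cb); first exact: addr_ge0.
move=> L1 L2 b Ln L1A L2A b0 L12.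
have P1 := norm_prod_ge0 s_ge1 L1A; have P2 := norm_prod_ge0 s_ge1 L2A.
have Pe := expR_ge0 (- c * b).
have [pw1|np1] := boolP (pairwise (fun p q : pt => eps * b <= d p.1 q.1) L1);
  last first.
  apply: (le_trans (close _ _ _ Ln L1A L2A b0 L12 np1)).
  by rewrite !ler_wpM2r ?mulr_ge0// lerDl.
have [pw2|np2] := boolP (pairwise (fun p q : pt => eps * b <= d p.1 q.1) L2);
  last first.
  rewrite addnC in Ln; rewrite farC in L12.
  have := close _ _ _ Ln L2A L1A b0 L12 np2.
  rewrite corrC (mulrC (corr L2)) (mulrC (norm_prod s L2)) => /le_trans; apply.
  by rewrite !ler_wpM2r ?mulr_ge0// lerDl.
have eb0 : 0 <= eps * b by rewrite mulr_ge0// ltW.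
have pw : pairwise (fun p q : pt => eps * b <= d p.1 q.1) (L1 ++ L2).
  rewrite pairwise_cat pw1 pw2 !andbT; apply: sub_allrel L12 => p q.
  by apply: le_trans; rewrite ler_piMl.
have LA : all in_alg (L1 ++ L2) by rewrite all_cat L1A.
have sz : (size (L1 ++ L2) <= n.+1)%N by rewrite size_cat Ln.
have sz1 : (size L1 <= n.+1)%N by rewrite -Ln leq_addr.
have sz2 : (size L2 <= n.+1)%N by rewrite -Ln leq_addl.
have := CmP _ _ sz LA eb0 pw; have := CmP _ _ sz1 L1A eb0 pw1.
have := CmP _ _ sz2 L2A eb0 pw2; rewrite big_cat/= norm_prod_cat.
have := corr_le s_ge1 BP L1A; have := prod_mexp_le s_ge1 BP L2A.
move: (corr (L1 ++ L2)) (corr L1) (corr L2) (norm_prod s L1) (norm_prod s L2) P1 P2.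
move: (\prod_(p <- L1) _) (\prod_(p <- L2) _) => q1 q2 k12 k1 k2 n1 n2 P1 P2.
have Bsz m : (m <= n.+1)%N -> B ^+ m <= B ^+ n.+1.
  by move=> mn; exact: ler_weXn2l.
move=> hq2 hk1 h2 h1 h12.
set E := expR (- de * (eps * b)) in h1 h2 h12.
have E0 : 0 <= E by exact: expR_ge0.
have EE : E <= expR (- c * b).
  rewrite /E ler_expR mulrA ler_wpM2r// !mulNr lerN2.
  by rewrite ge_min lexx.
have {}hq2 : `|q2| <= B ^+ n.+1 * n2.
  by apply: (le_trans hq2); rewrite ler_wpM2r// Bsz.
have {}hk1 : `|k1| <= B ^+ n.+1 * n1.
  by apply: (le_trans hk1); rewrite ler_wpM2r// Bsz.
(* All three correlations are compared with the products [q1], [q2] of the means, which mixing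
   approximates on the whole list and on each half. *)
have -> : k12 - k1 * k2 = (k12 - q1 * q2) - (k1 * (k2 - q2) + (k1 - q1) * q2).
  by ring.
apply: (le_trans (ler_normB _ _)).
apply: (le_trans (lerD h12 (ler_normD _ _))); rewrite !normrM.
have hA : `|k1| * `|k2 - q2| <= B ^+ n.+1 * n1 * (Cm * E * n2) by rewrite ler_pM.
have hB : `|k1 - q1| * `|q2| <= Cm * E * n1 * (B ^+ n.+1 * n2) by rewrite ler_pM.
apply: (@le_trans _ _ (Cb * E * (n1 * n2))).
  apply: (le_trans (lerD (lexx _) (lerD hA hB))).
  by rewrite /Cb le_eqVlt; apply/orP; left; apply/eqP; ring.
rewrite ler_wpM2r ?mulr_ge0// ler_pM// lerDr//.
Qed.

End decoupling.

(** * Moments of ergodic integrals *)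

Section bounded_measurable.
Context (R : realType) (dX : measure_display) (X : measurableType dX).

Definition bounded_mfun (g : X -> R) : Prop :=
  measurable_fun setT g /\ exists B : R, forall x, `|g x| <= B.

Lemma bounded_mfun_cst (r : R) : bounded_mfun (fun=> r).
Proof. by split=> //; exists `|r|. Qed.

Lemma bounded_mfunD f g : bounded_mfun f -> bounded_mfun g ->
  bounded_mfun (fun x => f x + g x).
Proof.
move=> [mf [B fB]] [mg [C gC]]; split; first exact: measurable_funD.
by exists (B + C) => x; rewrite (le_trans (ler_normD _ _))// lerD.
Qed.

Lemma bounded_mfunM f g : bounded_mfun f -> bounded_mfun g ->
  bounded_mfun (fun x => f x * g x).
Proof.
move=> [mf [B fB]] [mg [C gC]]; split; first exact: measurable_funM.
by exists (B * C) => x; rewrite normrM ler_pM.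
Qed.

Lemma bounded_mfunB f g : bounded_mfun f -> bounded_mfun g ->
  bounded_mfun (fun x => f x - g x).
Proof.
move=> [mf [B fB]] [mg [C gC]]; split; first exact: measurable_funB.
by exists (B + C) => x; rewrite (le_trans (ler_normB _ _))// lerD.
Qed.

Lemma bounded_mfunX f n : bounded_mfun f -> bounded_mfun (fun x => f x ^+ n).
Proof.
move=> fb; elim: n => [|n IH].
  by have := bounded_mfun_cst 1; congr bounded_mfun; apply/funext => x; rewrite expr0.
have := bounded_mfunM fb IH.
by congr bounded_mfun; apply/funext => x; rewrite exprS.
Qed.

Lemma bounded_mfun_norm f : bounded_mfun f -> bounded_mfun (fun x => `|f x|).
Proof.
move=> [mf [B fB]]; split; first exact: measurableT_comp.
by exists B => x; rewrite normr_id.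
Qed.

Context (mu : probability X R).

Lemma bounded_mfun_integrable f : bounded_mfun f ->
  mu.-integrable setT (EFin \o f).
Proof.
by move=> [mf [B fB]]; apply: (@integrable_ae_bounded _ _ _ _ _ B) => //; exact: aeW.
Qed.

Lemma mexpD f g : bounded_mfun f -> bounded_mfun g ->
  mexp mu (fun x => f x + g x) = mexp mu f + mexp mu g.
Proof. by move=> fb gb; apply: RintegralD => //; exact: bounded_mfun_integrable. Qed.

Lemma mexpB f g : bounded_mfun f -> bounded_mfun g ->
  mexp mu (fun x => f x - g x) = mexp mu f - mexp mu g.
Proof. by move=> fb gb; apply: RintegralB => //; exact: bounded_mfun_integrable. Qed.

Lemma mexpZl f r : bounded_mfun f ->
  mexp mu (fun x => r * f x) = r * mexp mu f.
Proof. by move=> fb; apply: RintegralZl => //; exact: bounded_mfun_integrable. Qed.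

Lemma mexp_le f g : bounded_mfun f -> bounded_mfun g ->
  (forall x, f x <= g x) -> mexp mu f <= mexp mu g.
Proof.
by move=> fb gb fg; apply: le_Rintegral => //; exact: bounded_mfun_integrable.
Qed.

Lemma normr_mexp_le_mexp f g : bounded_mfun f -> bounded_mfun g ->
  (forall x, `|f x| <= g x) -> `|mexp mu f| <= mexp mu g.
Proof.
move=> fb gb fg.
apply: (le_trans (le_normr_Rintegral measurableT (bounded_mfun_integrable fb))).
by apply: mexp_le => //; exact: bounded_mfun_norm.
Qed.

Lemma normr_mexp_le_cst f B : bounded_mfun f ->
  (forall x, `|f x| <= B) -> `|mexp mu f| <= B.
Proof. by move=> [mf _] fB; apply: normr_mexp_le => //; exact: aeW. Qed.

End bounded_measurable.

(** Meant for [z = Z], [z - w = D]. The common bound [S] lets the remainder be estimated by powers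
    of [|Z| + M V], hence by moments of [Z] itself, rather than by moments of [D]. *)
Lemma expr_remainder1 (R : realType) (z w S : R) n : `|z| <= S -> `|z - w| <= S ->
  `|z ^+ n.+1 - (z - w) ^+ n.+1| <= n.+1%:R * `|w| * S ^+ n.
Proof.
move=> zS wS; have S0 : 0 <= S by exact: le_trans zS.
elim: n => [|n IH]; first by rewrite !expr1 expr0 mulr1 mul1r opprB addrC subrK.
rewrite exprS [(z - w) ^+ _]exprS.
have -> : z * z ^+ n.+1 - (z - w) * (z - w) ^+ n.+1 =
  z * (z ^+ n.+1 - (z - w) ^+ n.+1) + w * (z - w) ^+ n.+1 by ring.
rewrite (le_trans (ler_normD _ _))// !normrM normrX.
apply: (@le_trans _ _ (S * (n.+1%:R * `|w| * S ^+ n) + `|w| * S ^+ n.+1)).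
  by rewrite lerD// ?ler_pM// ?ler_wpM2l// ?exprn_ge0// lerXn2r.
by rewrite [n.+2%:R]mulrS exprS le_eqVlt; apply/orP; left; apply/eqP; ring.
Qed.

(** Multiplying the estimate by [z] raises the exponent; the constant closes because
    [n.+2 ^ 2 + n.+2 <= n.+3 ^ 2]. *)
Lemma expr_remainder2 (R : realType) (z w S : R) n : `|z| <= S -> `|z - w| <= S ->
  `|z ^+ n.+2 - (z - w) ^+ n.+2 - n.+2%:R * (w * (z - w) ^+ n.+1)|
    <= n.+2%:R ^+ 2 * (w ^+ 2 * S ^+ n).
Proof.
move=> zS wS; have S0 : 0 <= S by exact: le_trans zS.
have w20 : 0 <= w ^+ 2 by exact: sqr_ge0.
elim: n => [|n IH].
  have -> : z ^+ 2 - (z - w) ^+ 2 - 2 * (w * (z - w) ^+ 1) = w ^+ 2 by ring.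
  by rewrite expr0 mulr1 ger0_norm// ler_peMl//; nra.
have -> : z ^+ n.+3 - (z - w) ^+ n.+3 - n.+3%:R * (w * (z - w) ^+ n.+2) =
  z * (z ^+ n.+2 - (z - w) ^+ n.+2 - n.+2%:R * (w * (z - w) ^+ n.+1)) +
  n.+2%:R * (w ^+ 2 * (z - w) ^+ n.+1).
  by rewrite [n.+3%:R]mulrS [z ^+ n.+3]exprS ![(z - w) ^+ n.+2]exprS
    [(z - w) ^+ n.+3]exprS [(z - w) ^+ n.+2]exprS; ring.
rewrite (le_trans (ler_normD _ _))// [`|z * _|]normrM [`|n.+2%:R * _|]normrM
  normr_nat [`|w ^+ 2 * _|]normrM (ger0_norm w20).
apply: (@le_trans _ _ (S * (n.+2%:R ^+ 2 * (w ^+ 2 * S ^+ n)) +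
  n.+2%:R * (w ^+ 2 * S ^+ n.+1))).
  apply: lerD; first exact: ler_pM.
  by rewrite ler_wpM2l// ler_wpM2l// normrX lerXn2r.
have -> : S * (n.+2%:R ^+ 2 * (w ^+ 2 * S ^+ n)) + n.+2%:R * (w ^+ 2 * S ^+ n.+1) =
  (n.+2%:R ^+ 2 + n.+2%:R) * (w ^+ 2 * S ^+ n.+1).
  by rewrite [S ^+ n.+1]exprS; ring.
apply: ler_wpM2r; first by apply: mulr_ge0 => //; exact: exprn_ge0.
have n0 : 0 <= n.+2%:R :> R by [].
by rewrite [n.+3%:R]mulrS; nra.
Qed.

(** * Decoupling for powers of an ergodic integral *)

Section moment_recursion.
Context (R : realType) (dG : measure_display) (G : measurableType dG)
  (m : {sigma_finite_measure set G -> \bar R})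
  (dX : measure_display) (X : measurableType dX) (mu : probability X R)
  (u : G -> X -> R) (M : R) (d : G -> G -> R).
Context (mu_u : measurable_fun [set: G * X] (fun p => u p.1 p.2))
  (uM : forall h x, `|u h x| <= M).

Local Notation E := (mexp mu).

Definition uprod (L : seq G) (x : X) : R := \prod_(h <- L) u h x.

Definition decoupled (n : nat) (c C : R) := forall (L1 L2 : seq G) (b : R),
  (size L1 + size L2 <= n)%N -> 0 <= b ->
  allrel (fun h h' => b <= d h h') L1 L2 ->
  `|E (uprod (L1 ++ L2)) - E (uprod L1) * E (uprod L2)| <= C * expR (- c * b).

Lemma bounded_u h : bounded_mfun (u h).
Proof.
split; last by exists M.
exact: measurableT_comp mu_u (pair1_measurable h).
Qed.

Lemma bounded_uprod L : bounded_mfun (uprod L).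
Proof.
elim: L => [|h L IH].
  have := bounded_mfun_cst X (1 : R).
  by congr bounded_mfun; apply/funext => x; rewrite /uprod big_nil.
have := bounded_mfunM (bounded_u h) IH.
by congr bounded_mfun; apply/funext => x; rewrite /uprod big_cons.
Qed.

Definition Zint (A : set G) (x : X) : R := Rintegral m A (u ^~ x).

Context (A : set G) (mA : measurable A) (mAoo : (m A < +oo)%E).

Lemma measurable_usec x : measurable_fun setT (u ^~ x).
Proof. exact: measurableT_comp mu_u (pair2_measurable x). Qed.

Lemma Zint_le x : `|Zint A x| <= M * fine (m A).
Proof.
by apply: normr_Rintegral_le => //; apply: measurable_funTS; exact: measurable_usec.
Qed.

Lemma bounded_Zint : bounded_mfun (Zint A).
Proof.
split; last by exists (M * fine (m A)); exact: Zint_le.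
apply: (@measurable_Rintegral1 _ _ _ G X m mu A setT u M) => //.
exact: fin_num_fun_lty.
Qed.

(** Opens one power of the ergodic integral at a time, so that multiple integrals over powers of [A]
    never appear. *)
Lemma mexp_peel g : bounded_mfun g ->
  E (fun x => g x * Zint A x) = Rintegral m A (fun h => E (fun x => g x * u h x)) /\
  measurable_fun A (fun h => E (fun x => g x * u h x)).
Proof.
move=> [mg [B gB]].
have muT : (mu setT < +oo)%E by exact: fin_num_fun_lty.
have mgu : measurable_fun [set: G * X] (fun p => g p.2 * u p.1 p.2).
  by apply: measurable_funM => //; exact: measurableT_comp.
have guB h x : `|g x * u h x| <= B * M by rewrite normrM ler_pM.
split; last first.
  exact: (@measurable_Rintegral2 _ _ _ G X m mu A setT (fun h x => g x * u h x) (B * M)).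
rewrite [RHS](@Fubini_Rintegral _ _ _ G X m mu A setT (fun h x => g x * u h x) (B * M))//.
rewrite /mexp; congr (Rintegral mu); apply/funext => x.
rewrite /Zint RintegralZl//; apply: (@integrable_bounded _ _ _ _ _ _ M) => //.
by apply: measurable_funTS; exact: measurable_usec.
Qed.

(** Induction on [k]: [mexp_peel] opens one power of [Zint A], and the new point joins [L2]. This is
    why [A] has to be far from [L1] but may come close to [L2]. *)
Lemma decoupled_Zint n c C : decoupled n c C -> forall k L1 L2 b,
  (size L1 + size L2 + k <= n)%N -> 0 <= b ->
  allrel (fun h h' => b <= d h h') L1 L2 ->
  (forall h, A h -> all (fun h' => b <= d h' h) L1) ->
  `|E (fun x => uprod (L1 ++ L2) x * Zint A x ^+ k) -
    E (uprod L1) * E (fun x => uprod L2 x * Zint A x ^+ k)|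
  <= C * expR (- c * b) * fine (m A) ^+ k.
Proof.
move=> dec; elim=> [|k IH] L1 L2 b sz b0 L12 AL1.
  have s0 L : (fun x => uprod L x * Zint A x ^+ 0) = uprod L.
    by apply/funext => x; rewrite expr0 mulr1.
  by rewrite !s0 expr0 mulr1; apply: dec => //; rewrite addn0 in sz.
have bk : bounded_mfun (fun x => Zint A x ^+ k) by apply: bounded_mfunX; exact: bounded_Zint.
have sE L : (fun x => uprod L x * Zint A x ^+ k.+1) =
    fun x => (uprod L x * Zint A x ^+ k) * Zint A x.
  by apply/funext => x; rewrite exprSr mulrA.
rewrite !sE.
have [-> m1] := mexp_peel (bounded_mfunM (bounded_uprod (L1 ++ L2)) bk).
have [-> m2] := mexp_peel (bounded_mfunM (bounded_uprod L2) bk).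
have int1 L : bounded_mfun (uprod L) -> m.-integrable A
    (EFin \o (fun h => E (fun x => uprod L x * Zint A x ^+ k * u h x))).
  move=> bL; have [_ mL] := mexp_peel (bounded_mfunM bL bk).
  have [_ [B LB]] := bounded_mfunM bL bk.
  apply: (@integrable_bounded _ _ _ _ _ _ (B * M)) => // h _.
  apply: normr_mexp_le_cst; first by apply: bounded_mfunM; [exact: bounded_mfunM|exact: bounded_u].
  by move=> x; rewrite normrM ler_pM.
rewrite -RintegralZl//; last exact/int1/bounded_uprod.
rewrite -RintegralB//; [|exact/int1/bounded_uprod|]; last first.
  have := integrableZl mA (E (uprod L1)) (int1 L2 (bounded_uprod L2)).
  by congr (_.-integrable _ _).
rewrite exprS mulrCA mulrC.
apply: normr_Rintegral_le => //.
  apply: measurable_funB => //; exact: measurable_funM.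
move=> h Ah.
have perm L L' : uprod (L ++ h :: L') = fun x => uprod (L ++ L') x * u h x.
  by apply/funext => x; rewrite /uprod !(big_cat, big_cons)/=; ring.
have := IH L1 (h :: L2) b; rewrite perm -[h :: L2]cat0s perm.
have cE L : (fun x => uprod L x * u h x * Zint A x ^+ k) =
    (fun x => uprod L x * Zint A x ^+ k * u h x).
  by apply/funext => x; rewrite mulrAC.
rewrite !cE; apply => //.
  by move: sz; rewrite /= !addnS addSn.
by rewrite allrel_consr L12 andbT; exact: AL1.
Qed.

End moment_recursion.

(** * Recursion for the moments, with explicit errors *)

Section moment_recursion_step.
Context (R : realType) (dG : measure_display) (G : measurableType dG)
  (m : {sigma_finite_measure set G -> \bar R})
  (dX : measure_display) (X : measurableType dX) (mu : probability X R)
  (u : G -> X -> R) (M : R) (d : G -> G -> R).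
Context (M1 : 1 <= M)
  (mu_u : measurable_fun [set: G * X] (fun p => u p.1 p.2))
  (uM : forall h x, `|u h x| <= M)
  (dtri : forall x y z, d x z <= d x y + d y z)
  (mball : forall h r, measurable [set h' | d h h' < r])
  (u_mean : forall h, mexp mu (u h) = 0).

Local Notation E := (mexp mu).
Local Notation Z := (Zint m u).

Let M0 : 0 <= M. Proof. exact: le_trans M1. Qed.

Let uprod0 : uprod u [::] = fun=> 1.
Proof. by apply/funext => x; rewrite /uprod big_nil. Qed.

Let uprod1 h : uprod u [:: h] = u h.
Proof. by apply/funext => x; rewrite /uprod big_seq1. Qed.

Let uprod2 h h' : uprod u [:: h; h'] = fun x => u h x * u h' x.
Proof. by apply/funext => x; rewrite /uprod !big_cons big_nil mulr1. Qed.

(* Split [Z F = D + W] where [W] only sees the points of [F] at distance less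
   than [2 * b] from [h]: the term linear in [W] gives the main term, since
   [u h] and a point of [W] are together decoupled from [D], or else [u h] is
   decoupled from everything and both sides are small. *)
Lemma cross_moment_step (k : nat) (c C : R) (F : set G) (b V : R) (h : G) :
  decoupled mu u d k.+3 c C -> 0 <= C -> measurable F -> (m F < +oo)%E ->
  0 <= b -> V <= fine (m F) ->
  fine (m (F `&` [set h' | d h h' < b + b])) <= V ->
  `|E (fun x => Z F x ^+ k.+2 * u h x) -
    k.+2%:R * (E (fun x => Z F x * u h x) * E (fun x => Z F x ^+ k.+1))|
  <= C * (1 + k.+2%:R * (1 + 2 * M ^+ k.+1)) * expR (- c * b) * fine (m F) ^+ k.+2
   + (k.+2%:R * k.+1%:R + k.+2%:R ^+ 2) * M ^+ 3 * V ^+ 2 *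
     E (fun x => (`|Z F x| + M * V) ^+ k).
Proof.
move=> dec C0 mF mFoo b0 VF FBV.
set B := [set h' | d h h' < b + b] in FBV.
pose FB := F `&` B; pose FD := F `\` B.
have mB : measurable B by exact: mball.
have mFB : measurable FB by exact: measurableI.
have mFD : measurable FD by exact: measurableD.
have mFBoo : (m FB < +oo)%E.
  by apply: le_lt_trans mFoo; rewrite le_measure ?inE//; exact: subIsetl.
have mFDoo : (m FD < +oo)%E.
  by apply: le_lt_trans mFoo; rewrite le_measure ?inE//; exact: subDsetl.
have V0 : 0 <= V by apply: le_trans _ FBV; exact: fine_ge0.
set w := fine (m F) in VF *.
have w0 : 0 <= w by exact: fine_ge0.
have FDw : fine (m FD) <= w.
  by rewrite fine_le ?ge0_fin_numE// le_measure ?inE//; exact: subDsetl.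
pose W := Z FB; pose D := Z FD.
have bZ : bounded_mfun (Z F) by exact: (bounded_Zint mu mu_u uM).
have bW : bounded_mfun W by exact: (bounded_Zint mu mu_u uM).
have bD : bounded_mfun D by exact: (bounded_Zint mu mu_u uM).
have bu h' : bounded_mfun (u h') by exact: (bounded_u mu_u uM).
have ZE x : Z F x = D x + W x.
  rewrite /D /W /Zint addrC -Rintegral_setU//.
  - by rewrite /FB /FD setUIDK.
  - rewrite /FB /FD setUIDK; apply: (@integrable_bounded _ _ _ _ _ _ M) => //.
    by apply: measurable_funTS; exact: measurable_usec.
  - by apply/disj_setPS => y -[[? ?] []].
have WV x : `|W x| <= M * V.
  by rewrite (le_trans (Zint_le mu_u uM mFB mFBoo x))// ler_wpM2l.
have Zw x : `|Z F x| <= M * w by exact: (Zint_le mu_u uM).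
have Dw x : `|D x| <= M * w.
  by rewrite (le_trans (Zint_le mu_u uM mFD mFDoo x))// ler_wpM2l.
have MV0 : 0 <= M * V by exact: mulr_ge0.
pose S x := `|Z F x| + M * V.
have bS : bounded_mfun S.
  by apply: bounded_mfunD; [exact: bounded_mfun_norm|exact: bounded_mfun_cst].
have ZS x : `|Z F x| <= S x by rewrite lerDl.
have DE x : Z F x - W x = D x by rewrite ZE addrK.
have DS x : `|Z F x - W x| <= S x.
  by rewrite (le_trans (ler_normB _ _))// lerD.
have S0 x : 0 <= S x by exact: le_trans (ZS x).
pose ES := E (fun x => S x ^+ k).
have bSk : bounded_mfun (fun x => S x ^+ k) by exact: bounded_mfunX.
have ES0 : 0 <= ES by apply: Rintegral_ge0 => x _; exact: exprn_ge0.
set e := expR (- c * b).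
have e0 : 0 <= e by exact: expR_ge0.
have Ce0 : 0 <= C * e by exact: mulr_ge0.
have FDfar h' : FD h' -> b + b <= d h h'.
  by move=> [_ /= /negP]; rewrite -leNgt.
have powD j : (C * e) * fine (m FD) ^+ j <= C * e * w ^+ j.
  by rewrite ler_wpM2l// lerXn2r ?nnegrE ?fine_ge0.
(* The point [h] alone is decoupled from [D], and [u h] has mean zero, so the product term
   disappears. *)
have far1 j : (j <= k.+2)%N -> `|E (fun x => u h x * D x ^+ j)| <= C * e * w ^+ j.
  move=> jk; have := decoupled_Zint mu_u uM mFD mFDoo dec (k := j) (L1 := [:: h])
    (L2 := [::]) (b := b).
  rewrite /= uprod1 u_mean mul0r subr0 => /(_ jk b0 isT) dz.
  apply: le_trans (dz _) (powD _) => h' /FDfar; rewrite andbT; apply: le_trans.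
  by rewrite lerDl.
(* Expansion of [Z F ^ k.+2] about [D]: [a0] is the term of order zero, small by [far1]; [a1] is
   linear in [W] and close to [I * dl]; [a3] is quadratic in [W]. *)
pose a0 := E (fun x => u h x * D x ^+ k.+2).
pose a1 := E (fun x => u h x * (W x * D x ^+ k.+1)).
pose a2 := E (fun x => u h x * D x).
pose I := E (fun x => u h x * W x).
pose z := E (fun x => Z F x ^+ k.+1).
pose dl := E (fun x => D x ^+ k.+1).
pose rem x := Z F x ^+ k.+2 - D x ^+ k.+2 - k.+2%:R * (W x * D x ^+ k.+1).
pose a3 := E (fun x => u h x * rem x).
have bWD : bounded_mfun (fun x => W x * D x ^+ k.+1).
  by apply: bounded_mfunM => //; exact: bounded_mfunX.
have brem : bounded_mfun rem.
  apply: bounded_mfunB; first by apply: bounded_mfunB; exact: bounded_mfunX.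
  by apply: bounded_mfunM => //; exact: bounded_mfun_cst.
have EZ : E (fun x => Z F x ^+ k.+2 * u h x) = a0 + k.+2%:R * a1 + a3.
  transitivity (E (fun x => (u h x * D x ^+ k.+2 +
      k.+2%:R * (u h x * (W x * D x ^+ k.+1))) + u h x * rem x)).
    by congr (mexp mu); apply/funext => x; rewrite /rem; ring.
  rewrite mexpD; last 2 first.
  - apply: bounded_mfunD; first by apply: bounded_mfunM => //; exact: bounded_mfunX.
    by apply: bounded_mfunM; [exact: bounded_mfun_cst|exact: bounded_mfunM].
  - exact: bounded_mfunM.
  rewrite mexpD; last 2 first.
  - by apply: bounded_mfunM => //; exact: bounded_mfunX.
  - by apply: bounded_mfunM; [exact: bounded_mfun_cst|exact: bounded_mfunM].
  by rewrite mexpZl//; exact: bounded_mfunM.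
have EJ : E (fun x => Z F x * u h x) = a2 + I.
  rewrite /a2 /I -mexpD; [|exact: bounded_mfunM|exact: bounded_mfunM].
  by congr (mexp mu); apply/funext => x; rewrite ZE; ring.
have h0 : `|a0| <= C * e * w ^+ k.+2 by exact: far1.
have h2 : `|a2| <= C * e * w.
  by have := far1 1 isT; rewrite expr1; apply: le_trans.
have hz : `|z| <= M ^+ k.+1 * w ^+ k.+1.
  rewrite -exprMn; apply: normr_mexp_le_cst; first exact: bounded_mfunX.
  by move=> x; rewrite normrX lerXn2r ?nnegrE// mulr_ge0.
have hdl : `|dl| <= M ^+ k.+1 * w ^+ k.+1.
  rewrite -exprMn; apply: normr_mexp_le_cst; first exact: bounded_mfunX.
  by move=> x; rewrite normrX lerXn2r ?nnegrE// mulr_ge0.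
have hI : `|I| <= M * (M * V).
  apply: normr_mexp_le_cst; first exact: bounded_mfunM.
  by move=> x; rewrite normrM ler_pM.
have h3 : `|a3| <= M * (k.+2%:R ^+ 2 * ((M * V) ^+ 2 * ES)).
  rewrite /ES -mexpZl// -mexpZl; last first.
    by apply: bounded_mfunM => //; exact: bounded_mfun_cst.
  rewrite -mexpZl; last first.
    apply: bounded_mfunM; first exact: bounded_mfun_cst.
    by apply: bounded_mfunM => //; exact: bounded_mfun_cst.
  apply: normr_mexp_le_mexp; first exact: bounded_mfunM.
    apply: bounded_mfunM; first exact: bounded_mfun_cst.
    apply: bounded_mfunM; first exact: bounded_mfun_cst.
    by apply: bounded_mfunM => //; exact: bounded_mfun_cst.
  move=> x; rewrite normrM ler_pM//.
  have := expr_remainder2 k (ZS x) (DS x); rewrite DE => /le_trans; apply.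
  rewrite ler_wpM2l ?sqr_ge0// ler_wpM2r ?exprn_ge0//.
  by rewrite -real_normK ?num_real// lerXn2r ?nnegrE.
have hdz : `|dl - z| <= k.+1%:R * (M * V) * ES.
  rewrite distrC /dl /z -mexpB; [|exact: bounded_mfunX|exact: bounded_mfunX].
  rewrite /ES -mexpZl//; apply: normr_mexp_le_mexp.
  - by apply: bounded_mfunB; exact: bounded_mfunX.
  - by apply: bounded_mfunM => //; exact: bounded_mfun_cst.
  move=> x; have := expr_remainder1 k (ZS x) (DS x); rewrite DE => /le_trans; apply.
  by rewrite ler_wpM2r ?exprn_ge0// ler_wpM2l.
have h1 : `|a1 - I * dl| <= C * e * w ^+ k.+1 * (1 + M ^+ k.+1) * V.
  have bg : bounded_mfun (fun x => u h x * D x ^+ k.+1).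
    by apply: bounded_mfunM => //; exact: bounded_mfunX.
  have -> : a1 = E (fun x => (u h x * D x ^+ k.+1) * W x).
    by congr (mexp mu); apply/funext => x; ring.
  have [-> mg] := mexp_peel mu mu_u uM mFB mFBoo bg.
  rewrite /I; have [-> mg2] := mexp_peel mu mu_u uM mFB mFBoo (bu h).
  have ig g B' : bounded_mfun g -> (forall x, `|g x| <= B') ->
      m.-integrable FB (EFin \o (fun h' => E (fun x => g x * u h' x))).
    move=> bg' gB; have [_ mg'] := mexp_peel mu mu_u uM mFB mFBoo bg'.
    apply: (@integrable_bounded _ _ _ _ _ _ (B' * M)) => // h' _.
    apply: normr_mexp_le_cst; first exact: bounded_mfunM.
    by move=> x; rewrite normrM ler_pM.
  have i2 := ig _ _ (bu h) (uM h).
  have i1 : m.-integrable FB (EFin \o (fun h' => E (fun x => u h x * D x ^+ k.+1 * u h' x))).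
    by case: (bg) => _ [B' gB]; exact: (ig _ B').
  rewrite mulrC -RintegralZl// -RintegralB//; last first.
    by have := integrableZl mFB dl i2; congr (_.-integrable _ _).
  apply: (@le_trans _ _ (C * e * w ^+ k.+1 * (1 + M ^+ k.+1) * fine (m FB))); last first.
    by rewrite ler_wpM2l// !mulr_ge0 ?exprn_ge0// addr_ge0 ?exprn_ge0.
  apply: normr_Rintegral_le => //.
    by apply: measurable_funB => //; exact: measurable_funM.
  move=> h' [Fh' Bh']; rewrite mulrDr mulr1.
  have MC : 0 <= C * e * w ^+ k.+1 * M ^+ k.+1 by rewrite !mulr_ge0// exprn_ge0.
  have rE : (fun x => u h x * D x ^+ k.+1 * u h' x) =
      (fun x => u h x * u h' x * D x ^+ k.+1).
    by apply/funext => x; ring.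
  have [hb|hb] := leP b (d h h').
  - rewrite rE.
    have hh : `|E (fun x => u h x * u h' x)| <= C * e.
      have := dec [:: h] [:: h'] b; rewrite /= uprod2 !uprod1 u_mean mul0r subr0.
      by apply => //; rewrite allrel_consl/= allrel_consr/= hb.
    have := decoupled_Zint mu_u uM mFD mFDoo dec (k := k.+1) (L1 := [:: h])
      (L2 := [:: h']) (b := b).
    rewrite /= uprod2 !uprod1 u_mean mul0r subr0 => /(_ (leqnn _) b0) dz.
    apply: (le_trans (ler_normB _ _)); apply: lerD.
      apply: le_trans (dz _ _) (powD _).
        by rewrite allrel_consl/= allrel_consr/= hb.
      move=> h'' /FDfar; rewrite andbT; apply: le_trans; by rewrite lerDl.
    rewrite normrM mulrC -mulrA; apply: ler_pM => //.
    by rewrite mulrC.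
  (* This case dictates the radius [b + b]: as [d h h' < b], a point of [FD] is still at distance at
     least [b] from [h']. *)
  - apply: le_trans (_ : C * e * w ^+ k.+1 <= _); last by rewrite lerDl.
    rewrite rE mulrC.
    have := decoupled_Zint mu_u uM mFD mFDoo dec (k := k.+1) (L1 := [:: h; h'])
      (L2 := [::]) (b := b).
    rewrite /= uprod2 uprod0 => /(_ (leqnn _) b0 isT) dz.
    have -> : dl = E (fun x => 1 * D x ^+ k.+1).
      by congr (mexp mu); apply/funext => x; rewrite mul1r.
    apply: le_trans (dz _) (powD _) => h'' /FDfar hh''; rewrite andbT; apply/andP; split.
      by apply: le_trans hh''; rewrite lerDl.
    rewrite -(lerD2l b); apply: le_trans (le_trans hh'' (dtri h h' h'')) _.
    by rewrite lerD2r ltW.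
rewrite EZ EJ -/z.
(* The target [(a2 + I) * z] differs from [I * dl] by [a2 * z], small by decoupling, and by
   [I * (dl - z)], both factors of which are of order [V]. Hence [V ^+ 2] in the error. *)
have -> : a0 + k.+2%:R * a1 + a3 - k.+2%:R * ((a2 + I) * z) =
  a0 + k.+2%:R * ((a1 - I * dl) + (I * (dl - z) - a2 * z)) + a3 by ring.
have K0 : 0 <= k.+2%:R :> R by [].
apply: (le_trans (ler_normD _ _)).
apply: (le_trans (lerD (ler_normD _ _) h3)).
rewrite normrM normr_nat.
have hb1 : `|I * (dl - z)| <= M * (M * V) * (k.+1%:R * (M * V) * ES).
  by rewrite normrM; apply: ler_pM; rewrite ?normr_ge0.
have hb2 : `|a2 * z| <= C * e * w * (M ^+ k.+1 * w ^+ k.+1).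
  by rewrite normrM; exact: (ler_pM (normr_ge0 _) (normr_ge0 _) h2 hz).
have hb3 : `|a1 - I * dl| <= C * e * w ^+ k.+1 * (1 + M ^+ k.+1) * w.
  apply: (le_trans h1); rewrite ler_wpM2l//.
  by rewrite !mulr_ge0 ?exprn_ge0// addr_ge0// exprn_ge0.
have hb4 : `|a1 - I * dl + (I * (dl - z) - a2 * z)| <=
    C * e * w ^+ k.+1 * (1 + M ^+ k.+1) * w +
    (M * (M * V) * (k.+1%:R * (M * V) * ES) + C * e * w * (M ^+ k.+1 * w ^+ k.+1)).
  apply: (le_trans (ler_normD _ _)); apply: lerD => //.
  by apply: (le_trans (ler_normB _ _)); exact: lerD.
apply: (le_trans (lerD (lerD h0 (ler_wpM2l K0 hb4)) (lexx _))).
rewrite -/ES [w ^+ k.+2]exprS le_eqVlt; apply/orP; left; apply/eqP.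
move: (k.+2%:R) (k.+1%:R) (w ^+ k.+1) (M ^+ k.+1) => K K' w' M'.
ring.
Qed.

Lemma moment_step (k : nat) (c C : R) (F : set G) (b V : R) :
  decoupled mu u d k.+3 c C -> 0 <= C -> measurable F -> (m F < +oo)%E ->
  0 <= b -> V <= fine (m F) ->
  (forall h, fine (m (F `&` [set h' | d h h' < b + b])) <= V) ->
  `|E (fun x => Z F x ^+ k.+3) -
    k.+2%:R * (E (fun x => Z F x ^+ 2) * E (fun x => Z F x ^+ k.+1))|
  <= (C * (1 + k.+2%:R * (1 + 2 * M ^+ k.+1)) * expR (- c * b) * fine (m F) ^+ k.+2
   + (k.+2%:R * k.+1%:R + k.+2%:R ^+ 2) * M ^+ 3 * V ^+ 2 *
     E (fun x => (`|Z F x| + M * V) ^+ k)) * fine (m F).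
Proof.
move=> dec C0 mF mFoo b0 VF FBV.
have bZ : bounded_mfun (Z F) by exact: (bounded_Zint mu mu_u uM).
have -> : (fun x => Z F x ^+ k.+3) = fun x => Z F x ^+ k.+2 * Z F x.
  by apply/funext => x; rewrite exprSr.
have -> : (fun x => Z F x ^+ 2) = fun x => Z F x * Z F x by [].
have bZk := bounded_mfunX k.+2 bZ.
have ig g : bounded_mfun g ->
    m.-integrable F (EFin \o (fun h' => E (fun x => g x * u h' x))).
  move=> bg; have [_ mg] := mexp_peel mu mu_u uM mF mFoo bg.
  have [_ [B gB]] := bg.
  apply: (@integrable_bounded _ _ _ _ _ _ (B * M)) => // h' _.
  apply: normr_mexp_le_cst.
    by apply: bounded_mfunM => //; exact: (bounded_u mu_u uM).
  by move=> x; rewrite normrM ler_pM.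
have [-> mk] := mexp_peel mu mu_u uM mF mFoo bZk.
have [-> m1] := mexp_peel mu mu_u uM mF mFoo bZ.
rewrite [X in _ - X](_ : _ = Rintegral m F (fun h =>
  k.+2%:R * E (fun x => Z F x ^+ k.+1) * E (fun x => Z F x * u h x))); last first.
  by rewrite RintegralZl//; [ring|exact: ig].
rewrite -RintegralB//; [|exact: ig|]; last first.
  have := integrableZl mF (k.+2%:R * E (fun x => Z F x ^+ k.+1)) (ig _ bZ).
  by congr (_.-integrable _ _).
apply: normr_Rintegral_le => //.
  by apply: measurable_funB => //; exact: measurable_funM.
move=> h _; have := @cross_moment_step k c C F b V h dec C0 mF mFoo b0 VF (FBV h).
by rewrite [X in _ - X]mulrA (mulrAC _ _ (E (fun x => Z F x ^+ k.+1))).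
Qed.

End moment_recursion_step.

(** Integration by parts against the Gaussian density of variance [v], kept as a recursion so as to
    match the one satisfied by the moments of [Y]. The value [v = 0] gives the moments of the Dirac
    mass at 0. *)
Fixpoint gaussian_moment (R : realType) (v : R) (n : nat) : R :=
  match n with
  | 0 => 1
  | 1 => 0
  | k.+2 => k.+1%:R * (v * gaussian_moment v k)
  end.

(** The inductive hypothesis concerns moments, not absolute moments, so [k] is rounded up to the
    even number [(uphalf k).*2]. *)
Lemma shifted_power_le (R : realType) (y M : R) (k : nat) : 1 <= M ->
  (`|y| + M) ^+ k <= (2 * M) ^+ k * (1 + y ^+ (uphalf k).*2).
Proof.
move=> M1; have M0 : 0 <= M by exact: le_trans M1.
have y2 : 0 <= y ^+ (uphalf k).*2 by rewrite -muln2 mulnC exprM exprn_ge0// sqr_ge0.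
have kk : (k <= (uphalf k).*2)%N.
  by rewrite -[X in (X <= _)%N]odd_double_half uphalf_half doubleD leq_add2r; case: odd.
have y2E : y ^+ (uphalf k).*2 = `|y| ^+ (uphalf k).*2.
  by rewrite -normrX ger0_norm.
have [y1|y1] := leP `|y| 1.
  apply: (@le_trans _ _ ((2 * M) ^+ k)).
    by rewrite lerXn2r ?nnegrE ?addr_ge0 ?mulr_ge0//; lra.
  by rewrite ler_peMr ?exprn_ge0 ?mulr_ge0// lerDl.
apply: (@le_trans _ _ ((2 * M) ^+ k * `|y| ^+ k)).
  rewrite -exprMn lerXn2r ?nnegrE ?addr_ge0 ?mulr_ge0//.
  have h1 : 0 <= M * (`|y| - 1) by rewrite mulr_ge0// subr_ge0 ltW.
  have h2 : 0 <= `|y| * (M - 1) by rewrite mulr_ge0// subr_ge0.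
  by lra.
rewrite ler_wpM2l ?exprn_ge0 ?mulr_ge0// y2E (@le_trans _ _ (`|y| ^+ (uphalf k).*2))//.
  by rewrite ler_weXn2l// ltW.
by rewrite lerDr.
Qed.

(** * Convergence of the normalized moments *)

Section moment_limit.
Context (R : realType) (dG : measure_display) (G : measurableType dG)
  (m : {sigma_finite_measure set G -> \bar R})
  (dX : measure_display) (X : measurableType dX) (mu : probability X R)
  (u : G -> X -> R) (M : R) (d : G -> G -> R) (F : nat -> set G) (v : R).
Context (M1 : 1 <= M)
  (mu_u : measurable_fun [set: G * X] (fun p => u p.1 p.2))
  (uM : forall h x, `|u h x| <= M)
  (dtri : forall x y z, d x z <= d x y + d y z)
  (mball : forall h r, measurable [set h' | d h h' < r])
  (u_mean : forall h, mexp mu (u h) = 0)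
  (dec : forall n, exists2 c : R, 0 < c &
     exists2 C : R, 0 <= C & decoupled mu u d n c C)
  (vol : forall eps : R, 0 < eps -> exists r0 : R, forall r h, r0 <= r ->
     (m [set h' | (d h h' < r)%R] <= (expR (eps * r))%:E)%E)
  (mF : forall T, measurable (F T)) (mFoo : forall T, (m (F T) < +oo)%E)
  (F_oo : fine (m (F T)) @[T --> \oo] --> +oo).

Local Notation E := (mexp mu).
Local Notation Z := (Zint m u).
Local Notation q T := (Num.sqrt (fine (m (F T)))).

Definition normalized (T : nat) (x : X) : R := (q T)^-1 * Z (F T) x.
Local Notation Y := normalized.

Context (var_cvg : E (fun x => Y T x ^+ 2) @[T --> \oo] --> v).

Let M0 : 0 <= M. Proof. exact: le_trans M1. Qed.

Lemma bounded_normalized T : bounded_mfun (Y T).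
Proof.
apply: bounded_mfunM; first exact: bounded_mfun_cst.
exact: (bounded_Zint mu mu_u uM).
Qed.

Let EYn T n : E (fun x => Y T x ^+ n) = (q T)^-1 ^+ n * E (fun x => Z (F T) x ^+ n).
Proof.
rewrite -mexpZl; last by apply: bounded_mfunX; exact: (bounded_Zint mu mu_u uM).
by congr (mexp mu); apply/funext => x; rewrite exprMn.
Qed.

Let lnq_oo : ln (q T) @[T --> \oo] --> +oo.
Proof.
apply/cvgryPge => A.
have /cvgryPge/(_ (expR A ^+ 2)) := F_oo.
apply: filterS => T hT.
have E0 : 0 < expR A by exact: expR_gt0.
have w0 : 0 < fine (m (F T)) by apply: lt_le_trans hT; exact: exprn_gt0.
rewrite -(expRK A) ler_ln ?posrE ?sqrtr_gt0//.
by rewrite -(ger0_norm (ltW E0)) -sqrtr_sqr ler_wsqrtr.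
Qed.

Lemma normalized_moment_step k : exists2 K : R, 0 <= K & \forall T \near \oo,
  `|E (fun x => Y T x ^+ k.+3) -
    k.+2%:R * (E (fun x => Y T x ^+ 2) * E (fun x => Y T x ^+ k.+1))|
  <= K * expR (- (ln (q T) / 2)) * (1 + E (fun x => Y T x ^+ (uphalf k).*2)).
Proof.
have [c c0 [C C0 decC]] := dec k.+3.
pose C1 : R := C * (1 + k.+2%:R * (1 + 2 * M ^+ k.+1)).
pose C2 : R := (k.+2%:R * k.+1%:R + k.+2%:R ^+ 2) * M ^+ 3.
have C10 : 0 <= C1.
  by rewrite mulr_ge0// addr_ge0// mulr_ge0// addr_ge0// mulr_ge0// exprn_ge0.
have C20 : 0 <= C2 by rewrite mulr_ge0 ?exprn_ge0// addr_ge0// exprn_ge0.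
have k40 : 0 < k.+4%:R :> R by [].
(* With [b = kap * ln (q T)] the decoupling factor is the inverse of [q ^ k.+4], one power better
   than the [q ^ k.+3] that remains after normalization. *)
pose kap := k.+4%:R / c : R.
have kap0 : 0 < kap by exact: divr_gt0.
(* Then [eps * (b + b) = ln (q T) / 4]: the ball has measure at most [V = q ^ (1/4)], and [V ^+ 2]
   uses up only half of the power of [q] that is gained. *)
pose eps := (8 * kap)^-1 : R.
have eps0 : 0 < eps by rewrite invr_gt0 mulr_gt0.
have [r0 volr] := vol eps0.
exists (C1 + C2 * (2 * M) ^+ k).
  by rewrite addr_ge0// mulr_ge0// exprn_ge0// mulr_ge0.
have Fw : \forall T \near \oo, 1 <= fine (m (F T)).
  by have /cvgryPge := F_oo; exact.
(* Large [T] makes [b] nonnegative and brings the radius [b + b] beyond [r0], from where the volume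
   bound holds. *)
have /cvgryPge/(_ (Num.max 0 (r0 / (2 * kap)))) := lnq_oo.
apply: filterS2 Fw => T w1; rewrite ge_max => /andP[l0 lr].
set l := ln (q T) in l0 lr *.
set w := fine (m (F T)) in w1 *.
have q0 : 0 < q T by rewrite sqrtr_gt0; exact: lt_le_trans w1.
have ql : q T = expR l by rewrite /l lnK ?posrE.
have wl : w = expR l ^+ 2 by rewrite -ql sqr_sqrtr// (le_trans _ w1).
pose b := kap * l.
have b0 : 0 <= b by rewrite mulr_ge0// ltW.
pose V := expR (l / 4).
have bb : r0 <= b + b.
  have k20 : 0 < 2 * kap by apply: mulr_gt0.
  move: lr; rewrite ler_pdivrMr//.
  by rewrite (_ : l * (2 * kap) = b + b)// /b; ring.
have epsb : eps * (b + b) = l / 4.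
  by rewrite /eps /b; field; rewrite gt_eqF.
have Vball h : fine (m (F T `&` [set h' | d h h' < b + b])) <= V.
  have mB := mball h (b + b).
  rewrite -lee_fin fineK; last first.
    rewrite ge0_fin_numE//; apply: le_lt_trans (mFoo T).
    by rewrite le_measure ?inE//; exact: measurableI.
  apply: (@le_trans _ _ (m [set h' | (d h h' < b + b)%R])).
    by rewrite le_measure ?inE//; exact: measurableI.
  by rewrite /V -epsb; exact: volr.
have V0 : 0 <= V by exact: expR_ge0.
have Vq : V <= q T by rewrite ql ler_expR; lra.
have q1 : 1 <= q T by rewrite ql -expR0 ler_expR.
have VF : V <= w.
  by rewrite wl -ql (le_trans Vq)// expr2 ler_peMr// ltW.
have := moment_step M1 mu_u uM dtri mball u_mean decC C0 (mF T) (mFoo T) b0 VF Vball.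
rewrite -/C1 -/C2 -/w.
set z3 := E (fun x => Z (F T) x ^+ k.+3); set z2 := E (fun x => Z (F T) x ^+ 2).
set z1 := E (fun x => Z (F T) x ^+ k.+1); set ES := E _ => step.
rewrite (EYn T k.+3) (EYn T 2) (EYn T k.+1) -/z3 -/z2 -/z1.
set p := (q T)^-1.
have p0 : 0 <= p by rewrite invr_ge0 ltW.
have pq : p * q T = 1 by rewrite mulVf// gt_eqF.
have -> : p ^+ k.+3 * z3 - k.+2%:R * (p ^+ 2 * z2 * (p ^+ k.+1 * z1)) =
    p ^+ k.+3 * (z3 - k.+2%:R * (z2 * z1)).
  by rewrite (exprD p 2 k.+1); ring.
rewrite normrM ger0_norm ?exprn_ge0//.
have bY := bounded_normalized T.
pose EY := E (fun x => Y T x ^+ (uphalf k).*2).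
have ESle : ES <= q T ^+ k * ((2 * M) ^+ k * (1 + EY)).
  rewrite -[X in X + EY](mexp_cst mu) /EY -mexpD; last 2 first.
  - exact: bounded_mfun_cst.
  - exact: bounded_mfunX.
  rewrite -mexpZl; last first.
    by apply: bounded_mfunD; [exact: bounded_mfun_cst|exact: bounded_mfunX].
  rewrite -mexpZl; last first.
    apply: bounded_mfunM; first exact: bounded_mfun_cst.
    by apply: bounded_mfunD; [exact: bounded_mfun_cst|exact: bounded_mfunX].
  apply: mexp_le.
  - apply: bounded_mfunX; apply: bounded_mfunD; last exact: bounded_mfun_cst.
    by apply: bounded_mfun_norm; exact: (bounded_Zint mu mu_u uM).
  - do 2 (apply: bounded_mfunM; first exact: bounded_mfun_cst).
    by apply: bounded_mfunD; [exact: bounded_mfun_cst|exact: bounded_mfunX].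
  move=> x; apply: (@le_trans _ _ (q T ^+ k * (`|Y T x| + M) ^+ k)).
    rewrite -exprMn lerXn2r ?nnegrE ?addr_ge0 ?mulr_ge0 ?addr_ge0// ?(ltW q0)//.
    rewrite mulrDr /Y normrM (ger0_norm p0) mulrA (mulrC (q T) p) pq mul1r.
    by rewrite lerD2l mulrC ler_wpM2r.
  by rewrite ler_wpM2l ?exprn_ge0 ?(ltW q0)//; exact: shifted_power_le.
have EY0 : 0 <= EY.
  apply: Rintegral_ge0 => x _.
  by rewrite -muln2 mulnC exprM exprn_ge0// sqr_ge0.
apply: (le_trans (ler_wpM2l (exprn_ge0 k.+3 p0) step)).
apply: (@le_trans _ _ (C1 * expR (- l) + C2 * expR (- (l / 2)) * ((2 * M) ^+ k * (1 + EY)))).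
  have pqk j : p ^+ j * q T ^+ j = 1 by rewrite -exprMn pq expr1n.
  have eb : expR (- c * b) * q T ^+ k.+3 = expR (- l).
    rewrite ql -expRM_natl -expRD; congr expR; rewrite /b /kap.
    rewrite (_ : k.+4%:R = k.+3%:R + 1 :> R) ?natr1//; field; by rewrite gt_eqF.
  have V2 : V ^+ 2 = expR (- (l / 2)) * q T.
    by rewrite ql -expRM_natl -expRD; congr expR; lra.
  have w2 : w = q T ^+ 2 by rewrite wl ql.
  rewrite mulrDl mulrDr; apply: lerD.
    rewrite le_eqVlt; apply/orP; left; apply/eqP; rewrite -eb w2.
    have qq : (q T ^+ 2) ^+ k.+2 * q T ^+ 2 = q T ^+ k.+3 * q T ^+ k.+3.
      by rewrite -exprSr -exprM mul2n -addnn exprD.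
    rewrite -[X in p ^+ k.+3 * X]mulrA qq -[RHS]mul1r -(pqk k.+3); ring.
  apply: (@le_trans _ _ (p ^+ k.+3 * (C2 * V ^+ 2 *
      (q T ^+ k * ((2 * M) ^+ k * (1 + EY))) * w))).
    rewrite ler_wpM2l ?exprn_ge0// ler_wpM2r//; first exact: le_trans w1.
    by rewrite ler_wpM2l// mulr_ge0// exprn_ge0.
  rewrite le_eqVlt; apply/orP; left; apply/eqP; rewrite V2 w2.
  transitivity ((p ^+ k.+3 * q T ^+ k.+3) *
    (C2 * expR (- (l / 2)) * ((2 * M) ^+ k * (1 + EY)))).
    by rewrite !(exprSr (q T)); ring.
  by rewrite pqk mul1r.
have el : expR (- l) <= expR (- (l / 2)) by rewrite ler_expR; lra.
have e0 := expR_ge0 (- (l / 2)).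
have M20 : 0 <= (2 * M) ^+ k by rewrite exprn_ge0// mulr_ge0.
rewrite -/EY [leRHS](_ : _ = C1 * expR (- (l / 2)) * (1 + EY) +
  C2 * expR (- (l / 2)) * ((2 * M) ^+ k * (1 + EY))); last by ring.
rewrite lerD2r.
apply: (@le_trans _ _ (C1 * expR (- (l / 2)))); first by rewrite ler_wpM2l.
by apply: ler_peMr; [exact: mulr_ge0|rewrite lerDl].
Qed.

Lemma moments_cvg n : E (fun x => Y T x ^+ n) @[T --> \oo] --> gaussian_moment v n.
Proof.
suff : forall n i, (i <= n)%N ->
    E (fun x => Y T x ^+ i) @[T --> \oo] --> gaussian_moment v i.
  by move=> /(_ n n (leqnn n)).
have cvg0 : E (fun x => Y T x ^+ 0) @[T --> \oo] --> (1 : R).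
  under eq_fun => T.
    rewrite (_ : (fun x => Y T x ^+ 0) = cst 1); last by apply/funext => x; rewrite expr0.
    rewrite mexp_cst; over.
  exact: cvg_cst.
have cvg1 : E (fun x => Y T x ^+ 1) @[T --> \oo] --> (0 : R).
  under eq_fun => T.
    rewrite EYn (_ : (fun x => Z (F T) x ^+ 1) = fun x => 1 * Z (F T) x); last first.
      by apply/funext => x; rewrite expr1 mul1r.
    rewrite (mexp_peel mu mu_u uM (mF T) (mFoo T) (bounded_mfun_cst X 1)).1.
    rewrite (_ : (fun h => _) = cst 0); last first.
      apply/funext => h; rewrite -[RHS](u_mean h); congr (mexp mu).
      by apply/funext => x; rewrite mul1r.
    rewrite Rintegral_cst// mul0r mulr0; over.
  exact: cvg_cst.
elim=> [|N IH] i; first by rewrite leqn0 => /eqP ->.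
rewrite leq_eqVlt => /orP[/eqP -> {i}|]; last exact: IH.
(* Orders 1 and 2 are the mean and the variance; the recursion takes over at order 3. *)
case: N IH => [_ //|[IH|k IH]].
  by rewrite /= mulr1 mul1r.
(* The moment multiplying the error has even order at most [k.+1]: it converges by induction and
   hence stays bounded. *)
have IHj : E (fun x => Y T x ^+ (uphalf k).*2) @[T --> \oo] -->
    gaussian_moment v (uphalf k).*2.
  apply: IH; rewrite (@leq_trans k.+1)//.
  rewrite -[X in (_ <= X.+1)%N]odd_double_half uphalf_half doubleD.
  by rewrite -addSn leq_add2r; case: odd.
have IH1 := IH k.+1 (leqnSn _).
have [K K0 Kstep] := normalized_moment_step k.
set g := gaussian_moment v k.+3.
have main : k.+2%:R * (E (fun x => Y T x ^+ 2) * E (fun x => Y T x ^+ k.+1))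
    @[T --> \oo] --> g.
  by apply: cvgMr; apply: cvgM.
have elq : expR (- (ln (q T) / 2)) @[T --> \oo] --> (0 : R).
  have l2 : ln (q T) / 2 @[T --> \oo] --> +oo.
    apply/cvgryPge => A; have /cvgryPge/(_ (2 * A)) := lnq_oo.
    by apply: filterS => T; rewrite ler_pdivlMr// mulrC.
  exact: (cvg_comp _ _ l2 (@cvgr_expR R)).
have err : (E (fun x => Y T x ^+ k.+3) -
    k.+2%:R * (E (fun x => Y T x ^+ 2) * E (fun x => Y T x ^+ k.+1)))
    @[T --> \oo] --> (0 : R).
  apply/norm_cvg0P.
  apply: (@squeeze_cvgr _ _ _ _ (fun=> 0) (fun T => K * expR (- (ln (q T) / 2)) *
    (1 + E (fun x => Y T x ^+ (uphalf k).*2)))).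
  - by apply: filterS Kstep => T ->; rewrite normr_ge0.
  - exact: cvg_cst.
  - rewrite -(mul0r (1 + gaussian_moment v (uphalf k).*2)) -[X in X * _](mulr0 K).
    apply: cvgM; first exact: cvgMr.
    by apply: cvgD => //; exact: cvg_cst.
rewrite -[g]add0r; apply: cvg_trans (cvgD err main).
by apply: near_eq_cvg; apply: nearW => T /=; rewrite subrK.
Qed.

End moment_limit.

(** * Approximation by trigonometric polynomials *)

Section taylor.
Context (R : realType).

Lemma derive_ge0_ge0 (f df : R -> R) (x : R) : 0 <= x -> f 0 = 0 ->
  (forall y : R, is_derive y 1 f (df y)) -> (forall y, 0 <= y -> 0 <= df y) ->
  0 <= f x.
Proof.
move=> x0 f0 fdf df0.
have cf : {within `[0, x], continuous f}.
  apply: derivable_within_continuous => y _.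
  by case: (fdf y).
have [c c0x] := MVT_segment x0 (fun y _ => fdf y) cf.
rewrite f0 !subr0 => ->; rewrite mulr_ge0// df0//.
by move: c0x; rewrite in_itv/= => /andP[].
Qed.

(** With the factorials kept apart from the coefficients, differentiation is a shift of [a]. *)
Definition tpoly (a : nat -> R) (n : nat) (x : R) : R :=
  \sum_(k < n) a k * (x ^+ k / k`!%:R).

Lemma is_derive_monomial (k : nat) (x : R) :
  is_derive x 1 (fun y : R => y ^+ k.+1 / k.+1`!%:R) (x ^+ k / k`!%:R).
Proof.
have -> : (fun y : R => y ^+ k.+1 / k.+1`!%:R) = (k.+1`!%:R)^-1 \*: (@id R ^+ k.+1).
  by apply/funext => y /=; rewrite mulrC; congr (_ *: _); rewrite exprfctE.
apply: is_derive_eq; rewrite -[LHS]/(_ * (_ * _ * 1)) /= factS natrM.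
by rewrite mulr1 invfM mulrACA mulVf ?pnatr_eq0// mul1r mulrC.
Qed.

Lemma is_derive_tpoly (a : nat -> R) (n : nat) (x : R) :
  is_derive x 1 (tpoly a n.+1) (tpoly (fun k => a k.+1) n x).
Proof.
elim: n => [|n IH].
  have -> : tpoly a 1 = cst (a 0%N).
    by apply/funext => y; rewrite /tpoly big_ord1 expr0 fact0 invr1 !mulr1.
  rewrite (_ : tpoly _ 0 x = 0); first exact: is_derive_cst.
  by rewrite /tpoly big_ord0.
have -> : tpoly a n.+2 = tpoly a n.+1 +
    a n.+1 \*: (fun y : R => y ^+ n.+1 / n.+1`!%:R).
  by apply/funext => y; rewrite /tpoly big_ord_recr.
have -> : tpoly (fun k => a k.+1) n.+1 x = tpoly (fun k => a k.+1) n x +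
    a n.+1 *: (x ^+ n / n`!%:R).
  by rewrite /tpoly big_ord_recr.
apply: is_deriveD; apply: is_deriveZ; exact: is_derive_monomial.
Qed.

Lemma tpoly0 (a : nat -> R) n : tpoly a n.+1 0 = a 0%N.
Proof.
rewrite /tpoly big_ord_recl expr0 fact0 invr1 !mulr1 big1 ?addr0// => i _.
by rewrite exprS !mul0r mulr0.
Qed.

(** The monomial plus or minus the remainder vanishes at 0 and, by induction applied to [g 1], has a
    nonnegative derivative on the half-line. Monotonicity thus replaces the integral form of the
    remainder. *)
Lemma taylor_remainder_ge0 (n : nat) (g : nat -> R -> R) (x : R) :
  (forall k (y : R), is_derive y 1 (g k) (g k.+1 y)) ->
  (forall k y, `|g k y| <= 1) -> 0 <= x ->
  `|g 0%N x - tpoly (fun k => g k 0) n x| <= x ^+ n / n`!%:R.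
Proof.
elim: n g x => [|n IH] g x dg g1 x0.
  by rewrite /tpoly big_ord0 subr0 expr0 fact0 invr1 mulr1.
have dr (y : R) : is_derive y 1 (g 0%N - tpoly (fun k => g k 0) n.+1)
    (g 1%N y - tpoly (fun k => g k.+1 0) n y).
  by apply: is_deriveB; exact: is_derive_tpoly.
have dr0 : (g 0%N - tpoly (fun k => g k 0) n.+1) 0 = 0.
  by rewrite -[LHS]/(g 0%N 0 - tpoly _ n.+1 0) tpoly0 subrr.
have IH' y : 0 <= y -> `|g 1%N y - tpoly (fun k => g k.+1 0) n y| <= y ^+ n / n`!%:R.
  by move=> y0; apply: (IH (fun k => g k.+1)).
have m0 : ((0 : R) ^+ n.+1 / n.+1`!%:R) = 0 by rewrite exprS !mul0r.
rewrite ler_norml; apply/andP; split.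
- rewrite -subr_ge0 opprK.
  apply: (@derive_ge0_ge0 ((g 0%N - tpoly (fun k => g k 0) n.+1) +
    (fun y : R => y ^+ n.+1 / n.+1`!%:R))
    (fun y => (g 1%N y - tpoly (fun k => g k.+1 0) n y) + y ^+ n / n`!%:R)) => //.
  + by rewrite -[LHS]/((g 0%N - tpoly _ n.+1) 0 + 0 ^+ n.+1 / _) dr0 m0 addr0.
  + by move=> y; apply: is_deriveD; exact: is_derive_monomial.
  + by move=> y /IH'; rewrite ler_norml => /andP[+ _]; rewrite -subr_ge0 opprK.
- rewrite -subr_ge0.
  apply: (@derive_ge0_ge0 ((fun y : R => y ^+ n.+1 / n.+1`!%:R) -
    (g 0%N - tpoly (fun k => g k 0) n.+1))
    (fun y => y ^+ n / n`!%:R - (g 1%N y - tpoly (fun k => g k.+1 0) n y))) => //.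
  + by rewrite -[LHS]/(0 ^+ n.+1 / _ - (g 0%N - tpoly _ n.+1) 0) dr0 m0 subrr.
  + by move=> y; apply: is_deriveB; exact: is_derive_monomial.
  + by move=> y /IH'; rewrite ler_norml => /andP[_]; rewrite -subr_ge0.
Qed.

Lemma taylor_remainder (n : nat) (g : nat -> R -> R) (x : R) :
  (forall k (y : R), is_derive y 1 (g k) (g k.+1 y)) ->
  (forall k y, `|g k y| <= 1) ->
  `|g 0%N x - tpoly (fun k => g k 0) n x| <= `|x| ^+ n / n`!%:R.
Proof.
move=> dg g1; have [x0|x0] := leP 0 x.
  by rewrite (ger0_norm x0); exact: taylor_remainder_ge0.
rewrite (ltr0_norm x0).
(* Reflection at 0: the successive derivatives acquire the signs [(-1) ^+ k]. *)
have := @taylor_remainder_ge0 n (fun k => (-1) ^+ k \*: (g k \o -%R)) (- x).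
rewrite /= opprK expr0 scale1r oppr_ge0 (ltW x0).
have -> : tpoly (fun k => (-1) ^+ k *: g k (- 0)) n (- x) = tpoly (fun k => g k 0) n x.
  rewrite /tpoly; apply: eq_bigr => k _; rewrite oppr0 (exprNn x).
  have ss : (-1) ^+ k * (-1) ^+ k = 1 :> R by rewrite -expr2 sqrr_sign.
  rewrite -[_ *: _]/(_ * _).
  transitivity ((-1) ^+ k * (-1) ^+ k * (g k 0 * (x ^+ k / k`!%:R))); first by ring.
  by rewrite ss mul1r.
apply => // [k y|k y].
  have -> : (-1) ^+ k.+1 *: g k.+1 (- y) = (-1) ^+ k *: (g k.+1 (- y) * -1).
    by rewrite exprSr -[LHS]/(_ * _) -[RHS]/(_ * _) mulrAC mulrA.
  apply: is_deriveZ; apply: is_derive1_comp.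
rewrite -[_ *: _]/(_ * _) normrM normrX normrN1 expr1n mul1r//.
Qed.

(** This is the [k]-th derivative of [cos (x + c)]: differentiating advances the phase by
    [pi / 2]. *)
Definition cos_shift (c : R) (k : nat) (x : R) : R := cos (x + (c + k%:R * (pi / 2))).

Lemma taylor_cos (n : nat) (c x : R) :
  `|cos (x + c) - tpoly (fun k => cos_shift c k 0) n x| <= `|x| ^+ n / n`!%:R.
Proof.
have -> : cos (x + c) = cos_shift c 0 x by rewrite /cos_shift mul0r addr0.
apply: taylor_remainder => [k y|k y].
  have -> : cos_shift c k.+1 y = - sin (y + (c + k%:R * (pi / 2))) * 1.
    by rewrite mulr1 -cosDpihalf /cos_shift; congr cos; rewrite mulrS; ring.
  apply: (@is_derive1_comp _ cos (fun y => y + (c + k%:R * (pi / 2)))).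
  exact: is_derive_shift.
by rewrite /cos_shift ler_norml cos_geN1 cos_le1.
Qed.

End taylor.

Section trigonometric_polynomials.
Context (R : realType).

(** Frequencies are arbitrary reals, so no common period is imposed. The phase [c] covers constants
    and sines, and makes closure under products a matter of one addition formula. *)
Inductive trigpoly : (R -> R) -> Prop :=
| trigpoly_cos t c : trigpoly (fun y => cos (t * y + c))
| trigpolyD f g : trigpoly f -> trigpoly g -> trigpoly (fun y => f y + g y)
| trigpolyZ a f : trigpoly f -> trigpoly (fun y => a * f y).

Lemma trigpoly_cst a : trigpoly (fun=> a).
Proof.
have := trigpolyZ a (trigpoly_cos 0 0).
by congr trigpoly; apply/funext => y; rewrite mul0r addr0 cos0 mulr1.
Qed.

Lemma trigpoly_sin t : trigpoly (fun y => sin (t * y)).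
Proof.
have := trigpoly_cos t (- (pi / 2)).
by congr trigpoly; apply/funext => y; rewrite cosBpihalf.
Qed.

Lemma trigpolyM f g : trigpoly f -> trigpoly g -> trigpoly (fun y => f y * g y).
Proof.
move=> + tg; elim: tg f => [t c|g1 g2 _ IH1 _ IH2|a g1 _ IH] f tf.
- elim: tf => [s b|f1 f2 _ IH1 _ IH2|a f1 _ IH].
  + have := trigpolyZ (2^-1) (trigpolyD (trigpoly_cos (s + t) (b + c))
      (trigpoly_cos (s - t) (b - c))).
    congr trigpoly; apply/funext => y.
    have -> : (s + t) * y + (b + c) = (s * y + b) + (t * y + c) by ring.
    have -> : (s - t) * y + (b - c) = (s * y + b) - (t * y + c) by ring.
    by rewrite cosD cosB; field.
  + have := trigpolyD IH1 IH2.
    by congr trigpoly; apply/funext => y; rewrite mulrDl.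
  + by have := trigpolyZ a IH; congr trigpoly; apply/funext => y; rewrite mulrA.
- have := trigpolyD (IH1 _ tf) (IH2 _ tf).
  by congr trigpoly; apply/funext => y; rewrite mulrDr.
- by have := trigpolyZ a (IH _ tf); congr trigpoly; apply/funext => y; rewrite mulrCA.
Qed.

Lemma trigpoly_bounded f : trigpoly f -> bounded_mfun f.
Proof.
elim=> [t c|f1 f2 _ IH1 _ IH2|a f1 _ IH].
- split; last by exists 1 => y; rewrite ler_norml cos_geN1 cos_le1.
  apply: measurableT_comp; first by apply: continuous_measurable_fun; exact: continuous_cos.
  by apply: measurable_funD => //; exact: measurable_funM.
- exact: bounded_mfunD.
- by apply: bounded_mfunM => //; exact: bounded_mfun_cst.
Qed.

End trigonometric_polynomials.

(** * Bernstein polynomials and weighted uniform approximation *)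

Section bernstein.
Context (R : realType).

(* [bernstein n p g] is the expectation of [g] under the binomial law with
   parameters [n] and [p], defined by conditioning on the last trial. *)
Fixpoint bernstein (n : nat) (p : R) (g : nat -> R) : R :=
  if n is n'.+1 then (1 - p) * bernstein n' p g + p * bernstein n' p (g \o succn)
  else g 0%N.

Lemma bernstein_cst n p a : bernstein n p (fun=> a) = a.
Proof. by elim: n => //= n IH; rewrite /comp /= IH; ring. Qed.

Lemma bernsteinD n p g h :
  bernstein n p (fun k => g k + h k) = bernstein n p g + bernstein n p h.
Proof.
elim: n g h => //= n IH g h; rewrite IH.
by rewrite [bernstein n p (_ \o _)](IH (g \o succn) (h \o succn)); ring.
Qed.

Lemma bernsteinZ n p a g : bernstein n p (fun k => a * g k) = a * bernstein n p g.
Proof.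
elim: n g => //= n IH g; rewrite IH.
by rewrite [bernstein n p (_ \o _)](IH (g \o succn)); ring.
Qed.

Lemma bernstein_le n p g h : 0 <= p <= 1 -> (forall k, g k <= h k) ->
  bernstein n p g <= bernstein n p h.
Proof.
move=> /andP[p0 p1]; elim: n g h => //= n IH g h gh.
by apply: lerD; apply: ler_wpM2l; rewrite ?subr_ge0//; apply: IH => // k; exact: gh.
Qed.

(** The centre [x] is free because conditioning on the last trial replaces it by [x - 1]; at
    [x = n p] the formula gives the binomial variance. *)
Lemma bernstein_variance n p x :
  bernstein n p (fun k => (k%:R - x) ^+ 2) =
  (n%:R * p - x) ^+ 2 + n%:R * p * (1 - p).
Proof.
elim: n x => [|n IH] x /=; first by rewrite !mul0r addr0.
rewrite IH (_ : _ \o _ = fun k => (k%:R - (x - 1)) ^+ 2).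
  by rewrite IH [n.+1%:R]mulrS; ring.
by apply/funext => k /=; rewrite [k.+1%:R]mulrS; congr (_ ^+ 2); ring.
Qed.

Lemma bernstein_norm_le n p g B : 0 <= p <= 1 -> (forall k, `|g k| <= B) ->
  `|bernstein n p g| <= B.
Proof.
move=> p01 gB; rewrite ler_norml -{1}(bernstein_cst n p (- B)) -{2}(bernstein_cst n p B).
by apply/andP; split; apply: bernstein_le => // k; have := gB k;
  rewrite ler_norml => /andP[].
Qed.

Lemma trigpoly_bernstein n (p : R -> R) g : trigpoly p ->
  trigpoly (fun y => bernstein n (p y) g).
Proof.
move=> tp; elim: n g => [|n IH] g /=; first exact: trigpoly_cst.
apply: trigpolyD; last exact: trigpolyM.
apply: trigpolyM => //.
have := trigpolyD (trigpoly_cst 1) (trigpolyZ (-1) tp).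
by congr trigpoly; apply/funext => y; rewrite mulN1r.
Qed.

Lemma bernstein_approx (psi : R -> R) (B eps : R) : 0 <= B ->
  (forall x, `|psi x| <= B) -> continuous psi -> 0 < eps ->
  exists n, forall p, 0 <= p <= 1 ->
  `|psi p - bernstein n p (fun k => psi (k%:R / n%:R))| <= eps.
Proof.
move=> B0 psiB cpsi eps0.
have e40 : 0 < eps / 4 by exact: divr_gt0.
(* Uniform continuity on [[0, 1]] with [y] unrestricted: [bernstein_le] compares functions at every
   [k], also where [k%:R / n%:R] exceeds 1. *)
have unif0 : \forall dl \near (0:R)^'+, `[0, 1]%classic `<=`
    (fun x => forall y, `|x - y| < dl -> `|psi x - psi y| < eps / 2).
  have /compact_near_coveringP := @segment_compact R 0 1; apply.
  move=> x _; have /cvgrPdist_lt/(_ _ e40) := cpsi x.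
  move=> [r /= r0 xr].
  exists (ball x (r / 2), [set dl | dl < r / 2]) => /=.
    split; first by apply: nbhsx_ballx; exact: divr_gt0.
    by apply: nbhs_right_lt; exact: divr_gt0.
  move=> [x' dl] /= [xx' dlr] y xy.
  have h1 : `|psi x - psi x'| < eps / 4.
    by apply: xr => /=; apply: lt_le_trans xx' _; rewrite ler_pdivrMr// ler_peMr ?ltW//; lra.
  have h2 : `|psi x - psi y| < eps / 4.
    apply: xr => /=; rewrite -[x - y](subrKA x').
    apply: (le_lt_trans (ler_normD _ _)).
    by rewrite [ltRHS]splitr ltrD//; exact: lt_trans xy dlr.
  rewrite -[psi x' - psi y](subrKA (psi x)) (le_lt_trans (ler_normD _ _))//.
  rewrite distrC; move: h1 h2; lra.
have [dl [dl0 unif]] : exists dl : R, 0 < dl /\ forall x, 0 <= x <= 1 ->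
    forall y, `|x - y| < dl -> `|psi x - psi y| < eps / 2.
  near (0:R)^'+ => dl; exists dl; split; first by near: dl; exact: nbhs_right_gt.
  have unifdl : `[0, 1]%classic `<=`
    (fun x => forall y, `|x - y| < dl -> `|psi x - psi y| < eps / 2) by near: dl.
  by move=> x x01; apply: unifdl; rewrite /= in_itv.
(* Chosen so that [2 * B / (dl ^+ 2 * n%:R) <= eps / 2], the Chebyshev bound for deviations larger
   than [dl]. *)
pose n := (Num.bound (4 * B / (dl ^+ 2 * eps))).+1.
have dl20 : 0 < dl ^+ 2 by exact: exprn_gt0.
have nP : 4 * B / (dl ^+ 2 * eps) < n%:R.
  apply: (@lt_trans _ _ (Num.bound (4 * B / (dl ^+ 2 * eps)))%:R); last by rewrite ltr_nat.
  by apply: archi_boundP; rewrite divr_ge0 ?mulr_ge0// ltW.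
have n0 : 0 < n%:R :> R by rewrite ltr0n.
exists n => p p01; have /andP[p0 p1] := p01.
pose K := 2 * B / (dl ^+ 2 * n%:R ^+ 2).
have K0 : 0 <= K.
  by apply: divr_ge0; [exact: mulr_ge0|apply: mulr_ge0; [exact: ltW|exact: sqr_ge0]].
(* Within [dl] uniform continuity gives [eps / 2]; farther away the trivial bound [2 * B] lies below
   the quadratic term, whose binomial mean is known exactly. *)
pose h k : R := eps / 2 + K * (k%:R - n%:R * p) ^+ 2.
have psih k : `|psi p - psi (k%:R / n%:R)| <= h k.
  have [pk|pk] := ltP `|p - k%:R / n%:R| dl.
    apply: (le_trans (ltW (unif _ p01 _ pk))); rewrite lerDl mulr_ge0// sqr_ge0//.
  apply: (@le_trans _ _ (2 * B)).
    by rewrite (le_trans (ler_normB _ _))// [leRHS]mulr_natl mulr2n lerD.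
  have kE : K * (k%:R - n%:R * p) ^+ 2 = 2 * B * (`|p - k%:R / n%:R| ^+ 2 / dl ^+ 2).
    rewrite real_normK ?num_real// /K; field.
    by rewrite gt_eqF// gt_eqF.
  apply: (@le_trans _ _ (K * (k%:R - n%:R * p) ^+ 2)); last by rewrite lerDr ltW// divr_gt0.
  rewrite kE ler_peMr ?mulr_ge0// ler_pdivlMr// mul1r lerXn2r ?nnegrE//.
  exact: ltW.
have hE : bernstein n p h <= eps.
  rewrite /h bernsteinD bernstein_cst bernsteinZ bernstein_variance subrr.
  rewrite expr2 mul0r add0r.
  have -> : K * (n%:R * p * (1 - p)) = 2 * B / (dl ^+ 2 * n%:R) * (p * (1 - p)).
    by rewrite /K; field; rewrite gt_eqF// gt_eqF.
  have K1 : 2 * B / (dl ^+ 2 * n%:R) <= eps / 2.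
    move: nP; rewrite ltr_pdivrMr ?mulr_gt0// => nP.
    rewrite ler_pdivrMr ?mulr_gt0//; move: nP; rewrite [n%:R * _]mulrA.
    move: (n%:R) (dl ^+ 2) => N D; rewrite -[eps / 2 * _]mulrAC; lra.
  have K2 : 0 <= 2 * B / (dl ^+ 2 * n%:R).
    by apply: divr_ge0; [exact: mulr_ge0|apply: mulr_ge0; exact: ltW].
  have pp : p * (1 - p) <= 1 by nra.
  have pp0 : 0 <= p * (1 - p) by rewrite mulr_ge0// subr_ge0.
  have := ler_pM K2 pp0 K1 pp; lra.
have -> : psi p - bernstein n p (fun k => psi (k%:R / n%:R)) =
    bernstein n p (fun k => psi p + -1 * psi (k%:R / n%:R)).
  by rewrite bernsteinD bernsteinZ bernstein_cst mulN1r.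
rewrite ler_norml; apply/andP; split.
  apply: (@le_trans _ _ (- bernstein n p h)); first by rewrite lerN2.
  rewrite -[- bernstein n p h]mulN1r -bernsteinZ; apply: bernstein_le => // k.
  by have := psih k; rewrite ler_norml !mulN1r => /andP[].
apply: le_trans hE; apply: bernstein_le => // k.
by have := psih k; rewrite ler_norml mulN1r => /andP[].
Unshelve. all: by end_near.
Qed.

(** Truncation to the interval from [-1/2] to [1/2], written with absolute values so that continuity
    is immediate. *)
Definition clamp (x : R) : R := (`|x + 2^-1| - `|x - 2^-1|) / 2.

Lemma clamp_id x : `|x| <= 2^-1 -> clamp x = x.
Proof.
rewrite ler_norml => /andP[x1 x2]; rewrite /clamp ger0_norm; last by lra.
by rewrite ler0_norm; [field|lra].
Qed.

Lemma clamp_le x : `|clamp x| <= 2^-1.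
Proof.
rewrite /clamp normrM (ger0_norm (_ : 0 <= 2^-1)); last by rewrite invr_ge0.
rewrite ler_piMl ?invr_ge0//; apply: (le_trans (ler_dist_dist _ _)).
by rewrite opprB addrC subrKA -mulr2n -(mulr_natl 2^-1) divff// normr1.
Qed.

Lemma continuous_clamp : continuous clamp.
Proof.
move=> x; apply: cvgM; last exact: cvg_cst.
apply: cvgB; apply: cvg_norm.
  by apply: cvgD; [exact: cvg_id|exact: cvg_cst].
by apply: cvgB; [exact: cvg_id|exact: cvg_cst].
Qed.

(** For [|y| <= A] the substitution [s = (1 + sin (th / A * y)) / 2] is invertible, so [phi] becomes
    a continuous function [psi] of [s], and a Bernstein polynomial in [s] is a trigonometric
    polynomial in [y]. For larger [|y|] that polynomial is still bounded by [B], and the weight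
    absorbs the error [2 * B]. *)
Lemma trigpoly_approx (phi : R -> R) (B eps : R) :
  (forall x, `|phi x| <= B) -> continuous phi -> 0 < eps ->
  exists2 q, trigpoly q & forall y, `|phi y - q y| <= eps * (1 + y ^+ 2).
Proof.
move=> phiB cphi eps0.
have B0 : 0 <= B by exact: le_trans (phiB 0).
(* Angles up to [th] have sines within [1/2] of 0: there [clamp] is the identity, and [asin] is only
   evaluated away from its endpoints, where it is continuous. *)
pose th : R := asin 2^-1.
have half1 : -1 <= (2^-1 : R) <= 1 by lra.
have [/andP[th1 th2] sinth] := asin_def half1; rewrite -/th in th1 th2 sinth.
have pi20 : 0 < pi / 2 :> R by rewrite divr_gt0// pi_gt0.
have th0 : 0 < th.
  rewrite -ltr_sin ?in_itv/= ?th1 ?th2 ?sin0 ?sinth ?invr_gt0//.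
  by rewrite oppr_le0 ltW//= ltW.
(* This gives [eps * A >= 2 * B], and [A >= 1] gives [A <= y ^+ 2] as soon as [|y| > A]. *)
pose A := 1 + 2 * B / eps.
have A1 : 1 <= A by rewrite lerDl divr_ge0 ?mulr_ge0// ltW.
have A0 : 0 < A by exact: lt_le_trans A1.
pose psi s := phi (A / th * asin (clamp (2 * s - 1))).
have caff : continuous (fun s : R => 2 * s - 1).
  move=> s; apply: cvgB; last exact: cvg_cst.
  by apply: cvgM; [exact: cvg_cst|exact: cvg_id].
have cclamp : continuous (fun s : R => clamp (2 * s - 1)).
  by move=> s; exact: (cvg_comp _ _ (caff s) (continuous_clamp (x := _))).
have casin : continuous (fun s : R => asin (clamp (2 * s - 1))).
  move=> s; apply: (cvg_comp _ _ (cclamp s) (continuous_asin _)).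
  have := clamp_le (2 * s - 1).
  by rewrite ler_norml => /andP[]; lra.
have clin : continuous (fun s : R => A / th * asin (clamp (2 * s - 1))).
  by move=> s; apply: cvgM; [exact: cvg_cst|exact: casin].
have cpsi : continuous psi.
  by move=> s; exact: (cvg_comp _ _ (clin s) (cphi _)).
have [n nP] := bernstein_approx B0 (fun s => phiB _) cpsi eps0.
pose p y := (1 + sin (th / A * y)) / 2.
have p01 y : 0 <= p y <= 1.
  have := sin_geN1 (th / A * y); have := sin_le1 (th / A * y); rewrite /p; lra.
exists (fun y => bernstein n (p y) (fun k => psi (k%:R / n%:R))).
  apply: trigpoly_bernstein.
  have := trigpolyZ 2^-1 (trigpolyD (trigpoly_cst 1) (trigpoly_sin (th / A))).
  by congr trigpoly; apply/funext => y; rewrite /p mulrC.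
move=> y; have y20 := sqr_ge0 y.
have [yA|yA] := leP `|y| A; last first.
  apply: (@le_trans _ _ (2 * B)).
    rewrite (le_trans (ler_normB _ _))// [leRHS]mulr_natl mulr2n lerD//.
    by apply: bernstein_norm_le => // k; exact: phiB.
  have yy : A * A <= y ^+ 2.
    by rewrite -real_normK ?num_real// expr2; apply: ler_pM; rewrite ltW.
  have AA : A <= A * A by rewrite ler_peMl// ltW.
  have : eps * A <= eps * (1 + y ^+ 2).
    by rewrite ler_wpM2l ?(ltW eps0)//; lra.
  apply: le_trans; rewrite /A mulrDr mulr1.
  have -> : eps * (2 * B / eps) = 2 * B by field; rewrite gt_eqF.
  by rewrite lerDr ltW.
have t1 : `|th / A * y| <= th.
  have tA0 : 0 <= th / A by apply: divr_ge0; exact: ltW.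
  rewrite normrM (ger0_norm tA0).
  by rewrite mulrAC ler_pdivrMr// ler_wpM2l// ltW.
have tpi : th / A * y \in `[- (pi / 2), pi / 2].
  by rewrite in_itv/= -ler_norml (le_trans t1).
have thpi : th \in `[- (pi / 2), pi / 2] by rewrite in_itv/= th1.
have Nthpi : - th \in `[- (pi / 2), pi / 2] by rewrite in_itv/= lerN2 th2/= lerNl.
have sle : `|sin (th / A * y)| <= 2^-1.
  move: t1; rewrite !ler_norml => /andP[t1 t2]; rewrite -sinth -sinN.
  by rewrite !leNgt (ltr_sin tpi Nthpi) (ltr_sin thpi tpi) -!leNgt t1.
have psiE : psi (p y) = phi y.
  rewrite /psi (_ : 2 * p y - 1 = sin (th / A * y)); last by rewrite /p; field.
  rewrite clamp_id// sinK//; congr phi; field.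
  by rewrite gt_eqF// gt_eqF.
rewrite -psiE; apply: (le_trans (nP _ (p01 y))).
by rewrite ler_peMr ?(ltW eps0)// lerDl.
Qed.

End bernstein.

(** * The method of moments *)

Section method_of_moments.
Context (R : realType).

Definition has_moments (dS : measure_display) (S : measurableType dS)
    (P : probability S R) (W : S -> R) :=
  measurable_fun setT W /\
  forall n, P.-integrable setT (EFin \o (fun s => W s ^+ n)).

Section one_variable.
Context (dS : measure_display) (S : measurableType dS)
  (P : probability S R) (W : S -> R) (mW : has_moments P W).

Lemma bounded_mfun_comp (q : R -> R) : bounded_mfun q -> bounded_mfun (q \o W).
Proof.
move=> [mq [B qB]]; split; first by apply: measurableT_comp => //; case: mW.
by exists B => s; exact: qB.
Qed.

Lemma mexp_tpoly (a : nat -> R) t n :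
  P.-integrable setT (EFin \o (fun s => tpoly a n (t * W s))) /\
  mexp P (fun s => tpoly a n (t * W s)) =
    \sum_(k < n) a k * (t ^+ k / k`!%:R) * mexp P (fun s => W s ^+ k).
Proof.
have [_ iW] := mW; elim: n => [|n [IH1 IH2]].
  have -> : (fun s => tpoly a 0 (t * W s)) = cst 0.
    by apply/funext => s; rewrite /tpoly big_ord0.
  by rewrite mexp_cst big_ord0; split => //; exact: integrable0.
have -> : (fun s => tpoly a n.+1 (t * W s)) = (fun s => tpoly a n (t * W s) +
    (a n * (t ^+ n / n`!%:R)) * W s ^+ n).
  apply/funext => s; rewrite /tpoly big_ord_recr /=; congr (_ + _).
  by rewrite exprMn; ring.
have i2 : P.-integrable setT
    (EFin \o (fun s => (a n * (t ^+ n / n`!%:R)) * W s ^+ n)).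
  have := integrableZl measurableT (a n * (t ^+ n / n`!%:R)) (iW n).
  by congr (_.-integrable _ _).
split.
  by have := integrableD measurableT IH1 i2; congr (_.-integrable _ _).
by rewrite /mexp RintegralD// RintegralZl// big_ord_recr /= -IH2.
Qed.

(** The truncation order is even, so that the remainder is a moment of [W] and not an absolute
    moment. *)
Lemma mexp_cos_taylor t c n :
  `|mexp P (fun s => cos (t * W s + c)) -
    \sum_(k < n.*2) cos_shift c k 0 * (t ^+ k / k`!%:R) * mexp P (fun s => W s ^+ k)|
  <= t ^+ n.*2 / n.*2`!%:R * mexp P (fun s => W s ^+ n.*2).
Proof.
have [_ iW] := mW.
have [ip <-] := mexp_tpoly (fun k => cos_shift c k 0) t n.*2.
have ic : P.-integrable setT (EFin \o (fun s => cos (t * W s + c))).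
  apply: bounded_mfun_integrable.
  exact: (bounded_mfun_comp (trigpoly_bounded (trigpoly_cos t c))).
rewrite /mexp -RintegralB// -RintegralZl//.
have ib : P.-integrable setT (EFin \o (fun s => cos (t * W s + c) -
    tpoly (fun k => cos_shift c k 0) n.*2 (t * W s))).
  by have := integrableB measurableT ic ip; congr (_.-integrable _ _).
apply: (le_trans (le_normr_Rintegral measurableT ib)).
apply: le_Rintegral => //.
- exact: (integrable_norm ib).
- have := integrableZl measurableT (t ^+ n.*2 / n.*2`!%:R) (iW n.*2).
  by congr (_.-integrable _ _).
move=> s _; apply: (le_trans (taylor_cos n.*2 c (t * W s))).
rewrite -mul2n exprM real_normK ?num_real// -exprM exprMn.
by rewrite le_eqVlt; apply/orP; left; apply/eqP; ring.
Qed.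

Lemma mexp_approx (phi q : R -> R) eps : bounded_mfun phi -> bounded_mfun q ->
  (forall y, `|phi y - q y| <= eps * (1 + y ^+ 2)) ->
  `|mexp P (fun s => phi (W s)) - mexp P (fun s => q (W s))|
    <= eps * (1 + mexp P (fun s => W s ^+ 2)).
Proof.
move=> bphi bq phiq; have [_ iW] := mW.
have b1 := bounded_mfun_comp bphi; have b2 := bounded_mfun_comp bq.
rewrite -mexpB//.
have i12 : P.-integrable setT (EFin \o (fun s => 1 + W s ^+ 2)).
  have := integrableD measurableT
    (bounded_mfun_integrable P (bounded_mfun_cst S (1 : R))) (iW 2%N).
  by congr (_.-integrable _ _).
have -> : 1 + mexp P (fun s => W s ^+ 2) = mexp P (fun s => 1 + W s ^+ 2).
  rewrite -[X in X + _](mexp_cst P) /mexp RintegralD//.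
  exact: (bounded_mfun_integrable P (bounded_mfun_cst S (1 : R))).
rewrite /mexp -RintegralZl//.
apply: (le_trans (le_normr_Rintegral measurableT
  (bounded_mfun_integrable P (bounded_mfunB b1 b2)))).
apply: le_Rintegral => //.
- by apply: bounded_mfun_integrable; apply: bounded_mfun_norm; exact: bounded_mfunB.
- by have := integrableZl measurableT eps i12; congr (_.-integrable _ _).
- by move=> s _; exact: phiq.
Qed.

End one_variable.

(** Turns the Taylor remainder at Gaussian moments into a term of the exponential series of
    [v / 2 * t ^+ 2], which tends to 0 for every [t]. This is the growth condition behind the method
    of moments. *)
Lemma gaussian_moment_even (v : R) n :
  gaussian_moment v n.*2 / n.*2`!%:R = (v / 2) ^+ n / n`!%:R.
Proof.
elim: n => [|n IH]; first by rewrite double0.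
have f0 k : (k`!%:R : R) != 0 by rewrite pnatr_eq0 -lt0n fact_gt0.
have s0 k : (k.+1%:R : R) != 0 by rewrite pnatr_eq0.
rewrite doubleS [gaussian_moment _ _]/= 3!factS !natrM exprS.
have -> : n.*2.+2%:R = 2 * n.+1%:R :> R by rewrite -natrM mul2n doubleS.
transitivity (v / 2 / n.+1%:R * (gaussian_moment v n.*2 / n.*2`!%:R)).
  move: (n.*2.+1%:R) (s0 n.*2) (n.+1%:R) (s0 n) (n.*2`!%:R) (f0 n.*2).
  move=> a a0 b b0 c c0; field.
  by rewrite a0 b0 c0.
rewrite IH; move: (n.+1%:R) (s0 n) (n`!%:R) (f0 n) => b b0 c c0; field.
by rewrite b0 c0.
Qed.

Context (dX : measure_display) (X : measurableType dX) (mu : probability X R)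
  (Y : nat -> X -> R) (nu : probability (measurableTypeR R) R) (v : R).
Context (mY : forall T, has_moments mu (Y T))
  (mnu : has_moments nu (@id (measurableTypeR R)))
  (nu_moment : forall n, mexp nu (fun y => y ^+ n) = gaussian_moment v n)
  (Y_moment : forall n,
     mexp mu (fun x => Y T x ^+ n) @[T --> \oo] --> gaussian_moment v n).

Lemma cos_cvg t c : mexp mu (fun x => cos (t * Y T x + c)) @[T --> \oo] -->
  mexp nu (fun y => cos (t * y + c)).
Proof.
apply/cvgrPdist_le => e e0.
have rem0 : exp_coeff (v / 2 * t ^+ 2) n @[n --> \oo] --> (0 : R) by exact: cvg_exp_coeff.
have e40 : 0 < e / 4 by exact: divr_gt0.
(* The order is fixed before [T]. The remainder for [nu] is at most [e / 4]; for large [T] that of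
   [Y T] is at most [e / 2], and the two Taylor sums differ by at most [e / 4]. *)
have [n _ /(_ n (leqnn n)) remn] : \forall n \near \oo, `|exp_coeff (v / 2 * t ^+ 2) n| <= e / 4.
  by have /cvgr0Pnorm_le/(_ _ e40) := rem0.
pose a k := cos_shift c k 0 * (t ^+ k / k`!%:R).
pose A : R := t ^+ n.*2 / n.*2`!%:R.
have AE : A * gaussian_moment v n.*2 = exp_coeff (v / 2 * t ^+ 2) n.
  rewrite /A /exp_coeff /= exprMn mulrAC -[RHS]mulrAC -gaussian_moment_even.
  by rewrite -exprM mul2n; ring.
have Ale : `|A * gaussian_moment v n.*2| <= e / 4 by rewrite AE.
have S_cvg : \sum_(k < n.*2) a k * mexp mu (fun x => Y T x ^+ k) @[T --> \oo] -->
    \sum_(k < n.*2) a k * gaussian_moment v k.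
  apply: cvg_big => [|k _]; last by apply: cvgMr; exact: Y_moment.
  by move=> ?; apply: add_continuous.
have R_cvg : A * mexp mu (fun x => Y T x ^+ n.*2) @[T --> \oo] -->
    A * gaussian_moment v n.*2 by apply: cvgMr; exact: Y_moment.
have /cvgrPdist_le/(_ _ e40) S1 := S_cvg; have /cvgrPdist_le/(_ _ e40) R1 := R_cvg.
near=> T.
have hS : `|\sum_(k < n.*2) a k * gaussian_moment v k -
    \sum_(k < n.*2) a k * mexp mu (fun x => Y T x ^+ k)| <= e / 4 by near: T.
have hR : `|A * gaussian_moment v n.*2 - A * mexp mu (fun x => Y T x ^+ n.*2)| <= e / 4.
  by near: T.
have h1 := mexp_cos_taylor (mY T) t c n.
have := mexp_cos_taylor mnu t c n.
rewrite nu_moment (eq_bigr (fun k : 'I_n.*2 => a k * gaussian_moment v k)); last first.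
  by move=> k _; rewrite nu_moment.
rewrite -/A -/(a _) in h1 *.
move: h1 hS hR Ale.
rewrite !ler_norml.
move: (\sum_(k < n.*2) _) (\sum_(k < n.*2) _) => s1 s2.
move: (A * _) (A * _) => r1 r2.
move: (mexp mu _) (mexp nu _) => m1 m2.
move=> /andP[? ?] /andP[? ?] /andP[? ?] /andP[? ?] /andP[? ?].
by apply/andP; split; lra.
Unshelve. all: by end_near.
Qed.

Lemma trigpoly_cvg q : trigpoly q ->
  mexp mu (fun x => q (Y T x)) @[T --> \oo] --> mexp nu q.
Proof.
have bc T q' : trigpoly q' -> bounded_mfun (fun x => q' (Y T x)).
  by move=> tq'; exact: (bounded_mfun_comp (mY T) (trigpoly_bounded tq')).
elim=> [t c|f g tf IHf tg IHg|a f tf IH]; first exact: cos_cvg.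
- rewrite mexpD; [|exact: trigpoly_bounded|exact: trigpoly_bounded].
  have -> : (fun T => mexp mu (fun x => f (Y T x) + g (Y T x))) =
      (fun T => mexp mu (fun x => f (Y T x)) + mexp mu (fun x => g (Y T x))).
    by apply/funext => T; apply: mexpD; exact: bc.
  exact: cvgD.
- rewrite mexpZl; last exact: trigpoly_bounded.
  have -> : (fun T => mexp mu (fun x => a * f (Y T x))) =
      (fun T => a * mexp mu (fun x => f (Y T x))).
    by apply/funext => T; apply: mexpZl; exact: bc.
  exact: cvgMr.
Qed.

Theorem moments_weak_cvg (phi : R -> R) : continuous phi ->
  (exists M : R, forall t, `|phi t| <= M) ->
  mexp mu (fun x => phi (Y T x)) @[T --> \oo] --> mexp nu phi.
Proof.
move=> cphi [B phiB].
have bphi : bounded_mfun phi.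
  by split; [exact: continuous_measurable_fun|exists B].
have v0 : 0 <= v.
  have := nu_moment 2; rewrite /= mulr1 mul1r => <-.
  by apply: Rintegral_ge0 => y _; exact: sqr_ge0.
apply/cvgrPdist_le => e e0.
have e40 : 0 < e / 4 by exact: divr_gt0.
(* The number [2 + v] dominates one plus the second moment, both for [nu] and, once [T] is large,
   for [Y T]. *)
pose eps := e / 4 / (2 + v).
have eps0 : 0 < eps by rewrite divr_gt0// ltr_wpDr.
have [q tq phiq] := trigpoly_approx phiB cphi eps0.
have bq := trigpoly_bounded tq.
have h2 := mexp_approx mnu bphi bq phiq.
have /cvgrPdist_le/(_ _ e40) q_cvg := trigpoly_cvg tq.
have v_cvg : \forall T \near \oo, mexp mu (fun x => Y T x ^+ 2) <= v + 1.
  have /cvgrPdist_le/(_ _ ltr01) := @Y_moment 2.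
  apply: filterS => T; rewrite /= mulr1 mul1r ler_norml => /andP[+ _].
  by move: (mexp _ _) => z; lra.
near=> T.
have h1 := mexp_approx (mY T) bphi bq phiq.
have hq : `|mexp nu q - mexp mu (fun x => q (Y T x))| <= e / 4 by near: T.
have hv : mexp mu (fun x => Y T x ^+ 2) <= v + 1 by near: T.
have epsE : eps * (2 + v) = e / 4 by rewrite /eps divfK// gt_eqF// ltr_wpDr.
have hE1 : eps * (1 + mexp mu (fun x => Y T x ^+ 2)) <= e / 4.
  by rewrite -epsE ler_wpM2l ?(ltW eps0)//; move: hv; move: (mexp _ _) => z; lra.
have hE2 : eps * (1 + mexp nu (fun y => y ^+ 2)) <= e / 4.
  by rewrite -epsE ler_wpM2l ?(ltW eps0)// nu_moment /= mulr1 mul1r; lra.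
have := le_trans h1 hE1; have := le_trans h2 hE2; move: hq; rewrite !ler_norml.
rewrite -/(mexp nu phi) -/(mexp nu q).
move: (mexp mu _) (mexp mu _) (mexp nu phi) (mexp nu q) => z1 z2 z3 z4.
move=> /andP[? ?] /andP[? ?] /andP[? ?].
by apply/andP; split; lra.
Unshelve. all: by end_near.
Qed.

End method_of_moments.

(** * Moments of the normal law *)

Section normal_moments.
Context (R : realType) (v : R) (v0 : 0 < v).

Local Notation leb := (@lebesgue_measure R).
Local Notation s := (Num.sqrt v).
Local Notation g := (normal_pdf 0 s).

Let s0 : 0 < s. Proof. by rewrite sqrtr_gt0. Qed.
Let s20 : s != 0. Proof. by rewrite gt_eqF. Qed.
Let ss : s ^+ 2 = v. Proof. by rewrite sqr_sqrtr// ltW. Qed.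

Definition normal_law : probability (measurableTypeR R) R := normal_prob 0 s.

(** Identifies the abstract Radon-Nikodym density with the explicit one, so that integrals against
    [normal_law] become Lebesgue integrals. *)
Let ae_density : ae_eq leb setT
  (Radon_Nikodym_SigmaFinite.f normal_law leb) (EFin \o g).
Proof.
have dom : normal_law `<< leb by exact: normal_prob_dominates.
apply: integral_ae_eq => //.
- exact: (Radon_Nikodym_SigmaFinite.f_integrable dom).
- apply/measurable_EFinP; exact: measurable_normal_pdf.
- by move=> A _ mA; rewrite -Radon_Nikodym_SigmaFinite.f_integral.
Qed.

Lemma ge0_integral_normal_law (f : R -> \bar R) : (forall x, 0 <= f x)%E ->
  measurable_fun setT f ->
  (\int[normal_law]_x f x = \int[leb]_x (f x * (g x)%:E))%E.
Proof.
move=> f0 mf.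
have dom : normal_law `<< leb by exact: normal_prob_dominates.
rewrite -(Radon_Nikodym_SigmaFinite.change_of_variables dom)//.
apply: ae_eq_integral => //.
- apply: emeasurable_funM => //.
  exact: measurable_int (Radon_Nikodym_SigmaFinite.f_integrable dom).
- apply: emeasurable_funM => //; apply/measurable_EFinP; exact: measurable_normal_pdf.
- exact: ae_eqe_mul2l ae_density.
Qed.

Lemma Rintegral_normal_law (f : R -> R) : measurable_fun setT f ->
  leb.-integrable setT (EFin \o (fun x => f x * g x)) ->
  normal_law.-integrable setT (EFin \o f) /\
  mexp normal_law f = Rintegral leb setT (fun x => f x * g x).
Proof.
move=> mf ifg.
have mEf : measurable_fun setT (EFin \o f) by exact/measurable_EFinP.
have g0 x : 0 <= g x by exact: normal_pdf_ge0.
split.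
  apply/integrableP; split => //.
  rewrite ge0_integral_normal_law//; last exact: measurableT_comp.
  have /integrableP[_] := ifg; congr (_ < _)%E; apply: eq_integral => x _ /=.
  by rewrite -EFinM normrM (ger0_norm (g0 x)).
rewrite /mexp /Rintegral; congr fine.
rewrite integralE [RHS]integralE; congr (_ - _)%E.
- rewrite ge0_integral_normal_law//; last exact: measurable_funepos.
  apply: eq_integral => x _; rewrite !funeposE /=.
  by rewrite -!EFin_max -EFinM maxr_pMl// mul0r.
- rewrite ge0_integral_normal_law//; last exact: measurable_funeneg.
  apply: eq_integral => x _; rewrite !funenegE /=.
  by rewrite -!EFin_max -EFinM maxr_pMl// mul0r mulNr.
Qed.

(** The density with doubled standard deviation dominates: for [x = y ^+ 2 / (8 * v)] the two
    exponents are [- 4 x] and [- x], and one factor [expR x] out of this gap absorbs the power of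
    [y]. *)
Lemma poly_normal_bound (k : nat) : exists2 K : R, 0 <= K &
  forall y, `|y| ^+ k * g y <= K * normal_pdf 0 (s * 2) y.
Proof.
have v80 : 0 < 8 * v by rewrite mulr_gt0.
have s220 : s * 2 != 0 by rewrite mulf_neq0.
pose K1 : R := 1 + (8 * v) ^+ k.+1 * k.+1`!%:R.
have K10 : 0 <= K1 by rewrite addr_ge0// mulr_ge0// exprn_ge0// ltW.
have p0 : 0 <= normal_peak s by exact: normal_peak_ge0.
have q0 : 0 < normal_peak (s * 2) by exact: normal_peak_gt0.
exists (K1 * normal_peak s / normal_peak (s * 2)).
  by rewrite divr_ge0 ?mulr_ge0// ltW.
move=> y; rewrite !normal_pdfE// /normal_fun subr0.
have -> : K1 * normal_peak s / normal_peak (s * 2) *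
   (normal_peak (s * 2) * expR (- y ^+ 2 / ((s * 2) ^+ 2 *+ 2))) =
   normal_peak s * (K1 * expR (- y ^+ 2 / ((s * 2) ^+ 2 *+ 2))).
  by field; rewrite gt_eqF.
rewrite mulrCA ler_wpM2l//.
pose x := y ^+ 2 / (8 * v).
have x0 : 0 <= x by rewrite divr_ge0 ?sqr_ge0// ltW.
have e1 : - y ^+ 2 / (s ^+ 2 *+ 2) = - (4 * x).
  by rewrite ss /x; field; rewrite gt_eqF.
have e2 : - y ^+ 2 / ((s * 2) ^+ 2 *+ 2) = - x.
  by rewrite exprMn ss /x; field; rewrite gt_eqF.
rewrite e1 e2.
have yk : `|y| ^+ k <= K1 * expR x.
  have ex1 : 1 <= expR x by rewrite -expR0 ler_expR.
  have exk : x ^+ k.+1 <= k.+1`!%:R * expR x.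
    have := expR_ge1Dxn k x0; rewrite -ler_pdivrMl ?ltr0n ?fact_gt0// mulrC.
    by apply: le_trans; rewrite lerDr.
  have yx : (y ^+ 2) ^+ k.+1 = (8 * v) ^+ k.+1 * x ^+ k.+1.
    by rewrite -exprMn /x; congr (_ ^+ _); field; rewrite gt_eqF.
  apply: (@le_trans _ _ (1 + (y ^+ 2) ^+ k.+1)).
    have [y1|y1] := leP `|y| 1.
      apply: (@le_trans _ _ 1); first by rewrite exprn_ile1.
      by rewrite lerDl exprn_ge0// sqr_ge0.
    rewrite -real_normK ?num_real// -exprM.
    apply: (@le_trans _ _ (`|y| ^+ (2 * k.+1))); last by rewrite lerDr.
    by apply: ler_weXn2l; [exact: ltW|rewrite mul2n -addnn (leq_trans (leqnSn k))// leq_addr].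
  rewrite yx [leRHS]mulrDl mul1r; apply: lerD => //; rewrite -mulrA.
  by apply: ler_wpM2l => //; apply: exprn_ge0; exact: ltW.
apply: (@le_trans _ _ (K1 * expR x * expR (- (4 * x)))).
  by rewrite ler_wpM2r ?expR_ge0.
by rewrite -mulrA -expRD ler_wpM2l// ler_expR; lra.
Qed.

Lemma integrable_poly_normal k :
  leb.-integrable setT (EFin \o (fun y => y ^+ k * g y)).
Proof.
have [K K0 Kb] := poly_normal_bound k.
have iK : leb.-integrable setT (EFin \o (fun y => K * normal_pdf 0 (s * 2) y)).
  have := integrableZl measurableT K (integrable_normal_pdf 0 (s * 2)).
  by congr (_.-integrable _ _).
apply: le_integrable iK => //.
  apply/measurable_EFinP; apply: measurable_funM; last exact: measurable_normal_pdf.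
  exact: measurable_funX.
move=> y _ /=; rewrite lee_fin normrM normrX (ger0_norm (normal_pdf_ge0 _ _ _)).
by rewrite (le_trans (Kb y))// ler_norm.
Qed.

Lemma poly_normal_bounded k : exists K : R, forall y, `|y ^+ k * g y| <= K.
Proof.
have [K K0 Kb] := poly_normal_bound k.
have s220 : s * 2 != 0 by rewrite mulf_neq0.
exists (K * normal_peak (s * 2)) => y.
rewrite normrM normrX (ger0_norm (normal_pdf_ge0 _ _ _)).
by rewrite (le_trans (Kb y))// ler_wpM2l// normal_pdf_ub.
Qed.

Lemma poly_normal_cvg0 k (h : nat -> R) : (forall n, `|h n| = n.+1%:R) ->
  h n ^+ k * g (h n) @[n --> \oo] --> (0 : R).
Proof.
move=> hn; have [K Kb] := poly_normal_bounded k.+1.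
have K0 : 0 <= K by exact: le_trans (Kb 0).
apply/norm_cvg0P.
apply: (@squeeze_cvgr _ _ _ _ (fun=> 0) (fun n => K * harmonic n)).
- apply: nearW => n; rewrite normr_ge0 /= /harmonic /=.
  rewrite ler_pdivlMr// -hn -normrM mulrC mulrA -exprS; exact: Kb.
- exact: cvg_cst.
- by rewrite -[X in _ --> X](mulr0 K); apply: cvgMr; exact: cvg_harmonic.
Qed.

(** The fundamental theorem of calculus on growing symmetric intervals leaves vanishing boundary
    terms; dominated convergence identifies the limit with the full integral. *)
Lemma integral_derivative0 (F f : R -> R) :
  (forall y : R, is_derive y 1 F (f y)) -> continuous f ->
  leb.-integrable setT (EFin \o f) ->
  F n.+1%:R @[n --> \oo] --> (0 : R) -> F (- n.+1%:R) @[n --> \oo] --> (0 : R) ->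
  Rintegral leb setT f = 0.
Proof.
move=> dF cf intf Fp Fn.
pose D n : set R := `[- n.+1%:R, n.+1%:R]%classic.
have FTC n : (\int[leb]_(x in D n) (f x)%:E = (F n.+1%:R)%:E - (F (- n.+1%:R))%:E)%E.
  have cF : continuous F.
    by move=> x; apply: differentiable_continuous; apply/derivable1_diffP; case: (dF x).
  apply: continuous_FTC2 => //.
  - by rewrite gtrN.
  - exact: continuous_subspaceT.
  - split => [x _||]; first by case: (dF x).
      exact: cvg_at_right_filter (cF _).
    exact: cvg_at_left_filter (cF _).
  - by move=> x _; rewrite derive1E; case: (dF x).
have lim0 : (\int[leb]_(x in D n) (f x)%:E)%E @[n --> \oo] --> (0%:E : \bar R).
  under eq_fun do rewrite FTC -EFinB.
  apply: cvg_EFin; first exact: nearW.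
  by rewrite -[X in _ --> X](subr0 0); exact: cvgB.
have mD n : measurable (D n) by exact: measurable_itv.
have mf := measurable_int _ intf.
have mfD n : measurable_fun setT ((EFin \o f) \_ (D n)).
  by apply/(measurable_restrictT _ (mD n)); exact: measurable_funTS.
have ptw : {ae leb, forall x, setT x -> ((EFin \o f) \_ (D n)) x @[n --> \oo] --> (EFin \o f) x}.
  apply: aeW => x _; apply: cvg_near_cst.
  exists (Num.bound `|x|) => // n /= xn; rewrite patchE mem_set//.
  rewrite /D /= in_itv /= -ler_norml ltW// (lt_trans (archi_boundP (normr_ge0 x)))//.
  by rewrite ltr_nat ltnS.
have dom : {ae leb, forall x n, setT x ->
    (`|((EFin \o f) \_ (D n)) x| <= (abse \o (EFin \o f)) x)%E}.
  apply: aeW => x n _; rewrite patchE; case: ifP => // _.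
  by rewrite abse0 /= lee_fin.
have [_ _ lim1] := @dominated_convergence _ _ R leb setT measurableT _ _ _ mfD mf ptw
  (integrable_abse intf) dom.
rewrite /Rintegral; have -> : (\int[leb]_x (f x)%:E = 0)%E; last by [].
have lim0' : (\int[leb]_x ((EFin \o f) \_ (D n)) x)%E @[n --> \oo] --> (0%:E : \bar R).
  apply: cvg_trans lim0; apply: near_eq_cvg; apply: nearW => n /=.
  by rewrite -integral_mkcond.
exact: (cvg_unique (@ereal_hausdorff R) lim1 lim0').
Qed.

Let is_derive_g (y : R) : is_derive y 1 g (- (y / v) * g y).
Proof.
have v2 : v != 0 by rewrite gt_eqF.
pose q := (- v^-1) \*: (fun x : R => x ^+ 2 / 2`!%:R).
have -> : g = normal_peak s \*: (expR \o q).
  rewrite normal_pdfE// /normal_fun; apply/funext => x /=.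
  rewrite -[RHS]/(normal_peak s * expR (- v^-1 * (x ^+ 2 / 2`!%:R))).
  by congr (_ * expR _); rewrite subr0 ss (_ : 2`! = 2%N)//; field.
have dq : is_derive y 1 q (- v^-1 *: (y ^+ 1 / 1`!%:R)).
  by apply: is_deriveZ; exact: is_derive_monomial.
have d : is_derive y 1 (normal_peak s \*: (expR \o q))
    (normal_peak s *: (expR (q y) * (- v^-1 *: (y ^+ 1 / 1`!%:R)))).
  by apply: is_deriveZ; apply: is_derive1_comp.
apply: (is_derive_eq d).
rewrite -[LHS]/(normal_peak s * (expR (q y) * (- v^-1 * (y ^+ 1 / 1`!%:R)))).
rewrite -[(_ \*: _) y]/(normal_peak s * expR (q y)) (_ : 1`! = 1%N)// expr1 invr1.
by move: (expR _) => E; field.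
Qed.

(** Since [g] has derivative [- (y / v) * g y], the integrand [f] is the derivative of
    [y ^+ k * g y], and its integral vanishes. At [k = 0] the factor [k%:R] cancels the term with
    the truncated index [k.-1]. *)
Lemma normal_moment_rec k : Rintegral leb setT (fun y => y ^+ k.+1 * g y) =
  v * (k%:R * Rintegral leb setT (fun y => y ^+ k.-1 * g y)).
Proof.
pose f y := k%:R * (y ^+ k.-1 * g y) - v^-1 * (y ^+ k.+1 * g y).
have dF (y : R) : is_derive y 1 (fun y => y ^+ k * g y) (f y).
  have -> : (fun y => y ^+ k * g y) = (@id R ^+ k) * g.
    by apply/funext => x; rewrite -[RHS]/((@id R ^+ k) x * g x) exprfctE.
  have d := is_deriveM (is_deriveX k (is_derive_id y (1 : R))) (is_derive_g y).
  apply: (is_derive_eq d).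
  rewrite -[LHS]/((@id R ^+ k) y * (- (y / v) * g y) +
    g y * ((k%:R * y ^+ k.-1) * 1)) exprfctE /f exprS.
  by field; rewrite gt_eqF.
have cg : continuous g by exact: continuous_normal_pdf.
have cp j : continuous (fun y : R => y ^+ j * g y).
  by move=> y; apply: cvgM; [exact: exprn_continuous|exact: cg].
have cf : continuous f.
  by move=> y; apply: cvgB; apply: cvgMr; exact: cp.
have i1 c j : leb.-integrable setT (EFin \o (fun y => c * (y ^+ j * g y))).
  have := integrableZl measurableT c (integrable_poly_normal j).
  by congr (_.-integrable _ _).
have intf : leb.-integrable setT (EFin \o f).
  have := integrableB measurableT (i1 k%:R k.-1) (i1 v^-1 k.+1).
  by congr (_.-integrable _ _).
have := integral_derivative0 dF cf intf.
rewrite /f RintegralB//.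
rewrite RintegralZl//; last exact: integrable_poly_normal.
rewrite RintegralZl//; last exact: integrable_poly_normal.
move=> H; have /eqP : k%:R * Rintegral leb setT (fun y => y ^+ k.-1 * g y) -
    v^-1 * Rintegral leb setT (fun y => y ^+ k.+1 * g y) = 0.
  apply: H; apply: (@poly_normal_cvg0 k) => n.
    by rewrite ger0_norm.
  by rewrite normrN ger0_norm.
rewrite subr_eq0 => /eqP ->.
by rewrite mulrA divff ?mul1r// gt_eqF.
Qed.

Lemma normal_law_moments : has_moments normal_law (@id (measurableTypeR R)) /\
  forall n, mexp normal_law (fun y => y ^+ n) = gaussian_moment v n.
Proof.
have mp n : measurable_fun [set: R] (fun y : R => y ^+ n) by exact: measurable_funX.
have mm n := Rintegral_normal_law (mp n) (integrable_poly_normal n).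
split; first by split => // n; case: (mm n).
have E0 : Rintegral leb setT (fun y => y ^+ 0 * g y) = 1.
  have -> : (fun y : R => y ^+ 0 * g y) = g by apply/funext => y; rewrite mul1r.
  by rewrite /Rintegral integral_normal_pdf.
have E1 : Rintegral leb setT (fun y => y ^+ 1 * g y) = 0.
  by rewrite normal_moment_rec mul0r mulr0.
move=> n; rewrite (mm n).2.
suff : Rintegral leb setT (fun y => y ^+ n * g y) = gaussian_moment v n /\
    Rintegral leb setT (fun y => y ^+ n.+1 * g y) = gaussian_moment v n.+1 by case.
elim: n => [|n [IH1 IH2]]; first by rewrite E0 E1.
split => //; rewrite normal_moment_rec IH1 /=; ring.
Qed.

Lemma normal_law_expect (phi : R -> R) : bounded_mfun phi ->
  mexp normal_law phi = normal_expect v phi.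
Proof.
move=> [mphi [B phiB]]; rewrite /normal_expect gt_eqF//.
have iB : leb.-integrable setT (EFin \o (fun y => B * g y)).
  have := integrableZl measurableT B (integrable_normal_pdf 0 s).
  by congr (_.-integrable _ _).
suff ip : leb.-integrable setT (EFin \o (fun y => phi y * g y)).
  by case: (Rintegral_normal_law mphi ip).
apply: le_integrable iB => //.
  by apply/measurable_EFinP; apply: measurable_funM => //; exact: measurable_normal_pdf.
move=> y _ /=; rewrite lee_fin !normrM ler_wpM2r//.
by rewrite (le_trans (phiB y))// ler_norm.
Qed.

End normal_moments.

(** The limiting variance may be 0; the law is then the Dirac mass at 0, in agreement with both
    [normal_expect] and the moment recursion. *)
Lemma gaussian_law (R : realType) (v : R) : 0 <= v ->
  exists nu : probability (measurableTypeR R) R,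
  [/\ has_moments nu (@id (measurableTypeR R)),
      forall n, mexp nu (fun y => y ^+ n) = gaussian_moment v n &
      forall phi : R -> R, bounded_mfun phi -> mexp nu phi = normal_expect v phi].
Proof.
rewrite le_eqVlt => /predU1P[<-|v0]; last first.
  exists (normal_law v); have [? ?] := normal_law_moments v0; split => // phi.
  exact: normal_law_expect.
pose nu : probability (measurableTypeR R) R := \d_ (0 : measurableTypeR R).
have nuE (f : R -> R) : measurable_fun setT f -> mexp nu f = f 0.
  move=> mf; rewrite /mexp /Rintegral integral_dirac//; last exact/measurable_EFinP.
  by rewrite [X in (X * _)%E](_ : _ = 1%E) ?mul1e//; exact: diracT.
exists nu; split.
- split => // n; apply/integrableP; split.
    by apply/measurable_EFinP; exact: measurable_funX.
  rewrite integral_dirac//; last first.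
    by apply: measurableT_comp => //; apply/measurable_EFinP; exact: measurable_funX.
  by rewrite [X in (X * _)%E](_ : _ = 1%E) ?mul1e ?ltry//; exact: diracT.
- move=> n; rewrite nuE; last exact: measurable_funX.
  case: n => [|[|n]] /=; rewrite ?expr0 ?expr1// exprS mul0r.
  by rewrite mul0r mulr0.
- by move=> phi [mphi _]; rewrite nuE// /normal_expect eqxx.
Qed.

(** * Borel structure and Haar measure *)

(** Fubini lives on packed sigma-finite measures, while Haar measure is given bare. The predicate
    [Q] ranges over bare measures so that the goal can be carried along the equality with the packed
    one. *)
Lemma sigma_finite_packing (R : realType) (dT : measure_display)
    (T : measurableType dT) (m : {measure set T -> \bar R})
    (Q : {measure set T -> \bar R} -> Prop) :
  sigma_finite setT m ->
  (forall m' : {sigma_finite_measure set T -> \bar R}, Q m') ->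
  Q m.
Proof.
move=> sf QP.
pose H1 := isSFinite.Build _ _ _ _ (sfinite_measure_sigma_finite sf).
pose H2 := isSigmaFinite.Build _ _ _ _ sf.
pose m' := HB.pack_for (SigmaFiniteMeasure.type T R) (Measure.sort m) H1 H2.
have -> : m = m' by exact: eq_measure.
exact: QP.
Qed.

Section borel_group.
Context (H : ptopologicalType).
Notation BH := (borel_of H).

Lemma open_borel (U : set H) : open U -> measurable (U : set BH).
Proof. exact: sub_sigma_algebra. Qed.

Lemma closed_borel (U : set H) : closed U -> measurable (U : set BH).
Proof.
move=> cU; rewrite -(setCK U); apply: measurableC.
by apply: open_borel; exact: closed_openC.
Qed.

Lemma compact_borel (U : set H) : hausdorff_space H -> compact U ->
  measurable (U : set BH).
Proof. by move=> hH cU; apply: closed_borel; exact: compact_closed. Qed.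

Lemma continuous_borel (f : H -> H) : continuous f ->
  measurable_fun [set: BH] (f : BH -> BH).
Proof.
move=> cf; apply: (@measurability _ _ BH BH setT f (@open H)) => //.
move=> _ [U oU <-]; rewrite setTI; apply: open_borel.
by apply: open_comp => // x _; exact: cf.
Qed.

Lemma open_borel_prod (U : set (H * H)) : @second_countable H -> open U ->
  measurable (U : set (BH * BH)).
Proof.
move=> [B cB [Bo Bb]] oU.
have [f finj] := countable_injP _ cB.
pose W n k : set (BH * BH) := [set p | exists b1 b2 : set H,
  [/\ B b1, B b2, f b1 = n, f b2 = k & b1 `*` b2 `<=` U /\ (b1 `*` b2) p]].
have -> : U = \bigcup_n \bigcup_k W n k.
  apply/seteqP; split => [[x y] Uxy|p [n _ [k _ [b1 [b2 [_ _ _ _ [sub bp]]]]]]]; last first.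
    exact: sub.
  have : nbhs (x, y) U by exact: open_nbhs_nbhs.
  move=> [[A1 A2] [/= nA1 nA2] A12].
  have [b1 [Bb1 b1x] b1A] := Bb _ _ nA1; have [b2 [Bb2 b2y] b2A] := Bb _ _ nA2.
  exists (f b1) => //; exists (f b2) => //; exists b1, b2; split => //.
  split => //= -[x' y'] [/= bx' by'].
  by apply: A12; split; [exact: b1A|exact: b2A].
apply: bigcup_measurable => n _; apply: bigcup_measurable => k _.
(* Injectivity of the coding leaves two cases: [W n k] is a single basic rectangle or it is
   empty. *)
have [[b1 [b2 [Bb1 Bb2 fb1 fb2 sub]]]|no] := pselect (exists b1 b2 : set H,
  [/\ B b1, B b2, f b1 = n, f b2 = k & b1 `*` b2 `<=` U]).
  have -> : W n k = b1 `*` b2.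
    apply/seteqP; split => [p [c1 [c2 [Bc1 Bc2 fc1 fc2 [_ cp]]]]|p bp]; last first.
      by exists b1, b2; split.
    have <- : c1 = b1 by apply: finj; rewrite ?inE// fc1.
    by have <- : c2 = b2 by apply: finj; rewrite ?inE// fc2.
  by apply: measurableX; apply: open_borel; exact: Bo.
have -> : W n k = set0.
  apply/seteqP; split => // p [c1 [c2 [Bc1 Bc2 fc1 fc2 [sub cp]]]].
  by apply: no; exists c1, c2; split.
exact: measurable0.
Qed.

Lemma continuous_borel2 (f : H * H -> H) : @second_countable H -> continuous f ->
  measurable_fun [set: BH * BH] (f : BH * BH -> BH).
Proof.
move=> sc cf; apply: (@measurability _ _ (BH * BH)%type BH setT f (@open H)) => //.
move=> _ [U oU <-]; rewrite setTI; apply: open_borel_prod => //.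
by apply: open_comp => // x _; exact: cf.
Qed.

End borel_group.

(** In contrast to [measurable_Rintegral1], neither boundedness nor a domain of finite measure is
    assumed: Tonelli applies to the positive and negative parts separately. *)
Lemma measurable_Rintegral_param (R : realType) (d1 d2 : measure_display)
    (T1 : measurableType d1) (T2 : measurableType d2)
    (m : {sigma_finite_measure set T1 -> \bar R}) (D : set T1)
    (w : T1 -> T2 -> R) : measurable D ->
  measurable_fun [set: T1 * T2] (fun p => w p.1 p.2) ->
  measurable_fun [set: T2] (fun y => Rintegral m D (w ^~ y)).
Proof.
move=> mD mw; rewrite /Rintegral; apply: measurableT_comp => //.
pose v (p : T1 * T2) : \bar R := ((fun p => (w p.1 p.2)%:E) \_ (D `*` setT)) p.
have mDT : measurable (D `*` [set: T2]) by exact: measurableX.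
have mv : measurable_fun setT v.
  apply/(measurable_restrictT _ mDT); apply: measurable_funTS.
  exact/measurable_EFinP.
have -> : (fun y => \int[m]_(x in D) (w x y)%:E)%E =
    (fun y => fubini_G m v^\+ y - fubini_G m v^\- y)%E.
  apply/funext => y; rewrite integral_mkcond.
  have -> : (fun x => (w x y)%:E) \_ D = fun x => v (x, y).
    apply/funext => x; rewrite /v !patchE; congr (if _ then _ else _).
    by apply/idP/idP; rewrite !inE => //= -[].
  by rewrite integralE /fubini_G; congr (_ - _)%E; apply: eq_integral => x _;
    rewrite ?funeposE ?funenegE.
apply: emeasurable_funB; apply: measurable_fun_fubini_tonelli_G => //.
- exact: measurable_funepos.
- exact: measurable_funeneg.
Qed.

(** * Haar measure: volume of balls, integrability of exponentials, Folner averages *)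

Section haar.
Context (R : realType) (H : ptopologicalType)
  (mul : H -> H -> H) (inv : H -> H) (e : H)
  (m : {sigma_finite_measure set borel_of H -> \bar R}) (d : H -> H -> R).
Notation BH := (borel_of H).
Context (lcsc : lcsc_group mul inv e) (haar : left_Haar mul m)
  (met : proper_left_inv_metric mul d).

Let grpH : is_group mul inv e. Proof. by case: lcsc. Qed.
Let hausH : hausdorff_space H. Proof. by case: lcsc. Qed.
Let mulVK g h : mul g (mul (inv g) h) = h. Proof. exact: (grp_mulVK grpH). Qed.
Let mulKV g h : mul (inv g) (mul g h) = h.
Proof. by case: grpH => mulA mul1 mulV; rewrite mulA (mulV g).1 (mul1 h).1. Qed.

Let cmull g : continuous (mul g).
Proof.
case: lcsc => _ cm _ _ _ x.
exact: (cvg_comp _ _ (cvg_pair (cvg_cst g) (@cvg_id _ (nbhs x))) (cm (g, x))).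
Qed.

Let cmulr g : continuous (fun x => mul x g).
Proof.
case: lcsc => _ cm _ _ _ x.
exact: (cvg_comp _ _ (cvg_pair (@cvg_id _ (nbhs x)) (cvg_cst g)) (cm (x, g))).
Qed.

Lemma dist_continuous x : continuous (d x).
Proof.
case: met => _ _ _ [_ cd _] y.
exact: (cvg_comp _ _ (cvg_pair (cvg_cst x) (@cvg_id _ (nbhs y))) (cd (x, y))).
Qed.

Lemma dball_open x r : open (dball d x r).
Proof.
rewrite (_ : dball d x r = d x @^-1` [set t | t < r])//.
by apply: open_comp; [move=> y _; exact: dist_continuous|exact: open_lt].
Qed.

Lemma measurable_dball x r : measurable (dball d x r : set BH).
Proof. by apply: open_borel; exact: dball_open. Qed.

Lemma measurable_dist x : measurable_fun [set: BH] (d x : BH -> R).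
Proof.
apply: (measurability _ (RGenOInfty.measurableE R)) => _ [_ [a ->] <-].
rewrite setTI; apply: open_borel.
rewrite (_ : _ @^-1` _ = d x @^-1` [set t | a < t]).
  by apply: open_comp; [move=> y _; exact: dist_continuous|exact: open_gt].
by apply/seteqP; split => y /=; rewrite in_itv/= andbT.
Qed.

Lemma dball_translate h r : dball d h r = mul h @` dball d e r.
Proof.
case: met => _ _ _ [dI _ _]; have [mulA mul1 mulV] := grpH.
apply/seteqP; split => [y hy|_ [y ey <-]] /=.
  exists (mul (inv h) y); last exact: mulVK.
  by rewrite /dball/= -(dI h) mulVK (mul1 h).2.
by rewrite /dball/= -{1}[h](mul1 h).2 dI.
Qed.

Lemma haar_dball h r : m (dball d h r) = m (dball d e r).
Proof.
by case: haar => mI _ _; rewrite dball_translate mI//; exact: measurable_dball.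
Qed.

Lemma haar_compact_lty (K : set H) : compact K -> (m K < +oo)%E.
Proof. by case: haar => _ + _; exact. Qed.

Lemma haar_dball_lty h r : (m (dball d h r) < +oo)%E.
Proof.
have cK : compact [set y | d h y <= r] by case: met => _ _ _ [].
apply: le_lt_trans (haar_compact_lty cK).
apply: le_measure; rewrite ?inE.
- exact: measurable_dball.
- exact: compact_borel.
- by move=> y /ltW.
Qed.

Lemma haar_volume (eps : R) : subexp_growth m d e -> 0 < eps ->
  exists r0 : R, forall (r : R) h, r0 <= r ->
    (m [set h' | (d h h' < r)%R] <= (expR (eps * r))%:E)%E.
Proof.
move=> sub eps0.
have : (limf_esup (fun r : R => (ln (fine (m (dball d e r))) / r)%:E)
  (@pinfty_nbhs R) < eps%:E)%E by rewrite sub lte_fin.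
move=> /ereal_inf_lt[_ [V [A [_ AV]] <-]] supV.
exists (Num.max 1 (A + 1)) => r h; rewrite ge_max => /andP[r1 rA].
have r0 : 0 < r by exact: lt_le_trans r1.
have Vr : V r by apply: AV; lra.
have : ((ln (fine (m (dball d e r))) / r)%:E < eps%:E)%E.
  by apply: le_lt_trans supV; apply: ereal_sup_ubound; exists r.
rewrite lte_fin ltr_pdivrMr// => lnm.
rewrite -/(dball d h r) haar_dball -[X in (X <= _)%E]fineK; last first.
  by rewrite ge0_fin_numE//; exact: haar_dball_lty.
(* The logarithm carries information only for positive measure; a null ball satisfies the bound
   trivially. *)
rewrite lee_fin; have [m0|m0] := leP (fine (m (dball d e r))) 0.
  by rewrite (le_trans m0)// expR_ge0.
by rewrite -[leLHS]lnK ?posrE// ler_expR ltW.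
Qed.

(** On the shell [n <= d e h < n.+1] the function is at most [expR (- c * n%:R)]. Volume growth at
    rate [c / 2] then leaves a geometric series of ratio [expR (- (c / 2))]. *)
Lemma exp_dist_integrable (c : R) : subexp_growth m d e -> 0 < c ->
  m.-integrable [set: BH] (EFin \o (fun h => expR (- c * d e h))).
Proof.
move=> sub c0.
have c20 : 0 < c / 2 by exact: divr_gt0.
have [r0 vol] := haar_volume sub c20.
(* Enlarging every radius by [r1] extends the volume bound to all radii [r >= 0], at the price of a
   constant factor. *)
pose r1 := Num.max 0 r0.
have r10 : 0 <= r1 by rewrite le_max lexx.
have volA r : 0 <= r -> (m (dball d e r) <= (expR (c / 2 * (r + r1)))%:E)%E.
  move=> rge0; apply: le_trans (vol (r + r1) e _); last first.
    by rewrite (@le_trans _ _ r1)// ?le_max ?lexx ?orbT// lerDr.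
  apply: le_measure; rewrite ?inE; [exact: measurable_dball|exact: measurable_dball|].
  by move=> y /= yr; rewrite (lt_le_trans yr)// lerDl.
have mg : measurable_fun [set: BH] (fun h : BH => expR (- c * d e h)).
  apply: measurableT_comp => //; apply: measurable_funM => //; exact: measurable_dist.
apply/integrableP; split; first exact/measurable_EFinP.
pose f n (h : BH) : \bar R := (expR (- c * n%:R) * \1_(dball d e n.+1%:R) h)%:E.
have f0 n h : (0 <= f n h)%E by rewrite lee_fin mulr_ge0 ?expR_ge0.
have mfn n : measurable_fun setT (f n).
  apply/measurable_EFinP; apply: measurable_funM => //.
  by apply: measurable_indic; exact: measurable_dball.
apply: (@le_lt_trans _ _ (\int[m]_h (\sum_(0 <= n <oo) f n h))%E).
  apply: ge0_le_integral => //.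
  - by apply: measurableT_comp => //; exact/measurable_EFinP.
  - by apply: ge0_emeasurable_sum => [n h _ _|n _]; [exact: f0|exact: mfn].
  move=> h _; rewrite gee0_abs ?lee_fin ?expR_ge0//.
  have dh0 : 0 <= d e h by exact: (dist_ge0 met).
  pose n := Num.truncn (d e h).
  have /andP[n1 n2] := Num.Theory.truncn_itv dh0.
  apply: (@le_trans _ _ (f n h)).
    rewrite lee_fin indicE mem_set ?mulr1//.
    by rewrite ler_expR !mulNr lerN2 ler_wpM2l// ltW.
  rewrite (nneseriesD1 (n := n))//.
  by apply: leeDl; apply: nneseries_ge0 => k _ _; exact: f0.
rewrite integral_nneseries//.
pose q := expR (- (c / 2)); pose A := expR (c / 2 * (1 + r1)).
have q0 : 0 < q by exact: expR_gt0.
have q1 : `|q| < 1 by rewrite gtr0_norm// -expR0 ltr_expR; lra.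
have fint n : (\int[m]_h f n h <= (geometric A q n)%:E)%E.
  rewrite /f; under eq_integral do rewrite EFinM.
  rewrite ge0_integralZl//; last first.
    by apply/measurable_EFinP; apply: measurable_indic; exact: measurable_dball.
  rewrite integral_indic//; last exact: measurable_dball.
  rewrite setIT; apply: (@le_trans _ _ ((expR (- c * n%:R))%:E *
    (expR (c / 2 * (n.+1%:R + r1)))%:E)%E).
    by rewrite lee_wpmul2l ?lee_fin ?expR_ge0//; exact: volA.
  rewrite -EFinM lee_fin /geometric /= /A /q -expRM_natl -!expRD ler_expR.
  by rewrite -natr1 le_eqVlt; apply/orP; left; apply/eqP; field.
apply: (@le_lt_trans _ _ (A / (1 - q))%:E); last exact: ltry.
apply: lime_le.
  by apply: is_cvg_nneseries => n _ _; apply: integral_ge0 => h _; exact: f0.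
apply: nearW => n.
apply: (@le_trans _ _ (\sum_(0 <= k < n) (geometric A q k)%:E)%E).
  by apply: lee_sum => k _; exact: fint.
rewrite sumEFin lee_fin; apply: geometric_le_lim => //; exact: expR_ge0.
Qed.

Let mmul : measurable_fun [set: BH * BH] (fun p : BH * BH => mul p.1 p.2 : BH).
Proof.
by case: lcsc => _ cm _ _ [_ sc]; exact: (continuous_borel2 sc cm).
Qed.

Let mmull g : measurable_fun [set: BH] (mul g : BH -> BH).
Proof. exact: continuous_borel. Qed.

Let mmulr g : measurable_fun [set: BH] ((fun x => mul x g) : BH -> BH).
Proof. exact: (continuous_borel (@cmulr g)). Qed.

Let mindr (F : set H) h : measurable (F : set BH) ->
  measurable_fun [set: BH] (fun x : BH => \1_F (mul x h) : R).
Proof.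
by move=> mF; exact: (measurableT_comp (measurable_indic mF) (mmulr h)).
Qed.

Lemma haar_translation g (k : BH -> R) :
  m.-integrable setT (EFin \o k) ->
  Rintegral m setT (fun h => k (mul g h)) = Rintegral m setT k.
Proof.
move=> ik; have mk : measurable_fun setT k.
  by apply/measurable_EFinP; exact: measurable_int ik.
have pf (A : set BH) : measurable A -> pushforward m (mul g : BH -> BH) A = m A.
  case: haar => mI _ _ mA; rewrite /pushforward.
  have <- : mul (inv g) @` A = (mul g : BH -> BH) @^-1` A.
    apply/seteqP; split => [_ [y Ay <-]|y Ay] /=; first by rewrite mulVK.
    by exists (mul g y); rewrite ?mulKV.
  exact: mI.
rewrite /Rintegral; congr fine.
transitivity (\int[pushforward m (mul g : BH -> BH)]_x (k x)%:E)%E; last first.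
  by apply: eq_measure_integral => A mA _; exact: pf.
rewrite (@integral_pushforward _ _ _ _ _ _ (mmull g) m setT (EFin \o k)) ?preimage_setT//.
  exact/measurable_EFinP.
apply/integrableP; split.
  exact: (measurableT_comp (measurable_int _ ik) (mmull g)).
have /integrableP[_] := ik; apply: le_lt_trans.
rewrite le_eqVlt; apply/orP; left; apply/eqP.
transitivity (\int[pushforward m (mul g : BH -> BH)]_x `|(k x)%:E|)%E; last first.
  by apply: eq_measure_integral => A mA _; exact: pf.
rewrite (@ge0_integral_pushforward _ _ _ _ _ _ (mmull g) m setT
  (fun x => `|(k x)%:E|)%E) ?preimage_setT//.
by apply: measurableT_comp => //; exact/measurable_EFinP.
Qed.

(** This is the measure of the intersection of [F] with its right translate by [inv h], in the
    integral form that Fubini produces. *)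
Definition overlap (F : set H) (h : H) : R :=
  Rintegral m F (fun h1 => \1_F (mul h1 h)).

Lemma overlap_le (F : set H) h : compact F -> 0 <= overlap F h <= fine (m F).
Proof.
move=> cF; have mF := compact_borel hausH cF.
apply/andP; split; first by apply: Rintegral_ge0.
apply: (le_trans (ler_norm _)); rewrite -[leRHS]mul1r.
apply: normr_Rintegral_le => //.
- exact: haar_compact_lty.
- by apply: measurable_funTS; exact: mindr.
- by move=> x _; rewrite indicE; case: (_ \in _); rewrite ?normr1 ?normr0.
Qed.

(** Left invariance allows the substitution [h2 = mul h1 h], after which the integrals are
    exchanged. The compact set [D] of all quotients [mul (inv h1) h2] keeps the outer domain of
    finite measure, as the bounded form of Fubini requires; off [D] the overlap is zero. *)
Lemma double_integral_overlap (F : set H) (psi : BH -> R) (B : R) :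
  compact F -> measurable_fun setT psi -> (forall h, `|psi h| <= B) ->
  Rintegral m F (fun h1 => Rintegral m F (fun h2 => psi (mul (inv h1) h2))) =
  Rintegral m setT (fun h => overlap F h * psi h).
Proof.
move=> cF mpsi psiB; have mF := compact_borel hausH cF.
have mFoo := haar_compact_lty cF.
pose D := (fun p : H * H => mul (inv p.1) p.2) @` (F `*` F).
have cD : compact D.
  apply: continuous_compact; last exact: compact_setX.
  apply: continuous_subspaceT => -[x y]; case: lcsc => _ cm ci _ _.
  have c1 : p.1 @[p --> (x, y)] --> x by exact: cvg_fst.
  have c2 : p.2 @[p --> (x, y)] --> y by exact: cvg_snd.
  have c3 : (inv p.1, p.2) @[p --> (x, y)] --> (inv x, y).
    exact: (cvg_pair (cvg_comp _ _ c1 (ci x)) c2).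
  exact: (cvg_comp _ _ c3 (cm (inv x, y))).
have mD := compact_borel hausH cD; have mDoo := haar_compact_lty cD.
have outD h1 h : F h1 -> ~ D h -> \1_F (mul h1 h) = 0 :> R.
  move=> Fh1 nD; rewrite indicE memNset// => Fh; apply: nD.
  by exists (h1, mul h1 h) => //=; rewrite mulKV.
have mind : measurable_fun [set: BH * BH] (fun p : BH * BH => \1_F (mul p.1 p.2) : R).
  by apply: measurableT_comp mmul; exact: measurable_indic.
have stepA h1 : F h1 -> Rintegral m F (fun h2 => psi (mul (inv h1) h2)) =
    Rintegral m D (fun h => \1_F (mul h1 h) * psi h).
  move=> Fh1; rewrite Rintegral_mkcond [RHS]Rintegral_mkcond.
  rewrite -(@haar_translation h1 (((fun h2 => psi (mul (inv h1) h2)) : BH -> R) \_ F)).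
    apply: eq_Rintegral => h _; rewrite !patchE mulKV.
    case: ifPn => Fh.
      rewrite mem_set; first by rewrite indicE Fh mul1r.
      by exists (h1, mul h1 h) => /=; [split => //; move: Fh; rewrite inE|rewrite mulKV].
    by case: ifP => // _; rewrite indicE (negbTE Fh) mul0r.
  rewrite -restrict_EFin -integrable_mkcond//.
  apply: (@integrable_bounded _ _ _ _ _ _ B) => //.
  by apply: measurable_funTS; exact: (measurableT_comp mpsi (mmull (inv h1))).
rewrite (@eq_Rintegral _ _ _ m F
  (fun h1 => Rintegral m D (fun h => \1_F (mul h1 h) * psi h))); last first.
  by move=> h1; rewrite inE; exact: stepA.
rewrite (@Fubini_Rintegral _ _ _ BH BH m m F D
  (fun h1 h => \1_F (mul h1 h) * psi h) B)//; last 2 first.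
- by apply: measurable_funM => //; exact: measurableT_comp.
- move=> x y; rewrite normrM indicE -[leRHS]mul1r ler_pM//.
  by case: (_ \in _); rewrite ?normr1 ?normr0.
rewrite Rintegral_mkcond; apply: eq_Rintegral => h _; rewrite patchE.
case: ifPn => Dh.
  rewrite RintegralZr//; apply: (@integrable_bounded _ _ _ _ _ _ 1) => //.
    by apply: measurable_funTS; exact: mindr.
  by move=> x _; rewrite indicE; case: (_ \in _); rewrite ?normr1 ?normr0.
rewrite /overlap (@eq_Rintegral _ _ _ m F (cst 0)); first by rewrite Rintegral_cst// !mul0r.
by move=> h1; rewrite inE => Fh1; apply: outD => //; move: Dh; rewrite notin_setE.
Qed.

(** The defect of the overlap is the part of [F T] outside its right translate by [inv h], hence at
    most the symmetric difference that the Folner condition at [inv h] makes negligible. *)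
Lemma overlap_cvg (F : nat -> set H) h : right_Folner mul m F ->
  m (F T) @[T --> \oo] --> +oo%E ->
  overlap (F T) h / fine (m (F T)) @[T --> \oo] --> (1 : R).
Proof.
move=> [cF _ fol] Foo.
have mF T := compact_borel hausH (cF T).
have mFoo T := haar_compact_lty (cF T).
pose G T := (fun x => mul x (inv h)) @` F T.
have cG T : compact (G T).
  by apply: continuous_compact => //; apply: continuous_subspaceT; exact: cmulr.
have mG T := compact_borel hausH (cG T); have mGoo T := haar_compact_lty (cG T).
have ovE T : overlap (F T) h = fine (m (F T `&` G T)).
  have -> : m (F T `&` G T) = (\int[m]_(x in F T) (\1_(G T) x)%:E)%E.
    by rewrite (integral_indic m (mF T) (mG T)) setIC.
  rewrite /overlap /Rintegral; congr fine; apply: eq_integral => x _.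
  have [mulA mul1 mulV] := grpH.
  have E : (mul x h \in F T) = (x \in G T).
    apply/idP/idP; rewrite !inE; [move=> Fx|move=> [y Fy <-]].
      by exists (mul x h) => //; rewrite -mulA (mulV h).2 (mul1 x).2.
    by rewrite -mulA (mulV h).1 (mul1 y).2.
  by rewrite !indicE E.
have pos : \forall T \near \oo, 0 < fine (m (F T)).
  have /cvgeyPge/(_ 1) := Foo; apply: filterS => T F1.
  apply: fine_gt0; rewrite mFoo andbT; exact: lt_le_trans F1.
have sq : (1 - overlap (F T) h / fine (m (F T))) @[T --> \oo] --> (0 : R).
  apply: (@squeeze_cvgr _ _ _ _ (fun=> 0) _ _ _ _ (cvg_cst _) (fol (inv h))).
  apply: filterS pos => T F0.
  have /andP[ge0ov leovF] := overlap_le h (cF T).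
  rewrite subr_ge0 ler_pdivrMr// mul1r leovF /=.
  have F0' : fine (m (F T)) != 0 by rewrite gt_eqF.
  rewrite -[X in X - _](divff F0') -mulrBl.
  rewrite ler_wpM2r ?invr_ge0 ?(ltW F0)// ovE.
  have mFG : measurable (F T `&` G T : set BH) by exact: measurableI.
  have mFD : measurable (F T `\` G T : set BH) by exact: measurableD.
  have fin (A B : set BH) : measurable A -> measurable B -> A `<=` B ->
      (m B < +oo)%E -> m A \is a fin_num.
    move=> mA mB AB Boo; rewrite ge0_fin_numE//; apply: le_lt_trans Boo.
    by apply: le_measure; rewrite ?inE.
  have fFG := fin _ _ mFG (mF T) (@subIsetl _ _ _) (mFoo T).
  have fFD := fin _ _ mFD (mF T) (@subDsetl _ _ _) (mFoo T).
  have mU : measurable ((F T `\` G T) `|` (G T `\` F T) : set BH).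
    by apply: measurableU => //; exact: measurableD.
  have Uoo : (m ((F T `\` G T) `|` (G T `\` F T)) < +oo)%E.
    apply: (@le_lt_trans _ _ (m (F T `|` G T))).
      apply: le_measure; rewrite ?inE//; first exact: measurableU.
      by move=> x [[? _]|[? _]]; [left|right].
    by apply: haar_compact_lty; exact: compactU.
  rewrite lerBlDr -lee_fin EFinD !fineK//; last 2 first.
  - by rewrite ge0_fin_numE.
  - by rewrite ge0_fin_numE.
  rewrite -[X in (m X <= _)%E](setUIDK (F T) (G T)) measureU//.
    by rewrite addeC; apply: leeD => //; apply: le_measure; rewrite ?inE//.
  by apply/seteqP; split => // x [[? ?] []].
rewrite -[X in _ --> X](subr0 1); apply: cvg_trans (cvgB (cvg_cst (1 : R)) sq).
by apply: near_eq_cvg; apply: nearW => T /=; rewrite opprB addrC subrK.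
Qed.

(** By [double_integral_overlap] the average integrates [psi] against weights in [[0, 1]] that tend
    to 1 pointwise; dominated convergence applies with majorant [|psi|]. *)
Lemma folner_average (F : nat -> set H) (psi : BH -> R) (B : R) :
  right_Folner mul m F -> m (F T) @[T --> \oo] --> +oo%E ->
  (forall h, `|psi h| <= B) -> m.-integrable setT (EFin \o psi) ->
  (fine (m (F T)))^-1 *
    Rintegral m (F T) (fun h1 => Rintegral m (F T) (fun h2 => psi (mul (inv h1) h2)))
  @[T --> \oo] --> Rintegral m setT psi.
Proof.
move=> fol Foo psiB ipsi; have [cF _ _] := fol.
have mpsi : measurable_fun setT psi by apply/measurable_EFinP; exact: measurable_int ipsi.
have mF T := compact_borel hausH (cF T).
have mov T : measurable_fun [set: BH] (fun h : BH => overlap (F T) h).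
  apply: (@measurable_Rintegral_param _ _ _ BH BH m (F T) (fun h1 h => \1_(F T) (mul h1 h))) => //.
  exact: (measurableT_comp (measurable_indic (mF T)) mmul).
pose f T (h : BH) : R := overlap (F T) h / fine (m (F T)) * psi h.
have mf T : measurable_fun setT (f T).
  by apply: measurable_funM => //; exact: measurable_funM.
have ov1 T h : `|overlap (F T) h / fine (m (F T))| <= 1.
  have /andP[ge0ov leovF] := overlap_le h (cF T).
  rewrite ger0_norm ?divr_ge0//; last exact: fine_ge0.
  have [F0|F0] := ltP 0 (fine (m (F T))); first by rewrite ler_pdivrMr// mul1r.
  have -> : fine (m (F T)) = 0 by apply/eqP; rewrite eq_le F0 fine_ge0.
  by rewrite invr0 mulr0.
have fpsi T h : `|f T h| <= `|psi h|.
  by rewrite /f normrM ler_piMl.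
have ifT T : m.-integrable setT (EFin \o f T).
  apply: le_integrable ipsi => //; first exact/measurable_EFinP.
  by move=> h _; rewrite lee_fin.
have ptw : {ae m, forall h, setT h -> (EFin \o f T) h @[T --> \oo] --> (EFin \o psi) h}.
  apply: aeW => h _; apply: cvg_EFin; first exact: nearW.
  rewrite -[X in _ --> X]mul1r; apply: cvgMl; exact: overlap_cvg.
have dom : {ae m, forall h T, setT h ->
    (`|(EFin \o f T) h| <= (abse \o (EFin \o psi)) h)%E}.
  by apply: aeW => h T _; rewrite lee_fin.
have mEf T : measurable_fun setT (EFin \o f T) by exact/measurable_EFinP.
have [_ _ lim1] := @dominated_convergence _ _ R m setT measurableT _ _ _ mEf
  (measurable_int _ ipsi) ptw (integrable_abse ipsi) dom.
have fin : (\int[m]_h (psi h)%:E)%E \is a fin_num by exact: integrable_fin_num.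
rewrite /= in lim1.
have lim2 : (\int[m]_h (f T h)%:E)%E @[T --> \oo] --> (Rintegral m setT psi)%:E.
  by rewrite /Rintegral fineK.
apply: cvg_trans (fine_cvg lim2); apply: near_eq_cvg; apply: nearW => T /=.
rewrite (double_integral_overlap (cF T) mpsi psiB) -/(Rintegral m setT (f T)).
have iov : m.-integrable setT (EFin \o (fun h => overlap (F T) h * psi h)).
  have := integrableZl measurableT (fine (m (F T))) (ipsi).
  move=> ifp; apply: le_integrable ifp => //.
    by apply/measurable_EFinP; apply: measurable_funM.
  move=> h _; rewrite lee_fin !normrM ler_wpM2r//.
  have /andP[ge0ov leovF] := overlap_le h (cF T).
  by rewrite !ger0_norm// fine_ge0.
rewrite -RintegralZl//; apply: eq_Rintegral => h _.
by rewrite /f mulrA (mulrC (_^-1)).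
Qed.

End haar.

(** * The central limit theorem *)

(** The exceptional null set depends on [h], so the quantifiers are exchanged by Fubini: the
    integral of the indicator of the disagreement set [S] is 0, hence almost every [x] has a null
    section. *)
Lemma ae_eq_Rintegral_param (R : realType) (d1 d2 : measure_display)
    (G : measurableType d1) (X : measurableType d2)
    (m : {sigma_finite_measure set G -> \bar R}) (mu : probability X R)
    (D : set G) (w1 w2 : G -> X -> R) : measurable D -> (m D < +oo)%E ->
  measurable_fun [set: G * X] (fun p => w1 p.1 p.2) ->
  measurable_fun [set: G * X] (fun p => w2 p.1 p.2) ->
  (forall h, {ae mu, forall x, w1 h x = w2 h x}) ->
  {ae mu, forall x, Rintegral m D (w1 ^~ x) = Rintegral m D (w2 ^~ x)}.
Proof.
move=> mD mDoo mw1 mw2 w12.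
pose S : set (G * X) := [set p | w1 p.1 p.2 - w2 p.1 p.2 != 0].
have mS : measurable S.
  rewrite (_ : S = setT `&` (fun p => w1 p.1 p.2 - w2 p.1 p.2) @^-1` (~` [set 0])).
    by apply: measurable_funB => //; exact: measurableC.
  by rewrite setTI; apply/seteqP; split => p /= /eqP.
pose I (h : G) (x : X) : R := \1_S (h, x).
have mI : measurable_fun [set: G * X] (fun p => I p.1 p.2).
  rewrite (_ : (fun p => I p.1 p.2) = \1_S); first exact: measurable_indic.
  by apply/funext => -[].
have I0 h x : 0 <= I h x by rewrite /I indicE.
have I1 h x : `|I h x| <= 1.
  by rewrite /I indicE; case: (_ \in _); rewrite ?normr1 ?normr0.
have muT : (mu setT < +oo)%E by exact: fin_num_fun_lty.
pose k x := Rintegral m D (I ^~ x).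
have mk : measurable_fun setT k.
  exact: (@measurable_Rintegral1 _ _ _ G X m mu D setT I 1).
have mIx x : measurable_fun setT (I ^~ x).
  exact: measurableT_comp mI (pair2_measurable x).
have k0 x : 0 <= k x by exact: Rintegral_ge0.
have kM x : `|k x| <= 1 * fine (m D).
  by apply: normr_Rintegral_le => //; exact: measurable_funTS.
have ik : mu.-integrable setT (EFin \o k).
  exact: (@integrable_bounded _ _ _ _ _ _ (1 * fine (m D))).
have Ek : Rintegral mu setT k = 0.
  rewrite -(@Fubini_Rintegral _ _ _ G X m mu D setT I 1)//.
  rewrite (@eq_Rintegral _ _ _ m D (cst 0)); first by rewrite Rintegral_cst// mul0r.
  move=> h _; rewrite -(mexp_cst mu 0); apply: eq_mexp_ae => //.
    exact: measurableT_comp mI (pair1_measurable h).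
  apply: filterS (w12 h) => x wx; rewrite /I indicE memNset//=.
  by rewrite /S /= wx subrr eqxx.
have /(ae_eq_integral_abs mu measurableT (measurable_int _ ik)) :
    (\int[mu]_x `|(EFin \o k) x| = 0)%E.
  rewrite (eq_integral (EFin \o k)); last first.
    by move=> x _ /=; rewrite ger0_norm.
  by rewrite -[LHS]fineK ?integrable_fin_num// -/(Rintegral mu setT k) Ek.
apply: filterS => x /(_ Logic.I) /= [kx].
have iI : m.-integrable D (EFin \o (I ^~ x)).
  by apply: (@integrable_bounded _ _ _ _ _ _ 1) => //; exact: measurable_funTS.
have : (\int[m]_(h in D) `|(EFin \o (I ^~ x)) h| = 0)%E.
  rewrite (eq_integral (EFin \o (I ^~ x))); last first.
    by move=> h _ /=; rewrite ger0_norm.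
  by rewrite -[LHS]fineK ?integrable_fin_num// -/(Rintegral m D (I ^~ x)) -/(k x) kx.
move/(ae_eq_integral_abs m mD (measurable_int _ iI)) => aeI.
rewrite /Rintegral; congr fine; apply: ae_eq_integral => //.
- apply/measurable_EFinP; apply: measurable_funTS.
  exact: measurableT_comp mw1 (pair2_measurable x).
- apply/measurable_EFinP; apply: measurable_funTS.
  exact: measurableT_comp mw2 (pair2_measurable x).
apply: filterS aeI => h hD /hD [] Ih; congr EFin; apply/eqP.
have [//|wN] := eqVneq (w1 h x) (w2 h x).
move: Ih => /eqP; rewrite /I indicE mem_set ?oner_eq0//.
by rewrite /S /= subr_eq0.
Qed.

Lemma decoupled_weaken (R : realType) (dG : measure_display) (G : measurableType dG)
    (dX : measure_display) (X : measurableType dX) (mu : probability X R)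
    (u : G -> X -> R) (d : G -> G -> R) :
  (forall n, exists2 c : R, 0 < c & exists2 C : R, 0 <= C &
    forall (L1 L2 : seq G) (b : R), (size L1 + size L2 = n)%N -> 0 <= b ->
    allrel (fun h h' => b <= d h h') L1 L2 ->
    `|mexp mu (uprod u (L1 ++ L2)) - mexp mu (uprod u L1) * mexp mu (uprod u L2)|
      <= C * expR (- c * b)) ->
  forall n, exists2 c : R, 0 < c & exists2 C : R, 0 <= C & decoupled mu u d n c C.
Proof.
move=> decn; elim=> [|n [c1 c10 [C1 C10 IH]]].
  have [c c0 [C C0 P]] := decn 0%N; exists c => //; exists C => // L1 L2 b.
  by rewrite leqn0 => /eqP sz; exact: P.
have [c2 c20 [C2 C20 P]] := decn n.+1.
exists (Num.min c1 c2); first by rewrite lt_min c10.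
exists (C1 + C2); first exact: addr_ge0.
move=> L1 L2 b; rewrite leq_eqVlt => /orP[/eqP sz|sz] b0 L12.
  apply: (le_trans (P _ _ _ sz b0 L12)).
  rewrite ler_pM ?expR_ge0 ?lerDr// ler_expR !mulNr lerN2 ler_wpM2r//.
  by rewrite ge_min lexx orbT.
apply: (le_trans (IH _ _ _ sz b0 L12)).
rewrite ler_pM ?expR_ge0 ?lerDl// ler_expR !mulNr lerN2 ler_wpM2r//.
by rewrite ge_min lexx.
Qed.

Section clt.
Context (R : realType) (H : ptopologicalType)
  (mul : H -> H -> H) (inv : H -> H) (e : H)
  (m : {sigma_finite_measure set borel_of H -> \bar R}) (d : H -> H -> R)
  (F : nat -> set H)
  (dX : measure_display) (X : measurableType dX) (mu : probability X R)
  (a : H -> X -> X) (Ainv : set (X -> R)) (N : nat -> (X -> R) -> R).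
Notation BH := (borel_of H).
Context (lcsc : lcsc_group mul inv e) (haar : left_Haar mul m)
  (met : proper_left_inv_metric mul d) (growth : subexp_growth m d e)
  (folner : right_Folner mul m F) (Foo : m (F T) @[T --> \oo] --> +oo%E)
  (action : mp_action mul e mu a) (alg : inv_subalgebra inv a mu Ainv)
  (norms : good_seminorms d e inv a mu Ainv N)
  (mixing : exp_mixing_all_orders d inv a mu Ainv N).
Context (f : X -> R) (fA : Ainv f) (f_mean : mexp mu f = 0).

Let grpH : is_group mul inv e. Proof. by case: lcsc. Qed.
Let hausH : hausdorff_space H. Proof. by case: lcsc. Qed.

Let mf : measurable_fun setT f. Proof. by case: alg => /(_ _ fA)[]. Qed.

(* [f] is only essentially bounded, so it is replaced by a truncation. *)
Context (M : R) (M1 : 1 <= M) (fM : {ae mu, forall x, `|f x| <= M}).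

Let ft (x : X) : R := f x * \1_[set x | `|f x| <= M] x.

Let mft : measurable_fun setT ft.
Proof.
apply: measurable_funM => //; apply: measurable_indic.
rewrite (_ : [set x | _] = setT `&` (fun x => `|f x|) @^-1` `]-oo, M]%classic).
  have mn : measurable_fun setT (fun x => `|f x|) by exact: measurableT_comp.
  by apply: mn => //; exact: measurable_itv.
by rewrite setTI; apply/seteqP; split => x /=; rewrite in_itv.
Qed.

Let ftM x : `|ft x| <= M.
Proof.
rewrite /ft indicE; have [xM|xM] := boolP (x \in _).
  by rewrite mulr1; move: xM; rewrite inE.
by rewrite mulr0 normr0 (le_trans _ M1).
Qed.

Let ft_ae : {ae mu, forall x, f x = ft x}.
Proof. by apply: filterS fM => x xM; rewrite /ft indicE mem_set// mulr1. Qed.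

Let u (h : BH) (x : X) : R := ft (a (inv h) x).

Let mainv : measurable_fun [set: BH * X] (fun p : BH * X => a (inv p.1) p.2).
Proof.
case: action => ma _ _ _.
have mi : measurable_fun [set: BH] (inv : BH -> BH).
  by case: lcsc => _ _ ci _ _; exact: continuous_borel.
have mp : measurable_fun [set: BH * X] (fun p : BH * X => (inv p.1 : BH, p.2)).
  apply: measurable_fun_pair; last exact: measurable_snd.
  exact: (measurableT_comp mi measurable_fst).
exact: (measurableT_comp ma mp).
Qed.

Let mu_u : measurable_fun [set: BH * X] (fun p => u p.1 p.2).
Proof. exact: (measurableT_comp mft mainv). Qed.

Let uM h x : `|u h x| <= M. Proof. exact: ftM. Qed.

Let u_act h : {ae mu, forall x, act_fun inv a h f x = u h x}.
Proof. exact: (ae_act action (inv h) ft_ae). Qed.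

Let u_mean h : mexp mu (u h) = 0.
Proof.
rewrite (mexp_act action (inv h) mft (aeW _ ftM)) -f_mean.
by apply/esym; apply: eq_mexp_ae.
Qed.

Let pts (L : seq BH) : seq (H * (X -> R)) := [seq (h : H, f) | h <- L].

Let pts_alg L : all (in_alg Ainv) (pts L).
Proof. by elim: L => //= h L ->; rewrite andbT; apply/asboolP. Qed.

Let uprod_corr L : mexp mu (uprod u L) = corr inv mu a (pts L).
Proof.
apply: eq_mexp_ae.
- by case: (bounded_uprod mu_u uM L).
- exact: (measurable_point_prod action alg (pts_alg L)).
elim: L => [|h L IH].
  by apply: aeW => x; rewrite /uprod /point_prod !big_nil.
apply: filterS2 (u_act h) IH => x hx IHx.
by rewrite /uprod /point_prod /= !big_cons -hx; congr (_ * _).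
Qed.

Let dec n : exists2 c : R, 0 < c & exists2 C : R, 0 <= C & decoupled mu u d n c C.
Proof.
apply: decoupled_weaken n => n.
have [s s1 [c c0 [C C0 P]]] := decoupling grpH met action alg norms mixing n.
exists c => //; exists (C * N s f ^+ n).
  by rewrite mulr_ge0// exprn_ge0//; exact: (norm_ge0 norms).
move=> L1 L2 b sz b0 L12; rewrite !uprod_corr /pts map_cat.
have := P (pts L1) (pts L2) b; rewrite !size_map => /(_ sz (pts_alg _) (pts_alg _) b0).
rewrite /far allrel_mapl allrel_mapr => /(_ L12) /le_trans; apply.
have npE L : norm_prod N s (pts L) = N s f ^+ size L.
  rewrite /norm_prod /pts; elim: L => [|h L IHL]; first by rewrite big_nil.
  by rewrite /= big_cons IHL exprS.
by rewrite !npE -exprD sz mulrAC.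
Qed.

Let cF T : compact (F T). Proof. by case: folner. Qed.
Let mF T : measurable (F T : set BH). Proof. exact: compact_borel. Qed.
Let mFoo T : (m (F T) < +oo)%E. Proof. exact: (haar_compact_lty haar). Qed.

Let F_oo : fine (m (F T)) @[T --> \oo] --> +oo.
Proof.
apply/cvgryPge => A; have /cvgeyPge/(_ A) := Foo.
by apply: filterS => T; rewrite -lee_fin fineK// ge0_fin_numE.
Qed.

Let psi (h : BH) : R := mexp mu (fun x => u e x * u h x).

Let psi_shift h1 h2 : mexp mu (fun x => u h1 x * u h2 x) = psi (mul (inv h1) h2).
Proof.
have [mulA mul1 mulV] := grpH; have [ma a1 aM aI] := action.
have inv1 : inv e = e by rewrite -[LHS](mul1 _).2 (mulV e).1.
have bu h := bounded_u mu_u uM h.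
have [mg [B gB]] := bounded_mfunM (bu e) (bu (mul (inv h1) h2)).
rewrite /psi -(mexp_act action (inv h1) mg (aeW _ gB)).
congr (mexp mu); apply/funext => x; rewrite /u inv1 a1; congr (_ * ft _).
by rewrite (grp_invM grpH) -aM -mulA (mulV (inv h1)).1 (mul1 _).2.
Qed.

Let bu h : bounded_mfun (u h). Proof. exact: (bounded_u mu_u uM). Qed.

Let psi_le h : `|psi h| <= M * M.
Proof.
apply: normr_mexp_le_cst; first exact: bounded_mfunM.
by move=> x; rewrite normrM ler_pM.
Qed.

Let mpsi : measurable_fun [set: BH] psi.
Proof.
apply: (@measurable_Rintegral_param _ _ _ X BH mu setT (fun x h => u e x * u h x)) => //.
apply: measurable_funM.
  by apply: (measurableT_comp (bu e).1).
exact: (measurableT_comp mu_u (@measurable_swap _ _ _ _)).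
Qed.

(** Decoupling the single point [e] from [h], with gap [d e h] and mean zero, bounds the correlation
    by an exponential of the distance, which subexponential growth makes integrable. *)
Let psi_integrable : m.-integrable [set: BH] (EFin \o psi).
Proof.
have [c c0 [C C0 P]] := dec 2.
have iC : m.-integrable [set: BH] (EFin \o (fun h => C * expR (- c * d e h))).
  have := integrableZl measurableT C (exp_dist_integrable lcsc haar met growth c0).
  by congr (_.-integrable _ _).
apply: le_integrable iC => //; first exact/measurable_EFinP.
move=> h _; rewrite lee_fin [leRHS]ger0_norm ?mulr_ge0 ?expR_ge0//.
have uprod1 g : uprod u [:: g] = u g.
  by apply/funext => x; rewrite /uprod big_seq1.
have uprod2 : uprod u [:: e; h] = fun x => u e x * u h x.
  by apply/funext => x; rewrite /uprod !big_cons big_nil mulr1.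
have := P [:: e] [:: h] (d e h) isT (dist_ge0 met e h).
rewrite /= uprod2 !uprod1 u_mean mul0r subr0; apply.
by rewrite allrel_consl /= allrel_consr /= lexx.
Qed.

Let v := Rintegral m [set: BH] (fun h => mexp mu (fun x => f x * act_fun inv a h f x)).

Let vE : v = Rintegral m [set: BH] psi.
Proof.
have [mulA mul1 mulV] := grpH; have [ma a1 aM aI] := action.
have inv1 : inv e = e by rewrite -[LHS](mul1 _).2 (mulV e).1.
apply: eq_Rintegral => h _; apply: eq_mexp_ae.
- by apply: measurable_funM => //; exact: (measurable_act_fun inv action).
- by case: (bounded_mfunM (bu e) (bu h)).
apply: filterS2 (ft_ae) (u_act h) => x fx hx.
by rewrite hx fx /u inv1 a1.
Qed.

Let Y := normalized m u F.

(** Opening both factors of the square gives the double integral of [psi (mul (inv h1) h2)], that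
    is, a Folner average of [psi]. *)
Let var_cvg : mexp mu (fun x => Y T x ^+ 2) @[T --> \oo] --> v.
Proof.
rewrite vE; apply: cvg_trans (folner_average lcsc haar folner Foo psi_le psi_integrable).
apply: near_eq_cvg; apply: nearW => T.
have bZ : bounded_mfun (Zint m u (F T)) by exact: (bounded_Zint mu mu_u uM).
have -> : mexp mu (fun x => Y T x ^+ 2) =
    (fine (m (F T)))^-1 * mexp mu (fun x => Zint m u (F T) x * Zint m u (F T) x).
  rewrite -mexpZl; last exact: bounded_mfunM.
  congr (mexp mu); apply/funext => x; rewrite /Y /normalized exprMn exprVn.
  by rewrite sqr_sqrtr ?fine_ge0.
congr (_ * _); rewrite (mexp_peel mu mu_u uM (mF T) (mFoo T) bZ).1.
apply: eq_Rintegral => h1 _.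
have -> : (fun x => Zint m u (F T) x * u h1 x) = (fun x => u h1 x * Zint m u (F T) x).
  by apply/funext => x; rewrite mulrC.
rewrite (mexp_peel mu mu_u uM (mF T) (mFoo T) (bu h1)).1.
by apply: eq_Rintegral => h2 _; rewrite psi_shift.
Qed.

(** Not visible on the integral of correlations: the sign is inherited from the second moments that
    converge to it. *)
Let v_ge0 : 0 <= v.
Proof.
apply: (@cvgr_to_ge _ _ _ _ _ _ _ var_cvg).
by apply: nearW => T; apply: Rintegral_ge0 => x _; exact: sqr_ge0.
Qed.

Lemma clt_truncated : cvg_dist_normal mu
  (fun (T : nat) (x : X) => (Num.sqrt (fine (m (F T))))^-1
     * Rintegral m (F T) (fun h => act_fun inv a h f x)) v.
Proof.
split => // phi cphi phiB.
have [nu [nu_mom nuE nu_phi]] := gaussian_law v_ge0.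
have dtri : forall x y z, d x z <= d x y + d y z by case: met.
have mom n : mexp mu (fun x => Y T x ^+ n) @[T --> \oo] --> gaussian_moment v n.
  apply: (moments_cvg M1 mu_u uM dtri (measurable_dball met) u_mean dec _ mF mFoo F_oo var_cvg).
  by move=> eps eps0; exact: (haar_volume lcsc haar met growth eps0).
have bY T : bounded_mfun (Y T) by exact: (bounded_normalized mu mu_u uM mF mFoo).
have mY T : has_moments mu (Y T).
  by split => [|n]; [case: (bY T)|apply: bounded_mfun_integrable; exact: bounded_mfunX].
have mphi : measurable_fun setT phi by exact: continuous_measurable_fun.
have bphi : bounded_mfun phi by [].
rewrite -(nu_phi _ bphi).
apply: cvg_trans (moments_weak_cvg mY nu_mom nuE mom cphi phiB).
apply: near_eq_cvg; apply: nearW => T.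
have mw : measurable_fun [set: BH * X] (fun p : BH * X => act_fun inv a p.1 f p.2).
  exact: (measurableT_comp mf mainv).
apply: eq_mexp_ae.
- by apply: (measurableT_comp mphi); case: (bY T).
- apply: (measurableT_comp mphi); apply: measurable_funM => //.
  exact: (@measurable_Rintegral_param _ _ _ BH X m (F T) (fun h => act_fun inv a h f)).
have := ae_eq_Rintegral_param (mF T) (mFoo T) mw mu_u u_act.
apply: filterS => x ZE; congr phi; rewrite /Y /normalized; congr (_ * _).
exact/esym.
Qed.

End clt.

Theorem theorem1p1 (R : realType) (H : ptopologicalType)
  (mul : H -> H -> H) (inv : H -> H) (e : H)
  (mH : {measure set borel_of H -> \bar R}) (d : H -> H -> R)
  (F : nat -> set H)
  (dX : measure_display) (X : measurableType dX) (mu : probability X R)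
  (a : H -> X -> X) (Ainv : set (X -> R)) (N : nat -> (X -> R) -> R) :
  lcsc_group mul inv e ->
  left_Haar mul mH ->
  proper_left_inv_metric mul d ->
  subexp_growth mH d e ->
  right_Folner mul mH F ->
  mH (F T) @[T --> \oo] --> +oo%E ->
  mp_action mul e mu a ->
  inv_subalgebra inv a mu Ainv ->
  good_seminorms d e inv a mu Ainv N ->
  exp_mixing_all_orders d inv a mu Ainv N ->
  forall f : X -> R, Ainv f -> mexp mu f = 0 ->
  cvg_dist_normal mu
    (fun (T : nat) (x : X) =>
       (Num.sqrt (fine (mH (F T))))^-1
       * Rintegral mH (F T) (fun h => act_fun inv a h f x))
    (Rintegral mH [set: borel_of H]
       (fun h => mexp mu (fun x => f x * act_fun inv a h f x))).
Proof.
move=> lcsc haar met growth folner Foo action alg norms mixing f fA f_mean.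
have sf : sigma_finite [set: borel_of H] mH.
  have [_ _ _ [_ _ cball]] := met.
  (* Properness of [d] makes these closed balls compact, hence of finite Haar measure. *)
  exists (fun n => [set y | d e y <= n%:R]) => [|n].
    apply/seteqP; split => // y _; exists (Num.bound (d e y)) => //=.
    by apply/ltW/archi_boundP; exact: (dist_ge0 met).
  split; first by apply: compact_borel => //; case: lcsc.
  by case: haar => _ + _; apply; exact: cball.
move: haar growth folner Foo.
pose Q (m : {measure set borel_of H -> \bar R}) := left_Haar mul m ->
  subexp_growth m d e -> right_Folner mul m F -> m (F T) @[T --> \oo] --> +oo%E ->
  cvg_dist_normal mu
    (fun (T : nat) (x : X) => (Num.sqrt (fine (m (F T))))^-1
       * Rintegral m (F T) (fun h => act_fun inv a h f x))
    (Rintegral m [set: borel_of H]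
       (fun h => mexp mu (fun x => f x * act_fun inv a h f x))).
suff : Q mH by [].
apply: sigma_finite_packing sf _ => m haar growth folner Foo.
have [/(_ _ fA)[_ [M0 fM0]] _ _ _] := alg.
(* The moment estimates, [shifted_power_le] in particular, are run with a bound at least 1. *)
have M1 : 1 <= Num.max 1 M0 by rewrite le_max lexx.
have fM : {ae mu, forall x, `|f x| <= Num.max 1 M0}.
  by apply: filterS fM0 => x /le_trans; apply; rewrite le_max lexx orbT.
exact: (clt_truncated lcsc haar met growth folner Foo action alg norms mixing
  fA f_mean M1 fM).
Qed.
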